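(* Let $\alpha>0$ and let $\Phi^t(\theta)=\theta+\alpha t \bmod 2\pi$ be the rotation flow on the circle $\mathbb T$. Fix $p\in(0,1)$ (the exponent defining the weights $\lambda_\tau$), $\kappa>0$, $t\in\mathbb R$, $d=2$, and an integer $m\ge 2d+1$. Let $W_{\tau,m}$ be the finite-rank approximate generators obtained from either of the two schemes (a), (b) described in the context. Then for every $f\in L^\infty(\mathbb T)$ there are constants $c_1,c_2\in\mathbb R_{>0}$, depending on $\kappa,d,\alpha,t$ and $p$, such that for every $\theta\in\mathbb T$, with $n=\lceil c_1/\varepsilon\rceil$ and $\tau=c_2\varepsilon^2$ (and $d=2$, $t$, $\kappa$, $m$ held constant), $$\lim_{\varepsilon\to0^+}\tilde f^{(t)}_{\kappa,0,\tau,n,d,m}(\theta)=\mathbb E_{p_{\theta,2\kappa}}(U^tf)=\int_{\mathbb T}f(\Phi^t(\theta'))\,p_{\theta,2\kappa}(\theta')\,d\mu(\theta'),$$ where $\tilde f^{(t)}_{\kappa,0,\tau,n,d,m}$ is the Fock space approximation defined in the context.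
   Context: Conventions: inner products are linear in the second argument. $\mu$ is the normalized Haar measure on $\mathbb T=\mathbb R/2\pi\mathbb Z$; $H=L^2(\mathbb T)=L^2(\mu)$; $U^tf=f\circ\Phi^t$, with skew-adjoint generator $V$ on $H$ ($U^t=e^{tV}$). $\iota$ sends a continuous function to its $\mu$-equivalence class. $\phi_j\in H$ is the class of $e^{ij\theta}$, $j\in\mathbb Z$, so $V\phi_j=i\alpha j\phi_j$. Von Mises densities: $p_{\mu_0,\kappa}(\theta)=e^{\kappa\cos(\theta-\mu_0)}/I_0(\kappa)$, with $I_0$ the modified Bessel function of the first kind of order $0$; these integrate to $1$ against $\mu$. RKHA. For $\tau>0$ let $\lambda_\tau(j)=e^{-\tau|j|^p}$, $j\in\mathbb Z$, and $k_\tau(\theta,\theta')=\sum_{j\in\mathbb Z}\lambda_\tau(j)e^{ij(\theta'-\theta)}$, with RKHS $\mathcal H_\tau\subset C(\mathbb T)$ and orthonormal basis $\psi_{j,\tau}=\sqrt{\lambda_\tau(j)}\,e^{ij\theta}$, $j\in\mathbb Z$. $\mathcal H_\tau$ is a reproducing kernel Hilbert algebra: the map $k_\tau(\theta,\cdot)\mapsto k_\tau(\theta,\cdot)\otimes k_\tau(\theta,\cdot)$ extends to a bounded linear map $\Delta:\mathcal H_\tau\to\mathcal H_\tau\otimes\mathcal H_\tau$, whose adjoint is pointwise multiplication. Set $\Delta_0=\mathrm{Id}$, $\Delta_1=\Delta$, $\Delta_n=(\Delta\otimes\mathrm{Id}^{\otimes(n-1)})\Delta_{n-1}$ for $n>1$,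 so $\Delta_{n-1}^*:\mathcal H_\tau^{\otimes n}\to\mathcal H_\tau$ is the $n$-fold pointwise product. $K_\tau:H\to\mathcal H_\tau$, $K_\tau f=\int k_\tau(\cdot,\theta)f(\theta)\,d\mu(\theta)$; $K_\tau^*=\iota|_{\mathcal H_\tau}$; $\mathcal K_\tau=K_\tau^*K_\tau$ on $H$; $K_\tau=T_\tau\mathcal K_{\tau/2}$ is the polar decomposition, with $T_\tau:H\to\mathcal H_\tau$ isometric, $T_\tau\phi_j=\psi_{j,\tau}$. Approximate generator: two schemes. Each scheme gives a skew-adjoint regularized generator on $H$, which is transported to $\mathcal H_\tau$ by conjugation with $T_\tau$. (a) Compact approximation: $V_\tau=\mathcal K_{\tau/2}V\mathcal K_{\tau/2}$ on $H$ and $W_\tau=T_\tau V_\tau T_\tau^*$ on $\mathcal H_\tau$. (b) Approximation with compact resolvent, with a resolvent parameter $z>0$: let $\tilde H\subset H$ be the subspace of functions with zero $\mu$-mean, $\tilde\Pi$ the orthogonal projection of $H$ onto $\tilde H$, $R_z=(z-V)^{-1}$, and $Q_{z,\tau}=R_z^*\mathcal K_{\tau/2}V\mathcal K_{\tau/2}R_z$ on $\tilde H$. Let $\tilde q_z^{-1}(i\omega)=i\,\frac{1+\sqrt{1-4z^2\omega^2}}{2\omega}$ for $0<|\omega|\le \frac1{2z}$ (the inverse of $i\omega\mapsto i\omega/(z^2+\omega^2)$ restricted to $|\omega|\ge z$). Put $V_{z,\tau}=\tilde q_z^{-1}(Q_{z,\tau})\tilde\Pi$ (functional calculus) and $W_{z,\tau}=T_\tau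 V_{z,\tau}T_\tau^*$ on $\mathcal H_\tau$. With the Fourier indices enumerated as $0,1,-1,2,-2,\dots$, let $\mathcal H_{\tau,m}$ be the span of the first $m+1$ of the functions $\psi_{0,\tau},\psi_{1,\tau},\psi_{-1,\tau},\psi_{2,\tau},\psi_{-2,\tau},\dots$, and let $W_{\tau,m}$ be the compression to $\mathcal H_{\tau,m}$ (extended by $0$ on $\mathcal H_{\tau,m}^\perp$) of $W_\tau$ in scheme (a), or of $W_{z,\tau}$ in scheme (b). In both schemes the functions $\psi_{j,\tau}$ in $\mathcal H_{\tau,m}$ are chosen as the eigenfunctions, in the order $\psi_{0,\tau},\psi_{1,\tau},\psi_{-1,\tau},\psi_{2,\tau},\psi_{-2,\tau},\dots$ (increasing Dirichlet energy). The eigenvalue of $W_{\tau,m}$ on $\psi_{j,\tau}$ is $i\alpha j\lambda_\tau(j)$ in scheme (a); in scheme (b) it is $0$ for $j=0$ and $\tilde q_z^{-1}\!\left(\frac{i\alpha j\lambda_\tau(j)}{z^2+\alpha^2j^2}\right)$ for $j\ne0$. Let $U^t_{\tau,m}=e^{tW_{\tau,m}}$. Let $Z_{\tau,d,m}$ be the orthogonal projection of $\mathcal H_\tau$ onto the span of the first $2d+1$ eigenfunctions, i.e. $\operatorname{span}\{\psi_{j,\tau}:|j|\le d\}$. Fock space. $F(\mathcal H_\tau)$ is the Hilbert space completion of $\mathbb C\oplus\mathcal H_\tau\oplus\mathcal H_\tau^{\otimes2}\oplus\cdots$; $\Delta_{n-1}$ is viewed as a map into $\mathcal H_\tau^{\otimes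 n}\subset F(\mathcal H_\tau)$. $\tilde U^t_{\tau,m}$ is the unitary on $F(\mathcal H_\tau)$ acting trivially on $\mathbb C$ and as $(U^t_{\tau,m})^{\otimes n}$ on $\mathcal H_\tau^{\otimes n}$. For a trace class operator $\rho$, $\tilde{\mathcal P}^t_{\tau,m}\rho=\tilde U^{t*}_{\tau,m}\rho\,\tilde U^t_{\tau,m}$, and $\mathbb E_\rho A=\operatorname{tr}(\rho A)$. Observable (with smoothing parameter $\sigma=0$): for $f\in L^\infty(\mathbb T)$ let $M_f$ be multiplication by $f$ on $H$, and $A_{f,0,\tau,n}=\Delta_{n-1}K_\tau M_fK_\tau^*\Delta_{n-1}^*\in B(F(\mathcal H_\tau))$; $A_{\mathbf 1,0,\tau,n}$ is the case where $f$ is the constant function $\mathbf 1$. Quantum feature map. Fix a unit vector $w\in\ell^2(\mathbb N)$ with strictly positive entries. For $\theta\in\mathbb T$ let $\xi=p_{\theta,\kappa}/\|p_{\theta,\kappa}\|_{\mathcal H_\tau}\in\mathcal H_\tau$ (a strictly positive function, all of whose roots lie in $\mathcal H_\tau$), $\xi_{\tau,n,d,m}=Z_{\tau,d,m}\xi^{1/n}/\|Z_{\tau,d,m}\xi^{1/n}\|_{\mathcal H_\tau}$, $\tilde F_{\kappa,\tau,d,m}(\theta)=\sum_{n=1}^\infty w_n\,\xi_{\tau,n,d,m}^{\otimes n}\in F(\mathcal H_\tau)$, and let $\tilde\Xi_{\kappa,\tau,d,m}(\theta)=\langle\tilde F_{\kappa,\tau,d,m}(\theta),\cdot\rangle\,\tilde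 F_{\kappa,\tau,d,m}(\theta)$. Fock space approximation: $$\tilde f^{(t)}_{\kappa,0,\tau,n,d,m}(\theta)=\frac{\mathbb E_{\tilde{\mathcal P}^t_{\tau,m}(\tilde\Xi_{\kappa,\tau,d,m}(\theta))}A_{f,0,\tau,n}}{\mathbb E_{\tilde{\mathcal P}^t_{\tau,m}(\tilde\Xi_{\kappa,\tau,d,m}(\theta))}A_{\mathbf 1,0,\tau,n}}$$ (defined whenever the denominator is nonzero).
   Formalization: In scheme (b) the resolvent parameter is restricted to 0 < z ≤ α; for fixed z > α the eigenvalues on ψ_{±1,τ} tend to ±iz²/α rather than ±iα, so the stated limit fails for general f and t. *)

(* Defs.v *)
From HB Require Import structures.
From mathcomp Require Import all_boot all_order all_algebra.
From mathcomp Require Import complex.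
From mathcomp Require Import all_classical all_reals all_analysis.

Set Implicit Arguments.
Unset Strict Implicit.
Unset Printing Implicit Defensive.

Import Order.TTheory GRing.Theory Num.Theory.
Import numFieldNormedType.Exports.

Local Open Scope classical_set_scope.
Local Open Scope ring_scope.
Local Open Scope complex_scope.

(* A separable Hilbert space with a fixed orthonormal basis indexed by a
   countable set I is represented by l^2(I): a vector is the family of its
   coordinates, an operator is a map between coordinate families, of which only
   the values on square-summable families matter.
     - H = L^2(T)         : I = int, basis phi_j (class of e^{i j theta});
     - H_tau              : I = int, basis psi_{j,tau};
     - H_tau (x) H_tau    : I = int * int, basis psi_k (x) psi_l;
     - F(H_tau)           : I = seq int, basis psi_{s_1} (x) ... (x) psi_{s_n}
                            for s = [:: s_1; ...; s_n]; H_tau^{(x) n} is spanned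
                            by the s of size n and [::] is the vacuum.
   Functions on the circle are 2 pi-periodic functions on R. *)

Section Hilbert.
Variable R : realType.
Local Notation C := R[i].

(* Unconditional sum (net limit over finite subsets) of an absolutely summable
   family; junk value otherwise. *)
Definition rsum (I : choiceType) (a : I -> R) : R :=
  fine (\esum_(i in [set: I]) ((EFin \o a)^\+ i) -
        \esum_(i in [set: I]) ((EFin \o a)^\- i))%E.

Definition csum (I : choiceType) (a : I -> C) : C :=
  rsum (fun i => complex.Re (a i)) +i* rsum (fun i => complex.Im (a i)).

Definition sqmod (z : C) : R := complex.Re z ^+ 2 + complex.Im z ^+ 2.

Definition sqnorm (I : choiceType) (x : I -> C) : \bar R :=
  \esum_(i in [set: I]) (sqmod (x i))%:E.

Definition ell2 (I : choiceType) (x : I -> C) : Prop := (sqnorm x < +oo)%E.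

Definition l2norm (I : choiceType) (x : I -> C) : R :=
  Num.sqrt (fine (sqnorm x)).

Definition inner (I : choiceType) (x y : I -> C) : C :=
  csum (fun i => (x i)^* * y i).

Definition basis_vec (I : choiceType) (i : I) : I -> C := fun j => (j == i)%:R.

Definition bounded_linear (I J : choiceType) (T : (I -> C) -> (J -> C)) : Prop :=
  (forall (c : C) (x y : I -> C), ell2 x -> ell2 y ->
     T (fun i => c * x i + y i) = (fun j => c * T x j + T y j)) /\
  (exists M : R, forall x : I -> C, ell2 x -> (sqnorm (T x) <= M%:E * sqnorm x)%E).

(* <e_i, T^* y> = <T e_i, y>. *)
Definition adjoint (I J : choiceType) (T : (I -> C) -> (J -> C))
  : (J -> C) -> (I -> C) := fun y i => inner (T (basis_vec i)) y.

Definition op_trace (I : choiceType) (T : (I -> C) -> (I -> C)) : C :=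
  csum (fun i => T (basis_vec i) i).

Definition expectation (I : choiceType) (rho A : (I -> C) -> (I -> C)) : C :=
  op_trace (rho \o A).

Definition rank_one (I : choiceType) (x : I -> C) : (I -> C) -> (I -> C) :=
  fun y i => inner x y * x i.

Definition opscale (I : choiceType) (c : C) (T : (I -> C) -> (I -> C))
  : (I -> C) -> (I -> C) := fun x i => c * T x i.

Definition opexp (I : choiceType) (T : (I -> C) -> (I -> C))
  : (I -> C) -> (I -> C) :=
  fun x i => csum (fun k : nat => (k`!%:R)^-1 * iter k T x i).

Definition diag_op (I : choiceType) (c : I -> C) : (I -> C) -> (I -> C) :=
  fun x i => c i * x i.

(* Functional calculus h(T), for T diagonal in the fixed basis. *)
Definition funcalc (I : choiceType) (h : C -> C) (T : (I -> C) -> (I -> C))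
  : (I -> C) -> (I -> C) := diag_op (fun i => h (T (basis_vec i) i)).

Definition tensor2 (I : choiceType) (x y : I -> C) : I * I -> C :=
  fun k => x k.1 * y k.2.

(* x^{(x) n}, as a vector of the Fock space. *)
Definition tensor_power (I : choiceType) (n : nat) (x : I -> C) : seq I -> C :=
  fun s => if size s == n then \prod_(i <- s) x i else 0.

(* The operator on the Fock space that is the identity on the vacuum and
   U^{(x) n} in degree n: U acts on the first index, recursively the same
   construction acts on the remaining ones. *)
Fixpoint fock_lift_at (I : choiceType) (U : (I -> C) -> (I -> C)) (s : seq I)
    (y : seq I -> C) : C :=
  if s is i :: s' then
    U (fun k => fock_lift_at U s' (fun r => y (k :: r))) i
  else y [::].

Definition fock_lift (I : choiceType) (U : (I -> C) -> (I -> C))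
  : (seq I -> C) -> (seq I -> C) := fun y s => fock_lift_at U s y.

(* D (x) Id^{(x) (n-1)} on each degree n >= 1, for D : H -> H (x) H. *)
Definition on_first (I : choiceType) (D : (I -> C) -> (I * I -> C))
  : (seq I -> C) -> (seq I -> C) :=
  fun y s => if s is k :: l :: r then D (fun j => y (j :: r)) (k, l) else 0.

(* D_0 = Id (H seen as degree 1 of the Fock space),
   D_n = (D (x) Id^{(x) (n-1)}) D_{n-1}. *)
Fixpoint iter_comult (I : choiceType) (D : (I -> C) -> (I * I -> C)) (n : nat)
  : (I -> C) -> (seq I -> C) :=
  if n is n'.+1 then on_first D \o iter_comult D n'
  else fun x s => if s is [:: j] then x j else 0.

End Hilbert.

Section Circle.
Variable R : realType.
Local Notation C := R[i].

(* Integral against the normalized Haar measure of R / 2 pi Z. *)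
Definition haar (g : R -> C) : C :=
  let I (h : R -> R) :=
    (2 * pi)^-1 * \int[@lebesgue_measure R]_(x in `[0, 2 * pi]) h x in
  I (fun x => complex.Re (g x)) +i* I (fun x => complex.Im (g x)).

Definition Linfty_circle (f : R -> C) : Prop :=
  [/\ forall x, f (x + 2 * pi) = f x,
      measurable_fun [set: R] (fun x => complex.Re (f x)),
      measurable_fun [set: R] (fun x => complex.Im (f x)) &
      exists M : R, {ae @lebesgue_measure R, forall x, sqmod (f x) <= M}].

Definition char (j : int) (x : R) : C := cos (j%:~R * x) +i* sin (j%:~R * x).

Definition rotation (alpha t : R) (x : R) : R := x + alpha * t.

Definition koopman (alpha t : R) (f : R -> C) : R -> C := f \o rotation alpha t.

(* I_0(x) = sum_k (x/2)^{2k} / (k!)^2 *)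
Definition besselI0 (x : R) : R :=
  limn (series (fun k : nat => (x / 2) ^+ (2 * k) / (k`!%:R) ^+ 2)).

Definition von_mises (mu0 kappa : R) (x : R) : R :=
  expR (kappa * cos (x - mu0)) / besselI0 kappa.

(* 0, 1, -1, 2, -2, ... *)
Definition fourier_index (k : nat) : int :=
  if odd k then (uphalf k)%:Z else - (k./2)%:Z.

(* Orthogonal projection onto the span of the first k basis vectors. *)
Definition proj_first (k : nat) (x : int -> C) : int -> C :=
  fun j => if j \in [seq fourier_index i | i <- iota 0 k] then x j else 0.

End Circle.

Section RKHA.
Variable R : realType.
Variable p : R.
Local Notation C := R[i].

Definition weight (tau : R) (j : int) : R := expR (- tau * `|j%:~R| `^ p).

Definition rk_kernel (tau x y : R) : C :=
  csum (fun j : int => (weight tau j)%:C * char j (y - x)).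

Definition psi (tau : R) (j : int) (x : R) : C :=
  (Num.sqrt (weight tau j))%:C * char j x.

(* <psi_{j,tau}, g>_{H_tau} for a function g in H_tau: if g = sum_j a_j psi_j,
   then the j-th Fourier coefficient of g is a_j sqrt(lambda_tau(j)). *)
Definition rk_coord (tau : R) (g : R -> C) : int -> C :=
  fun j => haar (fun x => (char j x)^* * g x) / (Num.sqrt (weight tau j))%:C.

(* K_tau^*, the inclusion of H_tau into H. *)
Definition rk_inclusion (tau : R) (a : int -> C) : R -> C :=
  fun x => csum (fun j => a j * psi tau j x).

Definition Kint (tau : R) (f : R -> C) : int -> C :=
  rk_coord tau (fun x => haar (fun y => rk_kernel tau x y * f y)).

Definition is_comult (tau : R) (D : (int -> C) -> (int * int -> C)) : Prop :=
  bounded_linear D /\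
  forall x : R, let kx := rk_coord tau (rk_kernel tau x) in D kx = tensor2 kx kx.

(* The bounded linear map with k_x |-> k_x (x) k_x; it exists for 0 < p < 1 and
   tau > 0, and is unique on l^2 since the k_x span a dense subspace. *)
Definition comult (tau : R) : (int -> C) -> (int * int -> C) :=
  match pselect (exists D, is_comult tau D) with
  | left e => projT1 (cid e)
  | right _ => fun _ _ => 0
  end.

Definition comult_n (tau : R) (n : nat) : (int -> C) -> (seq int -> C) :=
  iter_comult (comult tau) n.

Definition observable (f : R -> C) (tau : R) (n : nat)
  : (seq int -> C) -> (seq int -> C) :=
  fun y => comult_n tau n.-1
    (Kint tau (fun x => f x * rk_inclusion tau (adjoint (comult_n tau n.-1) y) x)).

Section Generator.
Variable alpha : R.

Definition generatorV : (int -> C) -> (int -> C) :=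
  diag_op (fun j => 0 +i* (alpha * j%:~R)).

(* K_tau^* K_tau on H. *)
Definition Kself (tau : R) : (int -> C) -> (int -> C) :=
  diag_op (fun j => (weight tau j)%:C).

Definition resolvent (z : R) : (int -> C) -> (int -> C) :=
  diag_op (fun j => (z +i* (- (alpha * j%:~R)))^-1).

Definition Vcompact (tau : R) : (int -> C) -> (int -> C) :=
  Kself (tau / 2) \o generatorV \o Kself (tau / 2).

Definition Qresolvent (z tau : R) : (int -> C) -> (int -> C) :=
  adjoint (resolvent z) \o Vcompact tau \o resolvent z.

Definition qinv (z : R) (w : C) : C :=
  let omega := complex.Im w in
  0 +i* ((1 + Num.sqrt (1 - 4 * z ^+ 2 * omega ^+ 2)) / (2 * omega)).

Definition proj_zero_mean (x : int -> C) : int -> C :=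
  fun j => if j == 0 then 0 else x j.

Definition Vresolvent (z tau : R) : (int -> C) -> (int -> C) :=
  funcalc (qinv z) (Qresolvent z tau) \o proj_zero_mean.

Inductive scheme : Type :=
| CompactApprox
| CompactResolvent of R.

(* For z > alpha the eigenvalues +/- i alpha of the generator lie outside the
   range {i omega : |omega| >= z} of the branch qinv z. *)
Definition admissible (s : scheme) : Prop :=
  match s with
  | CompactApprox => True
  | CompactResolvent z => 0 < z <= alpha
  end.

(* Conjugation by T_tau, which maps phi_j to psi_{j,tau}, is the identity on
   coordinates: this is both the regularized generator on H and its transport
   to H_tau. *)
Definition generatorW (s : scheme) (tau : R) : (int -> C) -> (int -> C) :=
  match s with
  | CompactApprox => Vcompact tau
  | CompactResolvent z => Vresolvent z tau
  end.

Definition generatorWm (s : scheme) (tau : R) (m : nat)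
  : (int -> C) -> (int -> C) :=
  @proj_first R m.+1 \o generatorW s tau \o @proj_first R m.+1.

Definition Um (s : scheme) (tau : R) (m : nat) (t : R)
  : (int -> C) -> (int -> C) := opexp (opscale t%:C (generatorWm s tau m)).

Definition evolve (s : scheme) (tau : R) (m : nat) (t : R)
    (rho : (seq int -> C) -> (seq int -> C)) : (seq int -> C) -> (seq int -> C) :=
  let U := fock_lift (Um s tau m t) in adjoint U \o rho \o U.

End Generator.

Section Feature.
Variables (w : nat -> R) (kappa tau : R) (d : nat) (theta : R).

Definition xi (x : R) : R :=
  von_mises theta kappa x /
    l2norm (rk_coord tau (fun y => (von_mises theta kappa y)%:C)).

Definition xi_n (n : nat) : int -> C :=
  let v := proj_first d.*2.+1
             (rk_coord tau (fun x => (xi x `^ (n%:R)^-1)%:C)) in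
  fun j => v j / (l2norm v)%:C.

(* w k is the entry of index k + 1 of the weight vector. *)
Definition feature : seq int -> C :=
  fun s => csum (fun k : nat => (w k)%:C * tensor_power k.+1 (xi_n k.+1) s).

Definition feature_state : (seq int -> C) -> (seq int -> C) := rank_one feature.

End Feature.

(* E_{P^t(Xi(theta))} A_{f,0,tau,n} *)
Definition fock_expectation (alpha : R) (s : scheme) (w : nat -> R)
    (kappa tau : R) (n d m : nat) (t theta : R) (f : R -> C) : C :=
  expectation (evolve alpha s tau m t (feature_state w kappa tau d theta))
              (observable f tau n).

Definition fock_approx (alpha : R) (s : scheme) (w : nat -> R)
    (kappa tau : R) (n d m : nat) (t theta : R) (f : R -> C) : C :=
  fock_expectation alpha s w kappa tau n d m t theta f /
  fock_expectation alpha s w kappa tau n d m t theta (fun=> 1).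

End RKHA.

(* Strictly positive unit vector of l^2. *)
Definition positive_unit (R : realType) (w : nat -> R) : Prop :=
  (forall k, 0 < w k) /\ (series (fun k => w k ^+ 2) @ \oo --> (1 : R)).

Definition ceil_nat (R : realType) (x : R) : nat := `|Num.ceil x|%N.

(* R[i] seen through its numClosedFieldType structure, which carries the topology
   of the complex modulus. *)
Definition complex_field (R : realType) : numClosedFieldType := R[i].

(* Main.v *)
Require Import Defs.
From HB Require Import structures.
From mathcomp Require Import all_boot all_order all_algebra.
From mathcomp Require Import complex.
From mathcomp Require Import all_classical all_reals all_analysis.
From mathcomp Require Import finmap measurable_realfun.
From mathcomp Require Import zify ring lra.

(** The comultiplication of a reproducing kernel Hilbert algebra is dual to the
    pointwise product. In the basis of the [psi_j] it is explicit
    ([comult_coord]): it is bounded because the weights are subconvolutive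
    ([weight_subconv]), and it is the only bounded map with the prescribed values
    because the kernel sections span a dense subspace ([is_comult_unique]).
    Therefore the matrix of the observable in degree [n] is the matrix of
    multiplication by [f] between products of [n] basis functions
    ([observable_basis]).

    Both regularized generators are diagonal, so the evolution multiplies each
    frequency by a phase ([Um_diag]). The feature state is of rank one, its
    component of degree [n] is a tensor power, and only the five frequencies
    [0, 1, -1, 2, -2] occur. The trace is thus a finite double sum over words of
    length [n], which factors under the integral
    ([expectation_observable], [fock_expectationE]): it is
    [K * haar (|profile|^{2n} f)] with [K > 0] independent of [f], so that [K]
    disappears from the quotient. Here [profile] is the truncated Fourier series
    of [e^{b cos (x - theta)}], with [b = kappa / n], whose [j]-th term carries
    the phase of the approximate evolution.

    To first order in [b] a von Mises exponential is [1 + b cos (x - theta)],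
    which contains the frequencies [0, 1, -1] only. As [tau -> 0] the approximate
    eigenvalues tend to the exact ones ([cvg_frequency]), so the profile differs
    from [e^{b cos (x - theta - alpha t)}] by [b * o(1)] uniformly in [x]
    ([profile_error]). Its [2n]-th power then tends to
    [e^{2 kappa cos (x - theta - alpha t)}] uniformly ([profile_power]): the
    large tensor degree compensates the truncation to few frequencies. In the
    quotient, the denominator tends to the integral of this function, which is
    [I_0(2 kappa)] ([haar_expcos]), and translation invariance ([haar_rotated])
    puts the rotation on [f]. *)

Import Order.TTheory GRing.Theory Num.Theory.
Import numFieldNormedType.Exports.
Local Open Scope classical_set_scope.
Local Open Scope ring_scope.
Local Open Scope complex_scope.

Set Implicit Arguments.
Unset Strict Implicit.
Unset Printing Implicit Defensive.

(* The conjugation of [R[i]] as a numeric field unfolds to [conjc]; all lemmas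
   use this form. *)
Local Notation "x ^*" := (conjc x) : ring_scope.

(** * The complex modulus and unconditional sums *)

Section Modulus.
Variable R : realType.
Local Notation C := R[i].
Implicit Types z w : C.

(** The norm of the numeric field [R[i]] takes its values in [R[i]]; estimates
    need it as a real number. *)
Definition modc z : R := Num.sqrt (sqmod z).

Lemma normc_modc z : `|z| = (modc z)%:C.
Proof. by rewrite normc_def. Qed.

Lemma modc_ge0 z : 0 <= modc z.
Proof. exact: sqrtr_ge0. Qed.

Lemma sqmod_ge0 z : 0 <= sqmod z.
Proof. by rewrite addr_ge0 ?sqr_ge0. Qed.

Lemma sqmodE z : sqmod z = modc z ^+ 2.
Proof. by rewrite sqr_sqrtr ?sqmod_ge0. Qed.

Lemma modc_le_add z w : modc (z + w) <= modc z + modc w.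
Proof. by rewrite -lecR rmorphD /= -!normc_modc ler_normD. Qed.

Lemma modcM z w : modc (z * w) = modc z * modc w.
Proof. by apply: (@complexI R); rewrite rmorphM /= -!normc_modc normrM. Qed.

Lemma modcV z : modc z^-1 = (modc z)^-1.
Proof. by apply: (@complexI R); rewrite fmorphV /= -!normc_modc normfV. Qed.

Lemma modcN z : modc (- z) = modc z.
Proof. by apply: (@complexI R); rewrite -!normc_modc normrN. Qed.

Lemma modcB z w : modc (z - w) = modc (w - z).
Proof. by rewrite -modcN opprB. Qed.

Lemma modc_le_sub z w : modc (z - w) <= modc z + modc w.
Proof. by rewrite (le_trans (modc_le_add _ _))// modcN. Qed.

Lemma modcX z n : modc (z ^+ n) = modc z ^+ n.
Proof. by apply: (@complexI R); rewrite rmorphXn /= -!normc_modc normrX. Qed.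

Lemma modcR (x : R) : modc x%:C = `|x|.
Proof. by rewrite /modc /sqmod /= expr0n addr0 sqrtr_sqr. Qed.

Lemma modc0 : modc 0 = 0. Proof. by rewrite (modcR 0) normr0. Qed.

Lemma modc1 : modc 1 = 1. Proof. by rewrite (modcR 1) normr1. Qed.

Lemma modc_eq0 z : (modc z == 0) = (z == 0).
Proof. by rewrite -(inj_eq (@complexI R)) -normc_modc normr_eq0. Qed.

Lemma modcJ z : modc z^* = modc z.
Proof. by apply: (@complexI R); rewrite -!normc_modc normcJ. Qed.

Lemma Re_le_modc z : `|complex.Re z| <= modc z.
Proof. by rewrite -lecR -normc_modc normc_ge_Re. Qed.

Lemma Im_le_modc z : `|complex.Im z| <= modc z.
Proof. by rewrite -sqrtr_sqr ler_wsqrtr// lerDr sqr_ge0. Qed.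

Lemma modc_le_ReIm z : modc z <= `|complex.Re z| + `|complex.Im z|.
Proof.
rewrite -(@ler_pXn2r _ 2) ?nnegrE ?modc_ge0 ?addr_ge0//.
rewrite -sqmodE /sqmod sqrrD !real_normK ?num_real// [X in _ <= X]addrAC.
by rewrite lerDl mulrn_wge0 ?mulr_ge0.
Qed.

Lemma modc_sum (I : Type) (s : seq I) (P : pred I) (F : I -> C) :
  modc (\sum_(i <- s | P i) F i) <= \sum_(i <- s | P i) modc (F i).
Proof.
elim/big_ind2 : _ => // [|x1 y1 x2 y2 h1 h2]; first by rewrite modc0.
exact: le_trans (modc_le_add _ _) (lerD h1 h2).
Qed.

Lemma modc_prod (I : Type) (s : seq I) (P : pred I) (F : I -> C) :
  modc (\prod_(i <- s | P i) F i) = \prod_(i <- s | P i) modc (F i).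
Proof.
by elim/big_ind2 : _ => // [|x1 y1 x2 y2 <- <-]; rewrite ?modc1 ?modcM.
Qed.

Lemma conjM z w : (z * w)^* = z^* * w^*.
Proof. exact: rmorphM. Qed.

Lemma conjR (x : R) : (x%:C)^* = x%:C.
Proof. exact: conjc_real. Qed.

Lemma conj0 : (0 : C)^* = 0.
Proof. exact: rmorph0. Qed.

Lemma conj_sum (I : Type) (s : seq I) (P : pred I) (F : I -> C) :
  (\sum_(i <- s | P i) F i)^* = \sum_(i <- s | P i) (F i)^*.
Proof. exact: rmorph_sum. Qed.

Lemma conj_prod (I : Type) (s : seq I) (P : pred I) (F : I -> C) :
  (\prod_(i <- s | P i) F i)^* = \prod_(i <- s | P i) (F i)^*.
Proof. exact: rmorph_prod. Qed.

Lemma mulcJ z : z * z^* = (modc z ^+ 2)%:C.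
Proof. by rewrite -sqr_normc normc_modc -rmorphXn. Qed.

Lemma ReD z w : complex.Re (z + w) = complex.Re z + complex.Re w.
Proof. by case: z w => [? ?] []. Qed.

Lemma ImD z w : complex.Im (z + w) = complex.Im z + complex.Im w.
Proof. by case: z w => [? ?] []. Qed.

Lemma Re_sum (I : Type) (s : seq I) (P : pred I) (F : I -> C) :
  complex.Re (\sum_(i <- s | P i) F i) = \sum_(i <- s | P i) complex.Re (F i).
Proof. exact: (big_morph _ ReD). Qed.

Lemma Im_sum (I : Type) (s : seq I) (P : pred I) (F : I -> C) :
  complex.Im (\sum_(i <- s | P i) F i) = \sum_(i <- s | P i) complex.Im (F i).
Proof. exact: (big_morph _ ImD). Qed.

End Modulus.

Section CSum.
Variables (R : realType) (I : choiceType).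
Local Notation C := R[i].
Implicit Types (a : I -> C) (u b : I -> R) (s r : seq I).

Definition rsummable b : Prop :=
  (forall i, 0 <= b i) /\ (\esum_(i in [set: I]) (b i)%:E < +oo)%E.

Lemma sum_le_esum u s : (forall i, 0 <= u i) -> uniq s ->
  ((\sum_(i <- s) u i)%:E <= \esum_(i in [set: I]) (u i)%:E)%E.
Proof.
move=> u0 us; apply: esum_ge; exists [set` s]; first by split=> //; exact: finite_seq.
by rewrite -sumEFin (fsbig_seq _ _ us).
Qed.

Lemma esum_le u (M : R) :
  (forall s, uniq s -> \sum_(i <- s) u i <= M) ->
  (\esum_(i in [set: I]) (u i)%:E <= M%:E)%E.
Proof.
move=> uM; apply: ge_ereal_sup => _ [A [finA _] <-].
by rewrite fsbig_finite//= sumEFin lee_fin uM.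
Qed.

Lemma rsummableP b : (forall i, 0 <= b i) ->
  (exists M : R, forall s, uniq s -> \sum_(i <- s) b i <= M) -> rsummable b.
Proof.
by move=> b0 [M bM]; split=> //; apply: le_lt_trans (esum_le bM) (ltry _).
Qed.

Lemma rsummable_fin_num b : rsummable b ->
  \esum_(i in [set: I]) (b i)%:E \is a fin_num.
Proof.
move=> [b0 bfin]; rewrite ge0_fin_numE//.
by apply: esum_ge0 => i _; rewrite lee_fin.
Qed.

Lemma rsummable_le b u : rsummable b -> (forall i, 0 <= u i <= b i) ->
  rsummable u.
Proof.
move=> [b0 bfin] ub; split; first by move=> i; case/andP: (ub i).
by apply: le_lt_trans bfin; apply: le_esum => i _; rewrite lee_fin; case/andP: (ub i).
Qed.

Lemma rsummable_sum_le b : rsummable b ->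
  exists2 M : R, 0 <= M & forall s, uniq s -> \sum_(i <- s) b i <= M.
Proof.
move=> sb; have [b0 _] := sb; have fin := rsummable_fin_num sb.
exists (fine (\esum_(i in [set: I]) (b i)%:E)).
  by apply: fine_ge0; apply: esum_ge0 => i _; rewrite lee_fin.
by move=> s us; rewrite -lee_fin fineK//; exact: sum_le_esum.
Qed.

Lemma rsummable_tail b : rsummable b -> forall e, 0 < e ->
  exists2 s, uniq s & forall r, uniq r -> {in r, forall i, i \notin s} ->
    \sum_(i <- r) b i <= e.
Proof.
move=> sb e e0; have [b0 _] := sb; have fin := rsummable_fin_num sb.
have [_ [A [finA _] <-]] := ub_ereal_sup_adherent e0 fin.
rewrite fsbig_finite//= sumEFin; set s := fset_set A => lts.
exists s => // r ur rs.
have : ((\sum_(i <- s ++ r) b i)%:E <= \esum_(i in [set: I]) (b i)%:E)%E.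
  apply: sum_le_esum => //; rewrite cat_uniq ur andbT fset_uniq/=.
  by apply/hasPn => i /rs.
move: lts; rewrite -/(esum _ _) big_cat/= -(fineK fin) -EFinB lte_fin lee_fin.
by move=> h1 h2; lra.
Qed.

Lemma sum_subset_le u s r : (forall i, 0 <= u i) -> uniq s -> uniq r ->
  {subset r <= s} -> \sum_(i <- r) u i <= \sum_(i <- s) u i.
Proof.
move=> u0 us ur rs; rewrite [leRHS](bigID (mem r))/= -[in leRHS]big_filter.
rewrite [X in _ <= X + _](perm_big r); first by rewrite lerDl sumr_ge0.
apply: uniq_perm => //; first exact: filter_uniq.
by move=> i; rewrite mem_filter /=; case: (boolP (i \in r)) => // /rs ->.
Qed.

Lemma esum_approx b u s e :
  (forall i, 0 <= u i <= b i) -> uniq s ->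
  (forall r, uniq r -> {in r, forall i, i \notin s} -> \sum_(i <- r) b i <= e) ->
  `|fine (\esum_(i in [set: I]) (u i)%:E) - \sum_(i <- s) u i| <= e.
Proof.
move=> ub us tail.
have u0 i : 0 <= u i by case/andP: (ub i).
have le1 := sum_le_esum u0 us.
have le2 : (\esum_(i in [set: I]) (u i)%:E <= (\sum_(i <- s) u i + e)%:E)%E.
  apply: esum_le => r ur; rewrite (bigID (mem s))/=; apply: lerD.
    rewrite -big_filter; apply: sum_subset_le => //; first exact: filter_uniq.
    by move=> i; rewrite mem_filter => /andP[].
  rewrite -big_filter; apply: le_trans (tail [seq i <- r | i \notin s] _ _).
  - by apply: ler_sum => i _; case/andP: (ub i).
  - exact: filter_uniq.
  - by move=> i; rewrite mem_filter => /andP[].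
have fin : \esum_(i in [set: I]) (u i)%:E \is a fin_num.
  by rewrite fin_numElt (lt_le_trans _ le1) ?ltNyr// (le_lt_trans le2) ?ltry.
move: le1 le2; rewrite -(fineK fin) !lee_fin => le1 le2.
by rewrite ger0_norm ?subr_ge0// lerBlDl.
Qed.

Lemma rsum_approx b u s e : rsummable b ->
  (forall i, `|u i| <= b i) -> uniq s ->
  (forall r, uniq r -> {in r, forall i, i \notin s} -> \sum_(i <- r) b i <= e) ->
  `|rsum u - \sum_(i <- s) u i| <= 2 * e.
Proof.
move=> sb ub us tail.
pose up i := Num.max (u i) 0; pose un i := Num.max (- u i) 0.
have upb i : 0 <= up i <= b i.
  by rewrite /up le_max lexx orbT ge_max (le_trans (ler_norm _) (ub i)) (le_trans _ (ub i)).
have unb i : 0 <= un i <= b i.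
  rewrite /un le_max lexx orbT ge_max (le_trans _ (ub i)) ?(le_trans _ (ub i))//.
  by rewrite -normrN ler_norm.
have -> : rsum u = fine (\esum_(i in [set: I]) (up i)%:E)
                 - fine (\esum_(i in [set: I]) (un i)%:E).
  rewrite /rsum -fineB; try exact: rsummable_fin_num (rsummable_le sb _).
  by congr (fine (_ - _))%E; apply: eq_esum => i _;
    rewrite ?funeposE ?funenegE /= -?EFinN EFin_max.
have -> : \sum_(i <- s) u i = \sum_(i <- s) up i - \sum_(i <- s) un i.
  rewrite -sumrB; apply: eq_bigr => i _; rewrite /up /un.
  by case: (leP 0 (u i)) => h; rewrite ?oppr_max; case: leP => h'; lra.
have := esum_approx upb us tail; have := esum_approx unb us tail.
set x := fine _; set y := \sum_(_ <- _) _; set z := fine _; set w := \sum_(_ <- _) _.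
by rewrite !ler_norml => /andP[? ?] /andP[? ?]; apply/andP; split; lra.
Qed.

(** The finite set [s] depends on the majorant only: termwise integration needs
    this uniformity over the families below [b]. *)
Lemma csum_approx b : rsummable b -> forall e, 0 < e ->
  exists2 s, uniq s & forall a, (forall i, modc (a i) <= b i) ->
    forall r, uniq r -> {subset s <= r} -> modc (csum a - \sum_(i <- r) a i) <= e.
Proof.
move=> sb e e0.
have [|s us tail] := rsummable_tail sb (e := e / 4); first by rewrite divr_gt0.
exists s => // a ab r ur sr.
have tail' t : uniq t -> {in t, forall i, i \notin r} -> \sum_(i <- t) b i <= e / 4.
  by move=> ut tr; apply: tail => // i /tr; apply: contra => /sr.
rewrite (le_trans (modc_le_ReIm _))// /csum.
rewrite -[X in `|X|]/(complex.Re _) !(ReD, ImD) /=.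
have reN (z : C) : complex.Re (- z) = - complex.Re z by case: z.
have imN (z : C) : complex.Im (- z) = - complex.Im z by case: z.
rewrite reN imN Re_sum Im_sum.
have hR := rsum_approx sb (fun i => le_trans (Re_le_modc _) (ab i)) ur tail'.
have hI := rsum_approx sb (fun i => le_trans (Im_le_modc _) (ab i)) ur tail'.
by apply: le_trans (lerD hR hI) _; lra.
Qed.

Lemma csum_unique b a (S : C) : rsummable b -> (forall i, modc (a i) <= b i) ->
  (forall e, 0 < e -> exists s, forall r, uniq r -> {subset s <= r} ->
     modc (S - \sum_(i <- r) a i) <= e) -> csum a = S.
Proof.
move=> sb ab h; apply/eqP; rewrite -subr_eq0 -modc_eq0 eq_le modc_ge0 andbT.
apply/ler_addgt0Pl => e e0; rewrite addr0.
have e20 : 0 < e / 2 by rewrite divr_gt0.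
have [s us hs] := csum_approx sb e20; have [s' hs'] := h _ e20.
pose r := undup (s ++ s').
have := hs a ab r (undup_uniq _); have := hs' r (undup_uniq _).
move=> /(_ _)/wrap[|h1]; first by move=> i; rewrite mem_undup mem_cat orbC => ->.
move=> /(_ _)/wrap[|h2]; first by move=> i; rewrite mem_undup mem_cat => ->.
rewrite -(subrKA (\sum_(i <- r) a i)) (le_trans (modc_le_add _ _))//.
by rewrite [X in _ + X]modcB; lra.
Qed.

Lemma rsummable_fin b s : (forall i, 0 <= b i) -> uniq s ->
  (forall i, i \notin s -> b i = 0) -> rsummable b.
Proof.
move=> b0 us bs; apply: rsummableP => //; exists (\sum_(i <- s) b i) => r ur.
rewrite (bigID (mem s))/= [X in _ + X]big1 ?addr0; last by move=> i /bs.
rewrite -big_filter; apply: sum_subset_le => //; first exact: filter_uniq.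
by move=> i; rewrite mem_filter => /andP[].
Qed.

Lemma csum_fin a s : uniq s -> (forall i, i \notin s -> a i = 0) ->
  csum a = \sum_(i <- s) a i.
Proof.
move=> us as0.
have sb : rsummable (fun i => modc (a i)).
  apply: (rsummable_fin (s := s)) => //; first by move=> i; exact: modc_ge0.
  by move=> i /as0 ->; rewrite modc0.
apply: (csum_unique sb) => // e e0; exists s => r ur sr.
rewrite [X in _ - X](_ : _ = \sum_(i <- s) a i) ?subrr ?modc0 ?ltW//.
rewrite (bigID (mem s))/= [X in _ + X]big1 ?addr0; last by move=> i /as0.
rewrite -big_filter; apply: perm_big.
apply: uniq_perm => //; first exact: filter_uniq.
by move=> i; rewrite mem_filter /=; case: (boolP (i \in s)) => // /sr ->.
Qed.

Lemma csum1 a j : (forall i, i != j -> a i = 0) -> csum a = a j.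
Proof.
move=> aj; rewrite (csum_fin (s := [:: j])) ?big_seq1// => i.
by rewrite inE => /aj.
Qed.

Lemma modc_csum_le b a (M : R) : rsummable b -> (forall i, modc (a i) <= b i) ->
  (forall s, uniq s -> \sum_(i <- s) b i <= M) -> modc (csum a) <= M.
Proof.
move=> sb ab bM; apply/ler_addgt0Pl => e e0.
have [s us hs] := csum_approx sb e0.
rewrite -(subrK (\sum_(i <- s) a i) (csum a)) (le_trans (modc_le_add _ _))//.
apply: lerD; first exact: hs.
rewrite (le_trans (modc_sum _ _ _))//; apply: le_trans (bM _ us).
by apply: ler_sum.
Qed.

End CSum.

(** * Integration of complex functions over the circle *)

Section Haar.
Variable R : realType.
Local Notation C := R[i].
Local Notation mu := (@lebesgue_measure R : {measure set _ -> \bar R}).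
Local Notation D := (`[0, 2 * pi]%classic).
Implicit Types (g h : R -> C) (q : R -> R).

Definition cmeasurable g : Prop :=
  measurable_fun [set: R] (fun x => complex.Re (g x)) /\
  measurable_fun [set: R] (fun x => complex.Im (g x)).

Definition cintegrable g : Prop :=
  mu.-integrable D (EFin \o (fun x => complex.Re (g x))) /\
  mu.-integrable D (EFin \o (fun x => complex.Im (g x))).

Lemma ReM (z w : C) : complex.Re (z * w) =
  complex.Re z * complex.Re w - complex.Im z * complex.Im w.
Proof. by case: z w => [? ?] []. Qed.

Lemma ImM (z w : C) : complex.Im (z * w) =
  complex.Re z * complex.Im w + complex.Im z * complex.Re w.
Proof. by case: z w => [? ?] []. Qed.

Lemma ReN (z : C) : complex.Re (- z) = - complex.Re z.
Proof. by case: z. Qed.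

Lemma ImN (z : C) : complex.Im (- z) = - complex.Im z.
Proof. by case: z. Qed.

Lemma cmeasurableD g h : cmeasurable g -> cmeasurable h ->
  cmeasurable (fun x => g x + h x).
Proof.
move=> [g1 g2] [h1 h2]; split.
  by under eq_fun do rewrite ReD; exact: measurable_funD.
by under eq_fun do rewrite ImD; exact: measurable_funD.
Qed.

Lemma cmeasurableM g h : cmeasurable g -> cmeasurable h ->
  cmeasurable (fun x => g x * h x).
Proof.
move=> [g1 g2] [h1 h2]; split.
  by under eq_fun do rewrite ReM; apply: measurable_funB; exact: measurable_funM.
by under eq_fun do rewrite ImM; apply: measurable_funD; exact: measurable_funM.
Qed.

Lemma cmeasurable_cst (c : C) : cmeasurable (fun=> c).
Proof. by split; exact: measurable_cst. Qed.

Lemma cmeasurable_real q : measurable_fun [set: R] q ->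
  cmeasurable (fun x => (q x)%:C).
Proof. by move=> mq; split=> //=; exact: measurable_cst. Qed.

Lemma cmeasurableN g : cmeasurable g -> cmeasurable (fun x => - g x).
Proof.
move=> mg; under eq_fun do rewrite -mulN1r.
exact: cmeasurableM (cmeasurable_cst _) mg.
Qed.

Lemma cmeasurableJ g : cmeasurable g -> cmeasurable (fun x => (g x)^*).
Proof.
move=> [g1 g2]; split.
  by rewrite (_ : (fun _ => _) = (fun x => complex.Re (g x)))//; apply/funext => x; case: (g x).
rewrite (_ : (fun _ => _) = (fun x => - complex.Im (g x))); last by apply/funext => x; case: (g x).
exact: measurableT_comp.
Qed.

Lemma cmeasurable_sum (I : Type) (s : seq I) (F : I -> R -> C) :
  (forall i, cmeasurable (F i)) -> cmeasurable (fun x => \sum_(i <- s) F i x).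
Proof.
move=> mF; elim: s => [|i s ih].
  by under eq_fun do rewrite big_nil; exact: cmeasurable_cst.
by under eq_fun do rewrite big_cons; exact: cmeasurableD.
Qed.

Lemma cmeasurable_prod (I : Type) (s : seq I) (F : I -> R -> C) :
  (forall i, cmeasurable (F i)) -> cmeasurable (fun x => \prod_(i <- s) F i x).
Proof.
move=> mF; elim: s => [|i s ih].
  by under eq_fun do rewrite big_nil; exact: cmeasurable_cst.
by under eq_fun do rewrite big_cons; exact: cmeasurableM.
Qed.

Lemma cmeasurableX g n : cmeasurable g -> cmeasurable (fun x => g x ^+ n).
Proof.
move=> mg; elim: n => [|n ih].
  by under eq_fun do rewrite expr0; exact: cmeasurable_cst.
by under eq_fun do rewrite exprS; exact: cmeasurableM.
Qed.

Let mD : measurable (D : set (measurableTypeR R)).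
Proof. exact: measurable_itv. Qed.

Let twopi_gt0 : 0 < 2 * pi :> R. Proof. by rewrite mulr_gt0 ?pi_gt0. Qed.

Let muD : mu D = (2 * pi)%:E.
Proof. by rewrite [LHS]lebesgue_measure_itv /= lte_fin twopi_gt0 sube0. Qed.

Let bounded_in q (M : R) : (forall x, `|q x| <= M) -> [bounded q x | x in D].
Proof.
move=> qM; exists M; split; first exact: num_real.
by move=> N /ltW MN x _; exact: le_trans (qM x) MN.
Qed.

Let integrable_bounded q (M : R) : measurable_fun [set: R] q ->
  (forall x, `|q x| <= M) -> mu.-integrable D (EFin \o q).
Proof.
move=> mq qM; apply: measurable_bounded_integrable => //.
- by rewrite muD ltry.
- exact: measurable_funTS.
- exact: bounded_in qM.
Qed.

Lemma cintegrable_bounded g (M : R) : cmeasurable g ->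
  (forall x, modc (g x) <= M) -> cintegrable g.
Proof.
move=> [g1 g2] gM; split; apply: (integrable_bounded (M := M)) => // x.
  exact: le_trans (Re_le_modc _) (gM x).
exact: le_trans (Im_le_modc _) (gM x).
Qed.

Lemma cintegrable_cst (c : C) : cintegrable (fun=> c).
Proof. by apply: (cintegrable_bounded (M := modc c)) => //; exact: cmeasurable_cst. Qed.

Lemma cintegrableD g h : cintegrable g -> cintegrable h ->
  cintegrable (fun x => g x + h x).
Proof.
move=> [g1 g2] [h1 h2]; split.
  apply: eq_integrable (integrableD mD g1 h1) => // x _ /=; by rewrite ReD.
by apply: eq_integrable (integrableD mD g2 h2) => // x _ /=; rewrite ImD.
Qed.

Lemma cintegrableM h g (M : R) : cmeasurable h -> (forall x, modc (h x) <= M) ->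
  cintegrable g -> cintegrable (fun x => h x * g x).
Proof.
move=> [h1 h2] hM [g1 g2].
have bR : [bounded complex.Re (h x) | x in D].
  by apply: (bounded_in (M := M)) => x; exact: le_trans (Re_le_modc _) (hM x).
have bI : [bounded complex.Im (h x) | x in D].
  by apply: (bounded_in (M := M)) => x; exact: le_trans (Im_le_modc _) (hM x).
have mR := measurable_funTS (D := D) h1; have mI := measurable_funTS (D := D) h2.
split.
  apply: eq_integrable (integrableB mD (integrableMr mD mR bR g1) (integrableMr mD mI bI g2)) => //.
  by move=> x _ /=; rewrite ReM.
apply: eq_integrable (integrableD mD (integrableMr mD mR bR g2) (integrableMr mD mI bI g1)) => //.
by move=> x _ /=; rewrite ImM.
Qed.

Lemma cintegrableZ (c : C) g : cintegrable g -> cintegrable (fun x => c * g x).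
Proof. by apply: (cintegrableM (M := modc c)) => //; exact: cmeasurable_cst. Qed.

Lemma haarD g h : cintegrable g -> cintegrable h ->
  haar (fun x => g x + h x) = haar g + haar h.
Proof.
move=> [g1 g2] [h1 h2]; rewrite /haar; simpc.
congr (_ +i* _).
  by under eq_Rintegral do rewrite ReD; rewrite RintegralD// mulrDr.
by under eq_Rintegral do rewrite ImD; rewrite RintegralD// mulrDr.
Qed.

Lemma haarZ (c : C) g : cintegrable g -> haar (fun x => c * g x) = c * haar g.
Proof.
move=> [g1 g2]; rewrite /haar; case: c => a b; simpc.
have Z (k : R) q : mu.-integrable D (EFin \o q) ->
    mu.-integrable D (EFin \o (fun x => k * q x)).
  by move=> iq; exact: (integrableZl mD k iq).
congr (_ +i* _).
  under eq_Rintegral do rewrite ReM /=.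
  by rewrite RintegralB ?RintegralZl//; try exact: Z; ring.
under eq_Rintegral do rewrite ImM /=.
by rewrite RintegralD ?RintegralZl//; try exact: Z; ring.
Qed.

Lemma haarN g : cintegrable g -> haar (fun x => - g x) = - haar g.
Proof.
by move=> ig; rewrite -mulN1r -haarZ//; congr (haar _); apply/funext => x; rewrite mulN1r.
Qed.

Lemma haarB g h : cintegrable g -> cintegrable h ->
  haar (fun x => g x - h x) = haar g - haar h.
Proof.
move=> ig ih; rewrite -haarN// -haarD//.
by under eq_fun do rewrite -mulN1r; exact: cintegrableZ.
Qed.

Lemma cintegrable_sum (I : Type) (s : seq I) (F : I -> R -> C) :
  (forall i, cintegrable (F i)) -> cintegrable (fun x => \sum_(i <- s) F i x).
Proof.
move=> iF; elim: s => [|i s ih].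
  by under eq_fun do rewrite big_nil; exact: cintegrable_cst.
by under eq_fun do rewrite big_cons; exact: cintegrableD.
Qed.

Lemma haar0 : haar (fun=> 0) = 0 :> C.
Proof. by rewrite /haar/= !Rintegral_cst// !mul0r mulr0. Qed.

Lemma haar_sum (I : Type) (s : seq I) (F : I -> R -> C) :
  (forall i, cintegrable (F i)) ->
  haar (fun x => \sum_(i <- s) F i x) = \sum_(i <- s) haar (F i).
Proof.
move=> iF; elim: s => [|i s ih].
  by rewrite big_nil -[RHS]haar0; congr (haar _); apply/funext => x; rewrite big_nil.
rewrite big_cons -ih -haarD//; last exact: cintegrable_sum.
by congr (haar _); apply/funext => x; rewrite big_cons.
Qed.

Lemma haar_cst (c : C) : haar (fun=> c) = c.
Proof.
rewrite /haar /= !Rintegral_cst// muD/= ![_ * (2 * pi)]mulrC.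
by rewrite !mulKf ?gt_eqF//; case: c.
Qed.

(** A bound for the mean of [modc (g x)] that avoids the square root. *)
Definition haar_abs g : R :=
  (2 * pi)^-1 * \int[mu]_(x in D) (`|complex.Re (g x)| + `|complex.Im (g x)|).

Lemma haar_abs_ge0 g : 0 <= haar_abs g.
Proof.
apply: mulr_ge0; first by rewrite invr_ge0 ltW.
by apply: Rintegral_ge0 => x _; rewrite addr_ge0.
Qed.

Lemma haar_abs_cst1 : haar_abs (fun=> 1) = 1.
Proof.
rewrite /haar_abs/= normr1 normr0 addr0 Rintegral_cst// muD/= mul1r mulVf//.
by rewrite gt_eqF.
Qed.

Lemma modc_haarM_le h g (M : R) : cmeasurable h -> (forall x, modc (h x) <= M) ->
  cintegrable g -> modc (haar (fun x => h x * g x)) <= 2 * (M * haar_abs g).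
Proof.
move=> mh hM ig; have [i1 i2] := cintegrableM mh hM ig; case: (ig) => g1 g2.
have ii : mu.-integrable D (EFin \o (fun x => `|complex.Re (g x)| + `|complex.Im (g x)|)).
  exact: (integrableD mD (integrable_norm g1) (integrable_norm g2)).
have bnd q : mu.-integrable D (EFin \o q) ->
    (forall x, `|q x| <= M * (`|complex.Re (g x)| + `|complex.Im (g x)|)) ->
    `|(2 * pi)^-1 * \int[mu]_(x in D) q x| <= M * haar_abs g.
  move=> iq qM; rewrite normrM gtr0_norm ?invr_gt0// /haar_abs mulrCA.
  rewrite ler_pM2l ?invr_gt0// (le_trans (le_normr_Rintegral mD iq))//.
  rewrite -RintegralZl//; apply: le_Rintegral => //.
  - exact: (integrable_norm iq).
  - exact: (integrableZl mD M ii).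
have h1 (z w : C) : `|complex.Re z * complex.Re w| + `|complex.Im z * complex.Im w| <=
    modc z * (`|complex.Re w| + `|complex.Im w|).
  by rewrite !normrM mulrDr lerD// ler_wpM2r// ?Re_le_modc ?Im_le_modc.
have h2 (z w : C) : `|complex.Re z * complex.Im w| + `|complex.Im z * complex.Re w| <=
    modc z * (`|complex.Re w| + `|complex.Im w|).
  by rewrite !normrM addrC mulrDr lerD// ler_wpM2r// ?Re_le_modc ?Im_le_modc.
have hM' x : modc (h x) * (`|complex.Re (g x)| + `|complex.Im (g x)|) <=
    M * (`|complex.Re (g x)| + `|complex.Im (g x)|).
  by rewrite ler_wpM2r// addr_ge0.
rewrite (le_trans (modc_le_ReIm _))// mulr2n mulrDl mul1r; apply: lerD; apply: bnd => // x.
  by rewrite ReM (le_trans (ler_normB _ _))// (le_trans (h1 _ _)).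
by rewrite ImM (le_trans (ler_normD _ _))// (le_trans (h2 _ _)).
Qed.

Lemma modc_haar_le g (M : R) : cmeasurable g -> (forall x, modc (g x) <= M) ->
  modc (haar g) <= 2 * M.
Proof.
move=> mg gM; have := modc_haarM_le mg gM (cintegrable_cst 1).
by rewrite haar_abs_cst1 mulr1; congr (modc (haar _) <= _); apply/funext => x; rewrite mulr1.
Qed.

Lemma haar_ge q (c : R) : measurable_fun [set: R] q ->
  (exists M, forall x, `|q x| <= M) -> (forall x, c <= q x) ->
  c <= complex.Re (haar (fun x => (q x)%:C)).
Proof.
move=> mq [M qM] cq; rewrite /haar /=.
have : \int[mu]_(x in D) c <= \int[mu]_(x in D) q x.
  apply: le_Rintegral => //; last exact: integrable_bounded qM.
  by apply: (@integrable_bounded _ `|c|) => //; exact: measurable_cst.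
rewrite Rintegral_cst// muD/= -ler_pdivlMr//.
by rewrite [(2 * pi)^-1 * _]mulrC.
Qed.

Lemma haar_real q : complex.Im (haar (fun x => (q x)%:C)) = 0.
Proof. by rewrite /haar/= Rintegral_cst// mul0r mulr0. Qed.

Lemma cmeasurable_csum (I : choiceType) (b : I -> R) (a : I -> R -> C) :
  rsummable b -> (forall i, cmeasurable (a i)) ->
  (forall i x, modc (a i x) <= b i) ->
  cmeasurable (fun x => csum (a^~ x)).
Proof.
move=> sb ma ab.
have /choice[s hs] (n : nat) : exists s, forall x,
    modc (csum (a^~ x) - \sum_(i <- s) a i x) <= n.+1%:R^-1.
  have [|s us hs] := csum_approx sb (e := n.+1%:R^-1); first by rewrite invr_gt0.
  by exists s => x; apply: hs.
have ms n := cmeasurable_sum (s n) ma.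
have cv (f : C -> R) : (forall z, `|f z| <= modc z) ->
    (forall z w, f (z - w) = f z - f w) ->
    forall x, f (\sum_(i <- s n) a i x) @[n --> \oo] --> f (csum (a^~ x)).
  move=> fm fB x; apply/cvgrPdist_le => e e0; near=> n.
  rewrite -fB (le_trans (fm _))// (le_trans (hs n x))//.
  by apply: ltW; near: n; exact: (near_infty_natSinv_lt (PosNum e0)).
split.
  apply: (measurable_fun_cvg (h := fun n x => complex.Re (\sum_(i <- s n) a i x))).
    by move=> n; case: (ms n).
  by move=> x _; apply: cv => [z|z w]; [exact: Re_le_modc|rewrite ReD ReN].
apply: (measurable_fun_cvg (h := fun n x => complex.Im (\sum_(i <- s n) a i x))).
  by move=> n; case: (ms n).
by move=> x _; apply: cv => [z|z w]; [exact: Im_le_modc|rewrite ImD ImN].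
Unshelve. all: by end_near. Qed.

(** Termwise integration: the partial sums of a dominated family converge
    uniformly, and a uniform error only costs a multiple of the mean of [g]. *)
Lemma haar_csum (I : choiceType) (b : I -> R) (a : I -> R -> C) g :
  rsummable b -> (forall i, cmeasurable (a i)) ->
  (forall i x, modc (a i x) <= b i) -> cintegrable g ->
  haar (fun x => csum (a^~ x) * g x) = csum (fun i => haar (fun x => a i x * g x)).
Proof.
move=> sb ma ab ig; set L := haar_abs g; have L0 : 0 <= L := haar_abs_ge0 g.
have sb' : rsummable (fun i => 2 * (b i * L)).
  case: (sb) => b0 _; apply: rsummableP => [i|]; first by rewrite mulr_ge0// mulr_ge0.
  have [M M0 hM] := rsummable_sum_le sb; exists (2 * (M * L)) => s us.
  by rewrite -mulr_sumr -mulr_suml ler_pM2l// ler_wpM2r// hM.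
symmetry; apply: (csum_unique sb') => [i|e e0]; first exact: modc_haarM_le.
have d0 : 0 < e / (2 * (L + 1)) by rewrite divr_gt0// mulr_gt0// ltr_wpDl.
have [s us hs] := csum_approx sb d0.
exists s => r ur sr; rewrite -haar_sum; last by move=> i; apply: cintegrableM.
have [M M0 hM] := rsummable_sum_le sb.
have mc := cmeasurable_csum sb ma ab; have ms := cmeasurable_sum r ma.
have ic : cintegrable (fun x => csum (a^~ x) * g x).
  by apply: (cintegrableM (M := M)) => // x; exact: modc_csum_le sb (ab^~ x) hM.
rewrite -haarB//; last by apply: cintegrable_sum => i; apply: cintegrableM.
rewrite (_ : (fun _ => _) = (fun x => (csum (a^~ x) - \sum_(i <- r) a i x) * g x)); last first.
  by apply/funext => x; rewrite mulrBl mulr_suml.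
apply: le_trans (modc_haarM_le _ (M := e / (2 * (L + 1))) _ ig) _.
- exact: cmeasurableD mc (cmeasurableN ms).
- by move=> x; apply: hs.
- have -> : 2 * (e / (2 * (L + 1)) * haar_abs g) = e * (L / (L + 1)).
    by rewrite -/L; field; rewrite gt_eqF// ltr_wpDl.
  by rewrite ler_piMr ?(ltW e0)// ler_pdivrMr ?ltr_wpDl// mul1r lerDl.
Qed.

End Haar.

(** * Characters of the circle *)

Section Characters.
Variable R : realType.
Local Notation C := R[i].
Local Notation mu := (@lebesgue_measure R : {measure set _ -> \bar R}).
Local Notation D := (`[0, 2 * pi]%classic).
Implicit Types (x y : R) (j k : int).

Lemma char0 x : char 0 x = 1 :> C.
Proof. by rewrite /char mul0r cos0 sin0. Qed.

Lemma charr0 j : char j 0 = 1 :> C.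
Proof. by rewrite /char mulr0 cos0 sin0. Qed.

Lemma charD j x y : char j (x + y) = char j x * char j y :> C.
Proof. by rewrite /char mulrDr cosD sinD; simpc; congr (_ +i* _); ring. Qed.

Lemma charDl j k x : char (j + k) x = char j x * char k x :> C.
Proof. by rewrite /char intrD mulrDl cosD sinD; simpc; congr (_ +i* _); ring. Qed.

Lemma charN j x : char j (- x) = (char j x)^* :> C.
Proof. by rewrite /char mulrN cosN sinN. Qed.

Lemma charNl j x : char (- j) x = (char j x)^* :> C.
Proof. by rewrite /char mulrNz mulNr cosN sinN. Qed.

Lemma charMz j x : char 1 (j%:~R * x) = char j x :> C.
Proof. by rewrite /char mul1r. Qed.

Lemma modc_char j x : modc (char j x) = 1.
Proof. by rewrite /modc /sqmod /= cos2Dsin2 sqrtr1. Qed.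

Lemma charX j x n : char j x ^+ n = char (j *+ n) x :> C.
Proof.
by elim: n => [|n ih]; rewrite ?expr0 ?char0// exprS ih -charDl mulrS.
Qed.

Lemma cosE_char x : (cos x)%:C = 2^-1 * (char 1 x + char (-1) x) :> C.
Proof.
rewrite charNl /char mul1r; simpc.
by congr (_ +i* _); rewrite expr0n/=; field.
Qed.

Lemma cmeasurable_char j : cmeasurable (char j : R -> C).
Proof.
have mj : measurable_fun [set: R] (fun x : R => j%:~R * x).
  by apply: measurable_funM => //; exact: measurable_cst.
split => /=.
  by apply: (measurableT_comp (f := cos)) => //; apply: continuous_measurable_fun;
    exact: continuous_cos.
by apply: (measurableT_comp (f := sin)) => //; apply: continuous_measurable_fun;
    exact: continuous_sin.
Qed.

Lemma cmeasurable_charJ j : cmeasurable (fun x => (char j x)^* : C).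
Proof. exact: cmeasurableJ (cmeasurable_char j). Qed.

Lemma cos2piMz j : cos (j%:~R * (2 * pi)) = 1 :> R /\ sin (j%:~R * (2 * pi)) = 0 :> R.
Proof.
have cosn n : cos (n%:R * (2 * pi)) = 1 :> R /\ sin (n%:R * (2 * pi)) = 0 :> R.
  have e : n%:R * (2 * pi) = 0 + (pi *+ 2) *+ n :> R.
    by rewrite add0r mulr_natl [2 * pi]mulr_natl.
  by rewrite e (periodicn (@cosD2pi R)) (periodicn (@sinD2pi R)) cos0 sin0.
case: j => n; first exact: cosn.
by rewrite NegzE mulrNz mulNr cosN sinN; case: (cosn n.+1) => -> ->; rewrite oppr0.
Qed.

Lemma char2pi j : char j (2 * pi) = 1 :> C.
Proof. by have [c s] := cos2piMz j; rewrite /char c s. Qed.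

Lemma haar_char j : haar (char j) = (j == 0)%:R :> C.
Proof.
have [->|j0] := eqVneq j 0.
  rewrite (_ : char 0 = fun=> 1); last by apply/funext => x; exact: char0.
  exact: haar_cst.
have jR : j%:~R != 0 :> R by rewrite intr_eq0.
have pi2 : 0 < 2 * pi :> R by rewrite mulr_gt0 ?pi_gt0.
have [cE sE] := cos2piMz j.
have cj (f : R -> R) : continuous f -> {within D, continuous (fun x => f (j%:~R * x))}.
  move=> cf; apply: continuous_subspaceT => x.
  by apply: (@continuous_comp _ _ _ (fun x => j%:~R * x) f);
    [apply: mulrl_continuous|exact: cf].
have dj (x : R) : is_derive x 1 (fun x => j%:~R * x) (j%:~R : R).
  have h : is_derive x 1 (j%:~R \*: (@id R)) (j%:~R *: (1 : R)).
    by apply: is_deriveZ.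
  by apply: is_derive_eq h _; exact: mulr1.
have dS (x : R) : is_derive x 1 (fun x => j%:~R^-1 * sin (j%:~R * x)) (cos (j%:~R * x)).
  have h : is_derive x 1 (j%:~R^-1 \*: (sin \o (fun x : R => j%:~R * x)))
      (j%:~R^-1 *: (cos (j%:~R * x) * j%:~R)).
    by apply: is_deriveZ; exact: is_derive1_comp.
  apply: is_derive_eq h _.
  by rewrite [LHS]mulrCA mulVf ?mulr1.
have dC (x : R) : is_derive x 1 (fun x => - j%:~R^-1 * cos (j%:~R * x)) (sin (j%:~R * x)).
  have h : is_derive x 1 (- j%:~R^-1 \*: (cos \o (fun x : R => j%:~R * x)))
      (- j%:~R^-1 *: (- sin (j%:~R * x) * j%:~R)).
    by apply: is_deriveZ; exact: is_derive1_comp.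
  apply: is_derive_eq h _.
  by rewrite [LHS]mulrC -mulrA mulrN divff// mulrNN mulr1.
have FTC (f F : R -> R) : continuous f -> (forall x, is_derive x 1 F (f (j%:~R * x))) ->
   \int[mu]_(x in D) f (j%:~R * x) = F (2 * pi) - F 0.
  move=> cf dF; rewrite /Rintegral (@continuous_FTC2 _ _ F)//.
  - exact: cj.
  - split.
    + by move=> x _; have [] := dF x.
    + apply: cvg_at_right_filter; apply: differentiable_continuous.
      by apply/derivable1_diffP; case: (dF 0).
    + apply: cvg_at_left_filter; apply: differentiable_continuous.
      by apply/derivable1_diffP; case: (dF (2 * pi)).
  - by move=> x _; rewrite derive1E; have /@derive_val -> := dF x.
rewrite /haar /char /=.
rewrite (FTC _ _ (@continuous_cos R) dS) (FTC _ _ (@continuous_sin R) dC).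
by rewrite cE sE !mulr0 sin0 cos0 !mulr0 !subrr !mulr0.
Qed.

Lemma haar_charM j k : haar (fun x => (char j x)^* * char k x) = (j == k)%:R :> C.
Proof.
rewrite (_ : (fun _ => _) = char (k - j)); last first.
  by apply/funext => x; rewrite addrC charDl charNl.
by rewrite haar_char subr_eq0 eq_sym.
Qed.

End Characters.

(** * Translation invariance *)

Section Translation.
Variable R : realType.
Local Notation C := R[i].
Local Notation mu := (@lebesgue_measure R : {measure set _ -> \bar R}).
Local Notation D := (`[0, 2 * pi]%classic).
Implicit Types (s : R) (q : R -> R) (f g : R -> C).

Let shift s : measurableTypeR R -> measurableTypeR R := fun x => x + s.

Let mshift s : measurable_fun [set: measurableTypeR R] (shift s).
Proof. by apply: measurable_funD => //; exact: measurable_cst. Qed.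

Let shift_itv s (i j : bool) (a b : R) :
  shift s @^-1` [set` Interval (BSide i a) (BSide j b)] =
  [set` Interval (BSide i (a - s)) (BSide j (b - s))].
Proof.
apply/seteqP; split => x /=; rewrite /shift !in_itv /=; case: i; case: j => /=;
  by rewrite ?lerBlDr ?lerBrDr ?ltrBlDr ?ltrBrDr.
Qed.

Lemma lebesgue_measure_shift s (A : set (measurableTypeR R)) : measurable A ->
  pushforward mu (shift s) A = mu A.
Proof.
move=> mA; apply/esym; apply: (@lebesgue_measure_unique R
  [the {measure set _ -> \bar R} of pushforward mu (shift s)]) => //= _ [[a b]] _ <-.
rewrite /pushforward shift_itv/= !lebesgue_measure_itv/=.
rewrite !lte_fin ltrBlDr subrK; case: ifP => // _.
by congr (_%:E); ring.
Qed.

Lemma integrable_shift s q (a b : R) : measurable_fun [set: R] q ->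
  mu.-integrable `[a + s, b + s] (EFin \o q) ->
  mu.-integrable `[a, b] (EFin \o (fun x => q (x + s))).
Proof.
move=> mq /integrableP[_ fin]; apply/integrableP; split.
  apply: measurable_funTS; apply/measurable_EFinP.
  exact: (measurableT_comp mq (mshift s)).
have -> : `[a, b]%classic = shift s @^-1` `[a + s, b + s] by rewrite shift_itv !addrK.
rewrite -(ge0_integral_pushforward (mshift s) _ (f := fun x => `|(q x)%:E|%E))//=.
  rewrite (@eq_measure_integral _ _ _ _ mu)// => A mA _.
  exact: lebesgue_measure_shift.
by apply: measurable_funTS; apply/measurable_EFinP; apply: measurableT_comp.
Qed.

Lemma Rintegral_shift s q (a b : R) : measurable_fun [set: R] q ->
  mu.-integrable `[a + s, b + s] (EFin \o q) ->
  \int[mu]_(x in `[a, b]) q (x + s) = \int[mu]_(x in `[a + s, b + s]) q x.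
Proof.
move=> mq iq; rewrite /Rintegral; congr fine.
have e : `[a, b]%classic = shift s @^-1` `[a + s, b + s] by rewrite shift_itv !addrK.
have := @integral_pushforward _ _ _ _ _ (shift s) (mshift s) mu `[a + s, b + s]%classic (EFin \o q).
rewrite -e => <-//.
- by apply: eq_measure_integral => A mA _; exact: lebesgue_measure_shift.
- exact/measurable_EFinP.
- exact: integrable_shift.
Qed.

Lemma Rintegral_itv_split q (a b c : R) : a <= b <= c ->
  mu.-integrable `[a, c] (EFin \o q) ->
  \int[mu]_(x in `[a, c]) q x =
  \int[mu]_(x in `[a, b]) q x + \int[mu]_(x in `[b, c]) q x.
Proof.
move=> /andP[ab bc] iq.
have := @Rintegral_itvB R q (BLeft a) (BRight c) b iq.
rewrite !bnd_simp => /(_ ab bc)/eqP; rewrite subr_eq => /eqP ->.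
rewrite addrC Rintegral_itv_obnd_cbnd//.
apply: integrableS iq => //; apply: subset_itvr; by rewrite bnd_simp.
Qed.

(** Reduce [s] modulo the period to [r] between [0] and [T]; the window from [r]
    to [T + r] is then cut at [T], and its last piece is moved back by one
    period. *)
Lemma Rintegral_periodic s q : measurable_fun [set: R] q ->
  (forall a b : R, mu.-integrable `[a, b] (EFin \o q)) ->
  (forall x, q (x + 2 * pi) = q x) ->
  \int[mu]_(x in D) q (x + s) = \int[mu]_(x in D) q x.
Proof.
move=> mq iq pq; set T := 2 * pi in pq *.
have T0 : 0 < T by rewrite mulr_gt0 ?pi_gt0.
have pqz (k : int) x : q (x + k%:~R * T) = q x.
  have pqn (n : nat) y : q (y + n%:R * T) = q y.
    elim: n => [|n ih]; first by rewrite mul0r addr0.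
    by rewrite -natr1 mulrDl mul1r addrA pq.
  case: k => n; first exact: pqn.
  by rewrite NegzE mulrNz mulNr -[in RHS](subrK (n.+1%:R * T) x) pqn.
pose k := Num.floor (s / T); pose r := s - k%:~R * T.
have r0 : 0 <= r by rewrite subr_ge0 -ler_pdivlMr// Num.Theory.floor_le.
have rT : r <= T.
  by rewrite lerBlDl -[X in _ + X]mul1r -mulrDl -ler_pdivrMr// -intrD1 ltW// Num.Theory.floorD1_gt.
have -> : \int[mu]_(x in D) q (x + s) = \int[mu]_(x in `[0, T]) q (x + r).
  apply: eq_Rintegral => x _; rewrite -(pqz k (x + r)); congr q; rewrite /r; ring.
rewrite Rintegral_shift// add0r.
rewrite (@Rintegral_itv_split _ r T); last exact: iq; last by rewrite rT lerDl.
rewrite [RHS](@Rintegral_itv_split _ 0 r); last exact: iq; last by rewrite r0.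
rewrite addrC; congr (_ + _).
rewrite (addrC T r) -[X in `[X, _]](add0r T).
rewrite -(@Rintegral_shift T q 0 r)// ?add0r//.
by apply: eq_Rintegral => x _; rewrite pq.
Qed.

End Translation.

(** * The subexponential weights *)

Section Weights.
Variables (R : realType) (p : R).
Hypothesis (hp : 0 < p < 1).

Let p0 : 0 < p. Proof. by case/andP: hp. Qed.
Let p1 : p < 1. Proof. by case/andP: hp. Qed.

(** Bernoulli's inequality. With [1 + u = e^y] it reads
    [p e^{(1-p)y} + (1-p) e^{-py} >= 1], the weighted sum of the tangent bounds
    of the exponential at [0]. *)
Lemma powR_le_1D (u : R) : 0 <= u -> (1 + u) `^ p <= 1 + p * u.
Proof.
move=> u0; have u1 : 0 < 1 + u by rewrite ltr_pwDl.
rewrite /powR gt_eqF//; set y := ln (1 + u).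
have ey : expR y = 1 + u by rewrite lnK// posrE.
have h1 := expR_ge1Dx ((1 - p) * y); have h2 := expR_ge1Dx (- (p * y)).
have e1 : expR (p * y) * expR ((1 - p) * y) = 1 + u.
  by rewrite -expRD -ey; congr expR; ring.
have e2 : expR (p * y) * expR (- (p * y)) = 1 by rewrite expRxMexpNx_1.
have e0 := expR_gt0 (p * y).
have h3 : 1 <= p * expR ((1 - p) * y) + (1 - p) * expR (- (p * y)).
  have a1 : p * (1 + (1 - p) * y) <= p * expR ((1 - p) * y) by rewrite ler_pM2l.
  have a2 : (1 - p) * (1 + - (p * y)) <= (1 - p) * expR (- (p * y)).
    by rewrite ler_pM2l// subr_gt0.
  apply: le_trans (lerD a1 a2); by rewrite [leRHS](_ : _ = 1)//; ring.
have : expR (p * y) * 1 <= expR (p * y) *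
    (p * expR ((1 - p) * y) + (1 - p) * expR (- (p * y))) by rewrite ler_pM2l.
rewrite mulr1 mulrDr mulrCA e1 [X in _ + X]mulrCA e2 => /le_trans; apply.
by rewrite [leLHS](_ : _ = 1 + p * u)//; ring.
Qed.

(** Strict concavity leaves a gain of [(1 - p) a^p] over subadditivity. This
    gain turns into a factor that is summable in the smaller index of
    [weight_subconv]. *)
Lemma powR_add_min (a b : R) : 0 <= a <= b ->
  (a + b) `^ p + (1 - p) * a `^ p <= a `^ p + b `^ p.
Proof.
move=> /andP[a0 ab]; have [->|an0] := eqVneq a 0.
  by rewrite add0r powR0 ?gt_eqF// mulr0 addr0 add0r.
have a_gt0 : 0 < a by rewrite lt_def an0.
have b_gt0 : 0 < b := lt_le_trans a_gt0 ab.
have -> : a + b = b * (1 + a / b) by field; rewrite gt_eqF.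
have ab0 : 0 <= a / b by rewrite divr_ge0// ltW.
rewrite powRM ?(ltW b_gt0)//; last by rewrite addr_ge0.
have h1 : b `^ p * (1 + a / b) `^ p <= b `^ p * (1 + p * (a / b)).
  by rewrite ler_pM2l ?powR_gt0// powR_le_1D.
have h2 : b `^ p * (a / b) <= a `^ p.
  have t1 : a / b <= 1 by rewrite ler_pdivrMr// mul1r.
  have t2 : a / b <= (a / b) `^ p.
    have := @ger_powR R (a / b) _ p 1; rewrite powRr1//; apply; last exact: ltW.
    by rewrite divr_gt0.
  apply: (@le_trans _ _ (b `^ p * (a / b) `^ p)); first by rewrite ler_pM2l ?powR_gt0.
  by rewrite -powRM// ?(ltW b_gt0)// mulrC divfK ?gt_eqF.
have h3 : p * (b `^ p * (a / b)) <= p * a `^ p by rewrite ler_pM2l.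
have e : b `^ p * (1 + p * (a / b)) = b `^ p + p * (b `^ p * (a / b)) by ring.
by rewrite e in h1; rewrite mulrBl mul1r; lra.
Qed.

Local Notation wt := (weight p).

Lemma weight_gt0 (tau : R) j : 0 < wt tau j. Proof. exact: expR_gt0. Qed.

Lemma weight0 (tau : R) : wt tau 0 = 1.
Proof. by rewrite /weight normr0 powR0 ?gt_eqF// mulr0 expR0. Qed.

Lemma weightN (tau : R) j : wt tau (- j) = wt tau j.
Proof. by rewrite /weight mulrNz normrN. Qed.

Let weight_pow (tau : R) (k l : int) : 0 <= tau ->
  `|(k + l)%:~R| `^ p + (1 - p) * Num.min `|k%:~R| `|l%:~R| `^ p
    <= `|k%:~R| `^ p + `|l%:~R| `^ p :> R.
Proof.
move=> t0; have h : `|(k + l)%:~R| `^ p <= (`|k%:~R| + `|l%:~R|) `^ p :> R.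
  by apply: ge0_ler_powR; rewrite ?nnegrE ?addr_ge0 ?(ltW p0)// intrD ler_normD.
case: (leP `|k%:~R : R| `|l%:~R|) => kl.
  by have := @powR_add_min `|k%:~R| `|l%:~R|; rewrite normr_ge0 kl => /(_ isT); lra.
have := @powR_add_min `|l%:~R| `|k%:~R|; rewrite normr_ge0 (ltW kl) => /(_ isT).
by rewrite [X in X `^ p + _ <= _]addrC; lra.
Qed.

Lemma weight_supermul (tau : R) (k l : int) : 0 <= tau ->
  wt tau k * wt tau l <= wt tau (k + l).
Proof.
move=> t0; rewrite /weight -expRD ler_expR -mulrDr !mulNr lerN2 ler_wpM2l//.
have := weight_pow k l t0; apply: le_trans.
by rewrite lerDl mulr_ge0 ?subr_ge0 ?(ltW p1)// powR_ge0.
Qed.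

(** The squared coefficient [wt k * wt l / wt (k + l)] of the comultiplication
    is at most a function of [k] plus a function of [l], both summable: this is
    what makes the comultiplication bounded. *)
Lemma weight_subconv (tau : R) (k l : int) : 0 <= tau ->
  wt tau k * wt tau l <=
  wt tau (k + l) * (wt (tau * (1 - p)) k + wt (tau * (1 - p)) l).
Proof.
move=> t0; have := weight_pow k l t0.
set m := Num.min _ _ => h.
apply: (@le_trans _ _ (wt tau (k + l) * expR (- (tau * (1 - p)) * m `^ p))).
  rewrite /weight -!expRD ler_expR.
  have : tau * (`|(k + l)%:~R| `^ p + (1 - p) * m `^ p) <=
    tau * (`|k%:~R| `^ p + `|l%:~R| `^ p) by rewrite ler_wpM2l.
  lra.
rewrite ler_pM2l ?weight_gt0// /m; case: (leP `|k%:~R : R| `|l%:~R|) => _.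
  by rewrite lerDl ltW// weight_gt0.
by rewrite lerDr ltW// weight_gt0.
Qed.

(** The telescoping majorant is the inverse square [1 / ((k+1)(k+2))]. *)
Lemma rsummable_int (b : nat -> R) (K : R) :
  (forall k, 0 <= b k <= K * (k.+1%:R^-1 - k.+2%:R^-1)) ->
  rsummable (fun j : int => b `|j|%N).
Proof.
move=> hb; have b0 k : 0 <= b k by case/andP: (hb k).
have K0 : 0 <= K.
  have /andP[h1 h2] := hb 0%N; have := le_trans h1 h2; rewrite pmulr_lge0//; lra.
have tele n : \sum_(k <- iota 0 n) b k <= K.
  apply: (@le_trans _ _ (K * (1 - n.+1%:R^-1))).
    elim: n => [|n ih]; first by rewrite big_nil invr1 subrr mulr0.
    rewrite -addn1 iotaD big_cat big_seq1/= add0n addn1.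
    have /andP[_ h] := hb n; apply: le_trans (lerD ih h) _.
    by rewrite -mulrDr addrA subrK.
  by rewrite ler_piMr// gerBl invr_ge0.
have tele' n : \sum_(k <- iota 0 n) b k.+1 <= K.
  apply: le_trans (tele n.+1); rewrite /= big_cons -[iota 1 n]/(iota 1 n) (iotaDl 1 0 n) big_map.
  by rewrite lerDr.
apply: rsummableP => //; exists (K + K) => s us.
pose M := (\max_(j <- s) `|j|%N).+1.
pose r := [seq Posz k | k <- iota 0 M] ++ [seq Negz k | k <- iota 0 M].
apply: (@le_trans _ _ (\sum_(j <- r) b `|j|%N)); last first.
  by rewrite /r big_cat !big_map; apply: lerD; [exact: tele|exact: tele'].
apply: sum_subset_le => //.
  rewrite cat_uniq !map_inj_uniq ?iota_uniq ?andbT//; try by move=> ? ? [].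
  by apply/hasPn => _ /mapP[k _ ->]; apply/negP => /mapP[].
move=> j js; have jM : (`|j| < M)%N by rewrite ltnS; apply: leq_bigmax_seq.
rewrite mem_cat; case: j js jM => n js jM; apply/orP; [left|right];
  apply/mapP; exists n => //; rewrite mem_iota leq0n add0n/=//.
by move: jM; rewrite NegzE abszN; exact: ltnW.
Qed.

(** [e^x >= x^N / N!] with [N p >= 2] compares the weights with an inverse
    square. *)
Lemma rsummable_weight (tau : R) : 0 < tau -> rsummable (wt tau).
Proof.
move=> t0; pose N := (Num.truncn (2 / p)).+1.
have Np : 2 <= N%:R * p by rewrite -ler_pdivrMr// ltW// truncnS_gt.
pose K := N`!%:R / tau ^+ N.
have K0 : 0 < K by rewrite divr_gt0 ?exprn_gt0// ltr0n fact_gt0.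
suff : rsummable (fun j : int => expR (- tau * (`|j|%N%:R : R) `^ p)).
  congr rsummable; apply/funext => j; rewrite /weight; congr (expR (_ * _ `^ p)).
  by rewrite -intr_norm -abszE.
apply: (@rsummable_int (fun k => expR (- tau * (k%:R : R) `^ p)) (2 + 6 * K)) => k.
rewrite expR_ge0/=.
have k12 : k.+1%:R^-1 - k.+2%:R^-1 = (k.+1%:R * k.+2%:R)^-1 :> R.
  have x0 : k.+1%:R != 0 :> R by rewrite pnatr_eq0.
  have y0 : k.+2%:R != 0 :> R by rewrite pnatr_eq0.
  move: x0 y0; rewrite -[k.+2%:R]natr1; move: (k.+1%:R : R) => x x0 y0.
  by field; rewrite x0 y0.
rewrite k12 ler_pdivlMr ?mulr_gt0//.
case: k {k12} => [|k].
  rewrite powR0 ?gt_eqF// mulr0 expR0 !mul1r; have := K0; lra.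
set x := tau * (k.+1%:R : R) `^ p.
have x0 : 0 < x by rewrite mulr_gt0 ?powR_gt0.
have hx : x ^+ N / N`!%:R <= expR x.
  by have := expR_ge1Dxn N.-1 (ltW x0); rewrite /N /=; apply: le_trans; rewrite lerDr.
have kN : k.+1%:R ^+ 2 <= ((k.+1%:R : R) `^ p) ^+ N.
  rewrite -!powR_mulrn ?powR_ge0// -powRrM [p * _]mulrC; apply: ler_powR => //.
  by rewrite ler1n.
have h : expR (- x) <= K / k.+1%:R ^+ 2.
  rewrite expRN -[leRHS]invrK lef_pV2 ?posrE ?invr_gt0 ?expR_gt0 ?divr_gt0 ?exprn_gt0//.
  apply: le_trans hx; rewrite /K /x exprMn invfM invrK invf_div.
  rewrite [leLHS]mulrAC; apply: ler_wpM2r; first by rewrite invr_ge0.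
  by apply: ler_wpM2l => //; rewrite exprn_ge0// ltW.
rewrite mulNr -/x.
apply: (@le_trans _ _ (K / k.+1%:R ^+ 2 * (k.+2%:R * k.+3%:R))).
  by rewrite ler_pM2r ?mulr_gt0.
have : (k.+2%:R * k.+3%:R : R) <= 6 * k.+1%:R ^+ 2.
  rewrite -natrM -natrX -natrM ler_nat; lia.
move=> h6; apply: (@le_trans _ _ (6 * K)); last by rewrite lerDr.
by rewrite mulrAC ler_pdivrMr ?exprn_gt0// [6 * K]mulrC -[leRHS]mulrA ler_pM2l.
Qed.

End Weights.

(** * Square-summable families and the comultiplication *)

Section Ell2.
Variables (R : realType) (I : choiceType).
Local Notation C := R[i].
Implicit Types (x y : I -> C).

Lemma ell2P x : ell2 x <-> rsummable (fun i => sqmod (x i)).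
Proof. by split=> [h|[]//]; split=> // i; exact: sqmod_ge0. Qed.

Lemma sqmod_le_sqnorm x i : ((sqmod (x i))%:E <= sqnorm x)%E.
Proof.
have := @sum_le_esum R I (fun i => sqmod (x i)) [:: i].
by rewrite big_seq1; apply=> // j; exact: sqmod_ge0.
Qed.

Lemma sqmodM (z w : C) : sqmod (z * w) = sqmod z * sqmod w.
Proof. by rewrite !sqmodE modcM exprMn. Qed.

Lemma sqmodR (a : R) : sqmod a%:C = a ^+ 2.
Proof. by rewrite sqmodE modcR real_normK ?num_real. Qed.

Lemma sqmod0 : sqmod (0 : C) = 0.
Proof. by rewrite sqmodE modc0 expr0n. Qed.

Lemma sqmodD_le (z w : C) : sqmod (z + w) <= 2 * (sqmod z + sqmod w).
Proof.
rewrite !sqmodE; apply: (@le_trans _ _ ((modc z + modc w) ^+ 2)).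
  by rewrite ler_pXn2r ?nnegrE ?addr_ge0 ?modc_ge0// modc_le_add.
have := sqr_ge0 (modc z - modc w); rewrite sqrrB sqrrD; lra.
Qed.

Lemma ell2_lin (c : C) x y : ell2 x -> ell2 y -> ell2 (fun i => c * x i + y i).
Proof.
move=> /ell2P sx /ell2P sy; apply/ell2P.
have [Mx Mx0 hx] := rsummable_sum_le sx; have [My My0 hy] := rsummable_sum_le sy.
apply: rsummableP => [i|]; first exact: sqmod_ge0.
exists (2 * (sqmod c * Mx + My)) => s us.
apply: (@le_trans _ _ (\sum_(i <- s) 2 * (sqmod c * sqmod (x i) + sqmod (y i)))).
  by apply: ler_sum => i _; rewrite -sqmodM sqmodD_le.
rewrite -mulr_sumr big_split/= -mulr_sumr ler_pM2l// lerD ?hy//.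
by rewrite ler_wpM2l ?sqmod_ge0 ?hx.
Qed.

Lemma ell2_fin x (s : seq I) : (forall i, i \notin s -> x i = 0) -> ell2 x.
Proof.
move=> xs; apply/ell2P; apply: (rsummable_fin (s := undup s)).
- by move=> i; exact: sqmod_ge0.
- exact: undup_uniq.
- by move=> i; rewrite mem_undup => /xs ->; exact: sqmod0.
Qed.

Lemma ell2_0 : ell2 (fun _ : I => 0 : C). Proof. exact: (ell2_fin (s := [::])). Qed.

Lemma ell2_basis (i : I) : @ell2 R I (basis_vec R i).
Proof.
by apply: (ell2_fin (s := [:: i])) => j; rewrite inE /basis_vec => /negbTE ->.
Qed.

End Ell2.

(** Two bounded linear maps that agree on a family agree on its closed span:
    [phi] is going to be one coordinate of their difference. *)
Section Functional.
Variables (R : realType) (I : choiceType) (phi : (I -> R[i]) -> R[i]) (M : R).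
Hypothesis phi_lin : forall (c : R[i]) x y, ell2 x -> ell2 y ->
  phi (fun i => c * x i + y i) = c * phi x + phi y.
Hypothesis phi_bnd : forall x (e : R), (sqnorm x <= e%:E)%E -> sqmod (phi x) <= M * e.

Definition in_kernel (y : I -> R[i]) : Prop := ell2 y /\ phi y = 0.

Lemma in_kernel0 : in_kernel (fun=> 0).
Proof.
split; first exact: ell2_0.
have := phi_lin (-1) (@ell2_0 R I) (@ell2_0 R I).
rewrite (_ : (fun _ => _) = (fun=> 0)); last by apply/funext => i; rewrite mulr0 addr0.
by rewrite mulN1r addNr.
Qed.

Lemma in_kernel_lin c x y : in_kernel x -> in_kernel y ->
  in_kernel (fun i => c * x i + y i).
Proof.
move=> [x2 x0] [y2 y0]; split; first exact: ell2_lin.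
by rewrite phi_lin// x0 y0 mulr0 addr0.
Qed.

Lemma in_kernel_sum (J : Type) (s : seq J) (c : J -> R[i]) (x : J -> I -> R[i]) :
  (forall j, in_kernel (x j)) -> in_kernel (fun i => \sum_(j <- s) c j * x j i).
Proof.
move=> kx; elim: s => [|j s ih].
  by rewrite (_ : (fun _ => _) = (fun=> 0)); [exact: in_kernel0|
    apply/funext => i; rewrite big_nil].
rewrite (_ : (fun _ => _) = (fun i => c j * x j i + \sum_(j <- s) c j * x j i)).
  exact: in_kernel_lin.
by apply/funext => i; rewrite big_cons.
Qed.

Lemma in_kernel_closed y : ell2 y -> 
  (forall e, 0 < e -> exists2 y', in_kernel y' &
    forall s, uniq s -> \sum_(i <- s) sqmod (y i - y' i) <= e) -> in_kernel y.
Proof.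
move=> y2 h; split=> //; apply/eqP; rewrite -modc_eq0 -sqrf_eq0 -sqmodE.
rewrite eq_le sqmod_ge0 andbT.
have [M1 [M10 MM1]] : exists M1, 0 < M1 /\ M <= M1.
  by exists (`|M| + 1); rewrite ltr_wpDl// (le_trans (ler_norm _)) ?lerDl.
apply/ler_addgt0Pl => e e0; rewrite addr0.
have [|y' [y'2 y'0] hy'] := h (e / M1); first by rewrite divr_gt0.
have yE : y = (fun i => 1 * y' i + (y i - y' i)).
  by apply/funext => i; rewrite mul1r addrC subrK.
have d2 : ell2 (fun i => y i - y' i).
  rewrite (_ : (fun _ => _) = (fun i => -1 * y' i + y i)); first exact: ell2_lin.
  by apply/funext => i; rewrite mulN1r addrC.
have phE : phi y = phi (fun i => y i - y' i).
  by rewrite [in LHS]yE phi_lin// y'0 mulr0 add0r.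
rewrite phE; apply: (@le_trans _ _ (M * (e / M1))); first exact/phi_bnd/esum_le.
rewrite mulrCA ler_piMr ?(ltW e0)// ler_pdivrMr// mul1r//.
Qed.

Lemma in_kernel_all y : (forall i, in_kernel (basis_vec R i)) -> ell2 y ->
  in_kernel y.
Proof.
move=> kb y2; apply: in_kernel_closed => // e e0.
have [s us hs] := rsummable_tail ((ell2P y).1 y2) e0.
exists (fun i => \sum_(j <- s) y j * basis_vec R j i); first exact: in_kernel_sum.
move=> r ur; rewrite (bigID (mem s))/= big1 ?add0r.
  rewrite -big_filter; apply: le_trans (hs [seq i <- r | i \notin s] _ _).
  - rewrite !big_filter; apply: ler_sum => i si.
    rewrite big_seq big1 ?subr0// => j js; rewrite /basis_vec.
    by case: eqP => [ij|]; [rewrite ij js in si|rewrite mulr0].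
  - exact: filter_uniq.
  - by move=> i; rewrite mem_filter => /andP[].
move=> i si; rewrite (bigD1_seq i)//= /basis_vec eqxx mulr1 big1 ?addr0 ?subrr ?sqmod0//.
by move=> j ji; rewrite eq_sym (negbTE ji) mulr0.
Qed.

End Functional.

Section Comult.
Variables (R : realType) (p : R).
Hypothesis (hp : 0 < p < 1).
Local Notation C := R[i].
Local Notation wt := (weight p).

(** Sampling at the [N]-th roots of unity isolates one frequency among those of
    absolute value below [N], at the price of bounded errors on the others. *)
Lemma char_average N (q : int) : (0 < N)%N ->
  let avg := (N%:R)^-1 * \sum_(r < N) char q (r%:R * (2 * pi / N%:R)) : C in
  modc avg <= 1 /\ ((`|q| < N)%N -> avg = (q == 0)%:R).
Proof.
move=> N0 avg; have NR : N%:R != 0 :> C by rewrite pnatr_eq0 -lt0n.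
have NRr : (N%:R : C) = (N%:R : R)%:C by rewrite rmorph_nat.
have N0R : 0 < N%:R :> R by rewrite ltr0n.
split.
  rewrite /avg modcM modcV NRr modcR gtr0_norm// ler_pdivrMl// mulr1.
  rewrite (le_trans (modc_sum _ _ _))//.
  under eq_bigr do rewrite modc_char.
  by rewrite sumr_const card_ord.
move=> qN; have [q0|q0] := eqVneq q 0.
  rewrite /avg q0; under eq_bigr do rewrite char0.
  by rewrite sumr_const card_ord mulVf.
set h := (2 * pi / N%:R : R); pose z := char q h : C.
have zr (r : nat) : char q (r%:R * h) = z ^+ r.
  elim: r => [|r ih]; first by rewrite mul0r charr0.
  by rewrite -natr1 mulrDl mul1r charD ih exprSr.
have zN : z ^+ N = 1.
  by rewrite -zr /h mulrC divfK ?gt_eqF// char2pi.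
have z1 : z != 1.
  apply/negP => /eqP; rewrite /z /char => -[cq _].
  pose y := `|q|%N%:R * (pi / N%:R) : R.
  have qh : cos (q%:~R * h) = cos (y *+ 2).
    rewrite -[LHS]cos_norm normrM (@ger0_norm _ h) ?divr_ge0 ?mulr_ge0 ?pi_ge0 ?ler0n//.
    have -> : `|q%:~R| = `|q|%N%:R :> R by rewrite -intr_norm -abszE.
    by congr cos; rewrite /y /h -mulr_natl; ring.
  have y0 : 0 < sin y.
    apply: sin_gt0_pi; rewrite /y mulr_gt0 ?divr_gt0 ?pi_gt0 ?ltr0n ?absz_gt0//=.
    by rewrite mulrCA gtr_pMr ?pi_gt0// ltr_pdivrMr// mul1r ltr_nat.
  move: cq; rewrite qh cos_mulr2n cos2sin2 => e.
  have : sin y ^+ 2 > 0 by rewrite exprn_gt0.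
  by move: e; rewrite mulr2n; lra.
rewrite /avg; under eq_bigr do rewrite zr.
have : (z - 1) * \sum_(r < N) z ^+ r = 0.
  by rewrite -subrX1 zN subrr.
by move/eqP; rewrite mulf_eq0 subr_eq0 (negbTE z1)/= => /eqP ->; rewrite mulr0.
Qed.

Section FixedTau.
Variables (tau : R) (htau : 0 < tau).

Local Notation sw j := (Num.sqrt (wt tau j)).

Lemma sqrtw_gt0 j : 0 < sw j. Proof. by rewrite sqrtr_gt0 weight_gt0. Qed.

Lemma sqr_sqrtw j : sw j ^+ 2 = wt tau j.
Proof. by rewrite sqr_sqrtr// ltW// weight_gt0. Qed.

Let wtC j : (wt tau j)%:C = (sw j)%:C ^+ 2.
Proof. by rewrite -rmorphXn /= sqr_sqrtw. Qed.

Let swC0 j : (sw j)%:C != 0.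
Proof. by rewrite (inj_eq (@complexI R) _ 0) gt_eqF// sqrtw_gt0. Qed.

(** Kernel sections are series in the frequencies [j] or [- j] according to the
    variable that is held fixed, whence the involution [sg]. *)
Lemma rk_coord_series (b : int -> R) (a : int -> C) (sg : int -> int) j :
  involutive sg -> rsummable b -> (forall i, modc (a i) <= b i) ->
  rk_coord p tau (fun x => csum (fun i => a i * char (sg i) x)) j =
    a (sg j) / (sw j)%:C.
Proof.
move=> sgK sb ab; rewrite /rk_coord; congr (_ / _).
under eq_fun do rewrite mulrC.
rewrite (haar_csum (a := fun i x => a i * char (sg i) x) sb); first last.
- apply: (cintegrable_bounded (M := 1)); first exact: cmeasurable_charJ.
  by move=> x; rewrite modcJ modc_char.
- by move=> i x; rewrite modcM modc_char mulr1.
- by move=> i; apply: cmeasurableM; [exact: cmeasurable_cst|exact: cmeasurable_char].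
have h i : haar (fun x => a i * char (sg i) x * (char j x)^*) = a i * (j == sg i)%:R.
  under eq_fun do rewrite -mulrA [char _ _ * _]mulrC.
  rewrite haarZ ?haar_charM//.
  apply: (cintegrable_bounded (M := 1)) => [|x].
    by apply: cmeasurableM; [exact: cmeasurable_charJ|exact: cmeasurable_char].
  by rewrite modcM modcJ !modc_char mulr1.
under [X in csum X]eq_fun do rewrite h.
rewrite (csum1 (j := sg j)) ?sgK ?eqxx ?mulr1// => i ij.
by case: eqP => [e|]; [rewrite e sgK eqxx in ij|rewrite mulr0].
Qed.

Lemma rk_coord_kernel x j : rk_coord p tau (rk_kernel p tau x) j =
  (sw j)%:C * char j (- x).
Proof.
have := @rk_coord_series (wt tau) (fun i => (wt tau i)%:C * char i (- x)) id j
  (fun=> erefl) (rsummable_weight hp htau).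
rewrite (_ : (fun _ => csum _) = rk_kernel p tau x); last first.
  apply/funext => y; rewrite /rk_kernel; congr csum; apply/funext => i.
  by rewrite charD -mulrA; congr (_ * _); rewrite mulrC.
move=> -> => [|i]; last by rewrite modcM modc_char mulr1 modcR ger0_norm// ltW// weight_gt0.
by rewrite wtC mulrAC expr2 mulfK.
Qed.

Lemma ell2_kernel x : ell2 (rk_coord p tau (rk_kernel p tau x)).
Proof.
apply/ell2P; rewrite (_ : (fun _ => _) = wt tau); first exact: rsummable_weight.
apply/funext => j; rewrite rk_coord_kernel sqmodM sqmodR sqmodE modc_char expr1n mulr1.
exact: sqr_sqrtw.
Qed.

Lemma Kint_coord g j : cintegrable g ->
  Kint p tau g j = (sw j)%:C * haar (fun y => (char j y)^* * g y).
Proof.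
move=> ig; rewrite /Kint.
have sb := rsummable_weight hp htau.
have hchar i : modc (haar (fun y => char i y * g y)) <= 2 * (1 * haar_abs g).
  by apply: modc_haarM_le => //; [exact: cmeasurable_char|move=> x; rewrite modc_char].
pose a i := (wt tau i)%:C * haar (fun y => char i y * g y).
have wtE i : modc (wt tau i)%:C = wt tau i.
  by rewrite modcR ger0_norm// ltW// weight_gt0.
have -> : (fun x => haar (fun y => rk_kernel p tau x y * g y)) =
          (fun x => csum (fun i => a i * char (- i) x)).
  apply/funext => x; rewrite (haar_csum (a := fun i y => (wt tau i)%:C * char i (y - x)) sb)//.
  - congr csum; apply/funext => i.
    transitivity (haar (fun y => (wt tau i)%:C * char i (- x) * (char i y * g y))).
      by congr haar; apply/funext => y; rewrite charD; ring.
    rewrite haarZ; first by rewrite charN charNl /a; ring.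
    apply: (cintegrableM (M := 1)) => //; first exact: cmeasurable_char.
    by move=> y; rewrite modc_char.
  - move=> i; apply: cmeasurableM; first exact: cmeasurable_cst.
    rewrite (_ : (fun _ => _) = (fun y => char i y * char i (- x))).
      by apply: cmeasurableM; [exact: cmeasurable_char|exact: cmeasurable_cst].
    by apply/funext => y; rewrite charD.
  - by move=> i y; rewrite modcM modc_char mulr1 wtE.
have sb' : rsummable (fun i => wt tau i * (2 * haar_abs g)).
  have [M M0 hM] := rsummable_sum_le sb; apply: rsummableP => [i|].
    by rewrite mulr_ge0 ?(ltW (weight_gt0 _ _ _))// mulr_ge0 ?haar_abs_ge0.
  exists (M * (2 * haar_abs g)) => s us.
  by rewrite -mulr_suml; apply: ler_wpM2r; [rewrite mulr_ge0 ?haar_abs_ge0|exact: hM].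
rewrite (@rk_coord_series _ _ (fun i => - i) j (@opprK _) sb') => [|i].
  rewrite /a weightN wtC [haar _](_ : _ = haar (fun y => (char j y)^* * g y)).
    by rewrite mulrAC expr2 mulfK.
  by congr haar; apply/funext => y; rewrite charNl.
rewrite /a modcM wtE ler_wpM2l ?(ltW (weight_gt0 _ _ _))//.
by have := hchar i; rewrite mul1r.
Qed.

(** The coordinates of the kernel section at [x] are [sw j * char j (- x)], so
    that multiplicativity of the characters in [j] forces these coefficients. *)
Definition comult_coord (y : int -> C) : int * int -> C :=
  fun k => y (k.1 + k.2) * (sw k.1 * sw k.2 / sw (k.1 + k.2))%:C.

Let coef_le k l : (sw k * sw l / sw (k + l)) ^+ 2 <=
  wt (tau * (1 - p)) k + wt (tau * (1 - p)) l.
Proof.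
have aux (a b c A B E M : R) : a ^+ 2 = A -> b ^+ 2 = B -> c ^+ 2 = E -> 0 < E ->
    A * B <= E * M -> (a * b / c) ^+ 2 <= M.
  by move=> <- <- <- c0 h; rewrite !exprMn exprVn ler_pdivrMr// [leRHS]mulrC.
apply: aux (sqr_sqrtw _) (sqr_sqrtw _) (sqr_sqrtw _) (weight_gt0 _ _ _) _.
exact: weight_subconv (ltW htau).
Qed.

(** For boundedness, [weight_subconv] splits the squared norm into two double
    sums; in each of them the translation-invariant sum of [sqmod (x (k + l))]
    is taken first. *)
Lemma is_comult_coord : is_comult p tau comult_coord.
Proof.
split; last first.
  move=> x; apply/funext => -[k l]; rewrite /= /comult_coord /tensor2 /=.
  rewrite !rk_coord_kernel charDl.
  rewrite [(_ / _)%:C]rmorphM rmorphM fmorphV /=.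
  have aux (a b c u v : C) : a != 0 -> a * (u * v) * (b * c / a) = b * u * (c * v).
    by move=> a0; field.
  exact: aux (swC0 _).
split=> [c x y _ _|].
  by apply/funext => k; rewrite /comult_coord mulrDl mulrA.
pose mu := wt (tau * (1 - p)).
have mu0 : rsummable mu.
  by apply: rsummable_weight => //; rewrite mulr_gt0// subr_gt0; case/andP: hp.
have [M M0 hM] := rsummable_sum_le mu0.
exists (2 * M) => x x2; have sx := (ell2P x).1 x2.
have fin : sqnorm x \is a fin_num := rsummable_fin_num sx.
have hS s : uniq s -> \sum_(i <- s) sqmod (x i) <= fine (sqnorm x).
  move=> us; rewrite -lee_fin fineK//; apply: sum_le_esum => // i.
  exact: sqmod_ge0.
have S0 : 0 <= fine (sqnorm x) by apply: le_trans (hS [::] isT); rewrite big_nil.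
rewrite -(fineK fin) -EFinM; apply: esum_le => s us.
have half (f : int -> int -> R) (K L : seq int) : uniq K -> uniq L ->
    (forall k l, f k l = sqmod (x (k + l)) * mu k) ->
    \sum_(k <- K) \sum_(l <- L) f k l <= M * fine (sqnorm x).
  move=> uK uL fE; apply: (@le_trans _ _ (\sum_(k <- K) mu k * fine (sqnorm x))).
    apply: ler_sum => k _; under eq_bigr do rewrite fE.
    rewrite -mulr_suml mulrC ler_wpM2l ?(ltW (weight_gt0 _ _ _))//.
    rewrite -(big_map (fun l => k + l) xpredT (fun j => sqmod (x j))).
    by apply: hS; rewrite map_inj_uniq//; exact: addrI.
  by rewrite -mulr_suml ler_wpM2r// hM.
pose K := undup [seq k.1 | k <- s]; pose L := undup [seq k.2 | k <- s].
pose f k l := sqmod (x (k + l)) * (mu k + mu l).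
apply: (@le_trans _ _ (\sum_(k <- s) f k.1 k.2)).
  apply: ler_sum => -[k l] _; rewrite /comult_coord /f sqmodM sqmodR /=.
  by apply: ler_wpM2l; [exact: sqmod_ge0|exact: coef_le].
have f0 k l : 0 <= f k l.
  by rewrite mulr_ge0 ?sqmod_ge0// addr_ge0// ltW// weight_gt0.
apply: (@le_trans _ _ (\sum_(k <- K) \sum_(l <- L) f k l)).
  have -> : \sum_(k <- K) \sum_(l <- L) f k l =
      \sum_(k <- [seq (k, l) | k <- K, l <- L]) f k.1 k.2 by rewrite big_allpairs.
  apply: sum_subset_le => //.
    by rewrite allpairs_uniq ?undup_uniq// => -[? ?] [? ?] _ _ /= [-> ->].
  move=> [k l] kl; apply/allpairsP; exists (k, l); split=> //=.
    by rewrite mem_undup; apply/mapP; exists (k, l).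
  by rewrite mem_undup; apply/mapP; exists (k, l).
under eq_bigr do under eq_bigr do rewrite /f mulrDr.
under eq_bigr do rewrite big_split/=.
rewrite big_split/= mulr2n mulrDl mul1r mulrDl; apply: lerD.
  by apply: half; rewrite ?undup_uniq.
by rewrite exchange_big; apply: half; rewrite ?undup_uniq// => k l; rewrite addrC.
Qed.

(** The kernel sections span a dense subspace: their averages over roots of
    unity isolate each basis vector up to an arbitrarily small tail. *)
Lemma is_comult_unique D1 D2 y : is_comult p tau D1 -> is_comult p tau D2 ->
  ell2 y -> D1 y = D2 y.
Proof.
move=> [[lin1 [M1 bnd1]] k1] [[lin2 [M2 bnd2]] k2] y2.
apply/funext => q; apply/eqP; rewrite -subr_eq0; apply/eqP.
pose phi z := D1 z q - D2 z q; pose M := 2 * (`|M1| + `|M2|).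
have phi_lin (c : C) u v : ell2 u -> ell2 v ->
    phi (fun i => c * u i + v i) = c * phi u + phi v.
  by move=> u2 v2; rewrite /phi lin1// lin2//; ring.
have phi_bnd u (e : R) : (sqnorm u <= e%:E)%E -> sqmod (phi u) <= M * e.
  move=> ue; have u2 : ell2 u := le_lt_trans ue (ltry _).
  have hM (D : (int -> C) -> (int * int -> C)) (N : R) :
      (forall x, ell2 x -> (sqnorm (D x) <= N%:E * sqnorm x)%E) ->
      sqmod (D u q) <= `|N| * e.
    move=> hD; rewrite -lee_fin; apply: le_trans (sqmod_le_sqnorm _ _) _.
    apply: le_trans (hD u u2) _.
    have fin : sqnorm u \is a fin_num := rsummable_fin_num ((ell2P u).1 u2).
    have S0 : 0 <= fine (sqnorm u).
      by apply/fine_ge0/esum_ge0 => i _; rewrite lee_fin sqmod_ge0.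
    move: ue; rewrite -(fineK fin) -EFinM !lee_fin => ue.
    by apply: le_trans (ler_wpM2l (normr_ge0 _) ue); rewrite ler_wpM2r// ler_norm.
  have := sqmodD_le (D1 u q) (- D2 u q).
  rewrite [sqmod (- _)]sqmodE modcN -sqmodE => /le_trans; apply.
  rewrite [leRHS](_ : _ = 2 * (`|M1| * e + `|M2| * e)); last by rewrite /M; ring.
  by apply: ler_wpM2l => //; apply: lerD; exact: hM.
suff [] : in_kernel phi y by [].
apply: (in_kernel_all phi_lin phi_bnd) => // j.
have kx0 x : in_kernel phi (rk_coord p tau (rk_kernel p tau x)).
  by split; [exact: ell2_kernel|rewrite /phi k1 k2 subrr].
suff : in_kernel phi (fun i => (sw j)%:C * basis_vec R j i).
  move=> h; rewrite (_ : basis_vec R j =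
      (fun i => ((sw j)%:C)^-1 * ((sw j)%:C * basis_vec R j i) + 0)).
    by apply: in_kernel_lin => //; exact: in_kernel0.
  by apply/funext => i; rewrite addr0 mulKf.
apply: (in_kernel_closed phi_lin phi_bnd) => [|e e0].
  by apply: (ell2_fin (s := [:: j])) => i; rewrite inE /basis_vec => /negbTE ->; rewrite mulr0.
have [s us hs] := rsummable_tail (rsummable_weight hp htau) e0.
pose N := (\max_(i <- s) `|j - i|%N).+1.
pose h := 2 * pi / N%:R : R.
exists (fun i => \sum_(r <- index_enum 'I_N) ((N%:R)^-1 * char j (r%:R * h)) *
    rk_coord p tau (rk_kernel p tau (r%:R * h)) i).
  exact: in_kernel_sum.
have yE i : \sum_(r <- index_enum 'I_N) ((N%:R)^-1 * char j (r%:R * h)) *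
    rk_coord p tau (rk_kernel p tau (r%:R * h)) i =
    (sw i)%:C * ((N%:R)^-1 * \sum_(r < N) char (j - i) (r%:R * h)).
  rewrite !mulr_sumr; apply: eq_bigr => r _.
  by rewrite rk_coord_kernel charN -charNl charDl; ring.
have small (a b c : C) : modc c <= 1 -> sqmod (a * 0 - b * c) <= sqmod b.
  move=> c1; rewrite mulr0 sub0r !sqmodE modcN modcM exprMn ler_piMr ?sqr_ge0//.
  by rewrite expr_le1// modc_ge0.
have null (a b : C) : sqmod (a * 0 - b * 0) = 0 by rewrite !mulr0 subrr sqmod0.
move=> r ur.
apply: (@le_trans _ _ (\sum_(i <- r | i \notin s) wt tau i)); last first.
  rewrite -big_filter; apply: hs; first exact: filter_uniq.
  by move=> i; rewrite mem_filter => /andP[].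
rewrite [X in X <= _](bigID (mem s))/= big1 ?add0r.
  apply: ler_sum => i si; rewrite yE; have [a1 a2] := @char_average N (j - i) isT.
  have [ij|ij] := eqVneq i j.
    rewrite /basis_vec ij eqxx mulr1; move: a2; rewrite ij subrr => -> //.
    by rewrite eqxx mulr1 subrr sqmod0 ltW// weight_gt0.
  rewrite /basis_vec (negbTE ij); apply: le_trans (small _ _ _ a1) _.
  by rewrite sqmodR sqr_sqrtw.
move=> i si; rewrite yE; have [_ a2] := @char_average N (j - i) isT.
rewrite a2; last by rewrite ltnS; apply: leq_bigmax_seq.
rewrite subr_eq0 /basis_vec eq_sym; case: eqP => [->|_].
  by rewrite subrr sqmod0.
by rewrite null.
Qed.
End FixedTau.
End Comult.

(** * The observable and the expectation as circle integrals *)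

Section Words.
Variable T : eqType.
Implicit Types (L s : seq T).

Fixpoint words L n : seq (seq T) :=
  if n is n'.+1 then [seq i :: s | i <- L, s <- words L n'] else [:: [::]].

Lemma mem_words L n s : (s \in words L n) = (size s == n) && all (mem L) s.
Proof.
elim: n s => [|n ih] [|i s] //=.
  by apply/negP => /allpairsP[[? ?] []].
apply/allpairsP/idP => [[[j r] /= [jL]]|].
  by rewrite ih => /andP[? ?] [-> ->]; rewrite eqSS jL /=; apply/andP.
by rewrite eqSS => /andP[sn /andP[iL sL]]; exists (i, s); rewrite /= ih sn sL.
Qed.

Lemma words_uniq L n : uniq L -> uniq (words L n).
Proof.
move=> uL; elim: n => //= n ih.
by apply: allpairs_uniq => // -[? ?] [? ?] _ _ /= [-> ->].
Qed.

Lemma sum_words (A : comPzRingType) L n (g : T -> A) :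
  \sum_(s <- words L n) \prod_(i <- s) g i = (\sum_(i <- L) g i) ^+ n.
Proof.
elim: n => [|n ih]; first by rewrite /= big_seq1 big_nil expr0.
rewrite /= (big_allpairs_dep) exprS -ih mulr_suml; apply: eq_bigr => i _.
by rewrite mulr_sumr; apply: eq_bigr => s _; rewrite big_cons.
Qed.

End Words.

Section Fock.
Variables (R : realType) (I : choiceType).
Local Notation C := R[i].
Implicit Types (u : I -> C) (F y z : seq I -> C).

Lemma fock_lift_diag u y s :
  fock_lift (diag_op u) y s = (\prod_(i <- s) u i) * y s.
Proof.
rewrite /fock_lift; elim: s y => [|i s ih] y /=; first by rewrite big_nil mul1r.
by rewrite /diag_op ih big_cons mulrA.
Qed.

Lemma innerE (J : choiceType) (x y : J -> C) :
  inner x y = csum (fun i => (x i)^* * y i).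
Proof. by []. Qed.

Lemma inner_basisr (J : choiceType) (j : J) (x : J -> C) :
  inner x (basis_vec R j) = (x j)^*.
Proof.
rewrite innerE (csum1 (j := j)) /basis_vec => [|i ij].
  by rewrite eqxx mulr1.
by rewrite (negbTE ij) mulr0.
Qed.

Lemma adjoint_diag (J : choiceType) (c x : J -> C) j :
  adjoint (diag_op c) x j = (c j)^* * x j.
Proof.
rewrite /adjoint innerE (csum1 (j := j)) /diag_op /basis_vec => [|i ij].
  by rewrite eqxx mulr1.
by rewrite conjM conjc_nat (negbTE ij) mulr0 mul0r.
Qed.

(** A rank-one state conjugated by a diagonal unitary is again of rank one, and
    its trace against [A] is a quadratic form in the rotated vector [G]. *)
Lemma expectation_rank_one u F (A : (seq I -> C) -> (seq I -> C)) :
  let U := fock_lift (diag_op u) in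
  let G s := (\prod_(i <- s) u i)^* * F s in
  Defs.expectation (adjoint U \o rank_one F \o U) A =
  csum (fun s => G s * csum (fun r => (G r)^* * A (basis_vec R s) r)).
Proof.
move=> U G; rewrite /Defs.expectation /op_trace; congr csum; apply/funext => s /=.
have UE : U = diag_op (fun s => \prod_(i <- s) u i).
  by apply/funext => y; apply/funext => r; rewrite /U fock_lift_diag.
rewrite UE adjoint_diag /rank_one mulrCA mulrC /G; congr (_ * _).
rewrite innerE; congr csum; apply/funext => r.
by rewrite /diag_op conjM conjcK; ring.
Qed.

End Fock.

Section Observable.
Variables (R : realType) (p : R).
Hypothesis (hp : 0 < p < 1).
Variables (tau : R) (htau : 0 < tau).
Local Notation C := R[i].
Local Notation wt := (weight p).
Local Notation sw j := (Num.sqrt (wt tau j)).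

Lemma comultP : is_comult p tau (comult p tau).
Proof.
rewrite /comult; case: pselect => [e|ne]; first exact: (projT2 (cid e)).
by exfalso; apply: ne; exists (comult_coord p tau); exact: is_comult_coord.
Qed.

Lemma comultE y : ell2 y -> comult p tau y = comult_coord p tau y.
Proof. by apply: (is_comult_unique hp htau comultP); exact: is_comult_coord. Qed.

(** Coefficient of the word [s] in the iterated comultiplication of the basis
    vector of index [\sum_(i <- s) i]: the two-letter coefficients telescope. *)
Definition wcoef (s : seq int) : R :=
  (\prod_(i <- s) sw i) / sw (\sum_(i <- s) i).

Lemma prod_sqrtw_gt0 (s : seq int) : 0 < \prod_(i <- s) sw i.
Proof. by apply: prodr_gt0 => i _; exact: sqrtw_gt0. Qed.

Lemma wcoef_ge0 s : 0 <= wcoef s.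
Proof. by rewrite divr_ge0 ?(ltW (prod_sqrtw_gt0 _))// ltW ?sqrtw_gt0. Qed.

Lemma wcoef_le1 s : wcoef s <= 1.
Proof.
rewrite ler_pdivrMr ?sqrtw_gt0// mul1r.
elim: s => [|i s ih]; first by rewrite !big_nil weight0// sqrtr1.
rewrite !big_cons.
apply: (@le_trans _ _ (sw i * sw (\sum_(i <- s) i))).
  by apply: ler_wpM2l; [exact/ltW/sqrtw_gt0|exact: ih].
have -> : sw i * sw (\sum_(i <- s) i) = Num.sqrt (wt tau i * wt tau (\sum_(i <- s) i)).
  by apply/esym/sqrtrM/ltW/weight_gt0.
apply: ler_wsqrtr; exact: weight_supermul (ltW htau).
Qed.

Lemma wcoef_merge k l s :
  wcoef (k + l :: s) * (sw k * sw l / sw (k + l)) = wcoef (k :: l :: s).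
Proof.
rewrite /wcoef !big_cons !addrA.
have := sqrtw_gt0 p tau (k + l); have := sqrtw_gt0 p tau (k + l + \sum_(i <- s) i).
have aux (a b c d e : R) : 0 < a -> 0 < b -> b * c / a * (d * e / b) = d * (e * c) / a.
  by move=> a0 b0; field; rewrite !gt_eqF.
exact: aux.
Qed.

(** The comultiplication is determined on square-summable families only, so
    each slice of the previous iterate must be shown to be one. *)
Lemma ell2_slice y (r : seq int) : ell2 y ->
  ell2 (fun j => y (\sum_(i <- j :: r) i) * (wcoef (j :: r))%:C).
Proof.
move=> y2; have sy := (ell2P y).1 y2; have [M M0 hM] := rsummable_sum_le sy.
apply/ell2P; apply: rsummableP => [j|]; first exact: sqmod_ge0.
exists M => s us; set q := \sum_(i <- r) i.
apply: (@le_trans _ _ (\sum_(j <- s) sqmod (y (j + q)))).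
  apply: ler_sum => j _; rewrite sqmodM sqmodR big_cons -/q ler_piMr ?sqmod_ge0//.
  by rewrite expr_le1// ?wcoef_le1 ?wcoef_ge0.
rewrite -(big_map (fun j => j + q) xpredT (fun j => sqmod (y j))).
by apply: hM; rewrite map_inj_uniq//; exact: addIr.
Qed.

Lemma comult_nE n y s : ell2 y -> comult_n p tau n y s =
  if size s == n.+1 then y (\sum_(i <- s) i) * (wcoef s)%:C else 0.
Proof.
move=> y2; rewrite /comult_n; elim: n s => [|n ih] s /=.
  case: s => [|j [|]]//=; rewrite big_seq1 /wcoef !big_seq1 divff ?mulr1//.
  by rewrite gt_eqF// sqrtw_gt0.
case: s => [|k [|l r]]//; rewrite /on_first.
rewrite (_ : (fun j => _) = fun j => if size r == n then
    y (\sum_(i <- j :: r) i) * (wcoef (j :: r))%:C else 0); last first.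
  by apply/funext => j; rewrite ih /= eqSS.
rewrite /= !eqSS; case: eqP => _; last first.
  by rewrite comultE ?/comult_coord ?mul0r//; exact: ell2_0.
rewrite comultE ?/comult_coord/=; last exact: ell2_slice.
rewrite -mulrA -(rmorphM (real_complex R)) wcoef_merge; congr (y _ * _).
by rewrite !big_cons addrA.
Qed.

Definition psis (s : seq int) (x : R) : C := \prod_(i <- s) psi p tau i x.

Lemma psisE s x : psis s x =
  (\prod_(i <- s) sw i)%:C * char (\sum_(i <- s) i) x.
Proof.
rewrite /psis; elim: s => [|i s ih]; first by rewrite !big_nil char0 mulr1.
rewrite !big_cons ih charDl (rmorphM (real_complex R)) /psi; ring.
Qed.

Lemma cmeasurable_psi j : cmeasurable (psi p tau j).
Proof. by apply: cmeasurableM; [exact: cmeasurable_cst|exact: cmeasurable_char]. Qed.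

Lemma modc_psi j x : modc (psi p tau j x) = sw j.
Proof. by rewrite /psi modcM modc_char mulr1 modcR ger0_norm// sqrtr_ge0. Qed.

Lemma cmeasurable_psis s : cmeasurable (psis s).
Proof. by apply: cmeasurable_prod => i; exact: cmeasurable_psi. Qed.

Lemma modc_psis s x : modc (psis s x) <= \prod_(i <- s) sw i.
Proof. by rewrite /psis modc_prod; under eq_bigr do rewrite modc_psi. Qed.

Lemma ell2_Kint g : cintegrable g -> ell2 (Kint p tau g).
Proof.
move=> ig; apply/ell2P; pose K := 2 * (1 * haar_abs g).
have K0 : 0 <= K by rewrite mulr_ge0// mul1r haar_abs_ge0.
have [M M0 hM] := rsummable_sum_le (rsummable_weight hp htau).
apply: rsummableP => [j|]; first exact: sqmod_ge0.
exists (M * K ^+ 2) => s us.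
apply: (@le_trans _ _ (\sum_(j <- s) wt tau j * K ^+ 2)).
  apply: ler_sum => j _; rewrite Kint_coord// sqmodM sqmodR sqr_sqrtw//.
  apply: ler_wpM2l; first exact: ltW (weight_gt0 _ _ _).
  rewrite sqmodE ler_pXn2r ?nnegrE ?modc_ge0//.
  apply: modc_haarM_le => //; first exact: cmeasurable_charJ.
  by move=> x; rewrite modcJ modc_char.
by rewrite -mulr_suml; apply: ler_wpM2r; [exact: sqr_ge0|exact: hM].
Qed.

Lemma adjoint_comult_n n s i : adjoint (comult_n p tau n) (basis_vec R s) i =
  ((size s == n.+1) && (i == \sum_(j <- s) j))%:R * (wcoef s)%:C.
Proof.
rewrite /adjoint inner_basisr comult_nE; last exact: ell2_basis.
case: eqP => _; last by rewrite conj0 andFb mul0r.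
by rewrite andTb conjM conjR /basis_vec conjc_nat eq_sym.
Qed.

Lemma rk_inclusion_adjoint n s x :
  rk_inclusion p tau (adjoint (comult_n p tau n) (basis_vec R s)) x =
  (size s == n.+1)%:R * psis s x.
Proof.
rewrite /rk_inclusion (csum1 (j := \sum_(j <- s) j)) => [|i ij].
  rewrite adjoint_comult_n eqxx andbT -mulrA; congr (_ * _).
  rewrite psisE /psi /wcoef mulrA -(rmorphM (real_complex R)) divfK//.
  by rewrite gt_eqF// sqrtw_gt0.
by rewrite adjoint_comult_n (negbTE ij) andbF !mul0r.
Qed.

(** The comultiplication and its adjoint are the pointwise product in disguise:
    the matrix of the observable in degree [n + 1] is that of multiplication by
    [f] between products of [n + 1] basis functions. *)
Lemma observable_basis f n s r : cintegrable f ->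
  observable p f tau n.+1 (basis_vec R s) r =
  if (size r == n.+1) && (size s == n.+1)
  then haar (fun x => (psis r x)^* * psis s x * f x) else 0.
Proof.
move=> jf; rewrite /observable /=.
set g := fun x => _.
have gE : g = fun x => (size s == n.+1)%:R * psis s x * f x.
  by apply/funext => x; rewrite /g rk_inclusion_adjoint mulrC.
have ig : cintegrable g.
  rewrite gE; apply: (cintegrableM (M := \prod_(i <- s) sw i)) => //.
    by apply: cmeasurableM; [exact: cmeasurable_cst|exact: cmeasurable_psis].
  move=> x; rewrite modcM (le_trans _ (modc_psis s x))// ler_piMl ?modc_ge0//.
  by case: eqP => _; rewrite ?modc1 ?modc0.
rewrite comult_nE; last exact: ell2_Kint.
case: eqP => //= _; rewrite Kint_coord// mulrAC -(rmorphM (real_complex R)) /wcoef.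
rewrite [sw _ * _]mulrC divfK; last by rewrite gt_eqF// sqrtw_gt0.
rewrite -haarZ; last first.
  apply: (cintegrableM (M := 1)) => //; first exact: cmeasurable_charJ.
  by move=> x; rewrite modcJ modc_char.
case: eqP => sn.
  congr haar; apply/funext => x; rewrite gE sn eqxx mul1r [psis r x]psisE conjM conjR.
  by rewrite !mulrA.
rewrite -[RHS]haar0; congr haar; apply/funext => x; rewrite gE.
by case: eqP => // _; rewrite !mul0r !mulr0.
Qed.

(** Only words over the finite set [L] of frequencies contribute, so the trace
    is a finite double sum. Inside the integral it factors into a product over
    letters: the [n + 1]-st power of [h] times its conjugate. *)
Lemma expectation_observable f n (u v : int -> C) (L : seq int)
    (F : seq int -> C) (w : R) : cintegrable f -> uniq L ->
  (forall i, i \notin L -> v i = 0) ->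
  (forall s, size s = n.+1 -> F s = w%:C * \prod_(i <- s) v i) ->
  let U := fock_lift (diag_op u) in
  let h x := \sum_(i <- L) (u i)^* * v i * psi p tau i x in
  Defs.expectation (adjoint U \o rank_one F \o U) (observable p f tau n.+1) =
  (w ^+ 2)%:C * haar (fun x => ((modc (h x)) ^+ (2 * n.+1))%:C * f x).
Proof.
move=> jf uL vL FE U h; rewrite expectation_rank_one.
pose G s := (\prod_(i <- s) u i)^* * F s.
change (csum (fun s => G s * csum (fun r => (G r)^* *
    observable p f tau n.+1 (basis_vec R s) r)) =
  (w ^+ 2)%:C * haar (fun x => ((modc (h x)) ^+ (2 * n.+1))%:C * f x)).
pose W := words L n.+1; have uW : uniq W := words_uniq _ uL.
have GE s : size s = n.+1 -> G s = w%:C * \prod_(i <- s) ((u i)^* * v i).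
  by move=> sn; rewrite /G FE// big_split/= conj_prod mulrCA.
have GW s : size s = n.+1 -> s \notin W -> G s = 0.
  move=> sn; rewrite mem_words sn eqxx /= => /allPn[i si iL].
  by rewrite GE// (big_rem i)//= vL// !(mulr0, mul0r).
clearbody G.
have bnd s r x : modc ((psis r x)^* * psis s x) <= (\prod_(i <- r) sw i) * (\prod_(i <- s) sw i).
  by rewrite modcM modcJ ler_pM ?modc_ge0 ?modc_psis.
have ms r s : cmeasurable (fun x => (psis r x)^* * psis s x).
  by apply: cmeasurableM; [apply: cmeasurableJ|]; exact: cmeasurable_psis.
have ii s r : cintegrable (fun x => (psis r x)^* * psis s x * f x).
  by apply: (cintegrableM (ms r s) (bnd s r)).
have inner_sum s : csum (fun r => (G r)^* * observable p f tau n.+1 (basis_vec R s) r) =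
  if size s == n.+1 then
    \sum_(r <- W) (G r)^* * haar (fun x => (psis r x)^* * psis s x * f x) else 0.
  rewrite (csum_fin uW) => [|r rW]; last first.
    rewrite observable_basis//; case: (eqVneq (size r) n.+1) => [rn|]/=; last by rewrite mulr0.
    by rewrite GW// conj0 mul0r.
  case: eqP => sn; last first.
    rewrite big1// => r _; rewrite observable_basis// andbC; case: eqP => //=.
    by rewrite mulr0.
  rewrite big_seq [RHS]big_seq; apply: eq_bigr => r; rewrite mem_words => /andP[rn _].
  by rewrite observable_basis// rn sn eqxx.
rewrite (csum_fin uW) => [|s sW]; last first.
  rewrite inner_sum; case: eqP => sn; last by rewrite mulr0.
  by rewrite GW// mul0r.
have sumW x : \sum_(s <- W) G s * psis s x = w%:C * (h x) ^+ n.+1.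
  rewrite -sum_words mulr_sumr big_seq [RHS]big_seq; apply: eq_bigr => s.
  rewrite mem_words => /andP[/eqP sn _].
  by rewrite GE// -mulrA; congr (_ * _); rewrite [RHS]big_split.
transitivity (haar (fun x => \sum_(s <- W) \sum_(r <- W)
   (G s * (G r)^*) * ((psis r x)^* * psis s x * f x))).
  rewrite haar_sum => [|s]; last by apply: cintegrable_sum => r; exact: cintegrableZ.
  rewrite big_seq [RHS]big_seq; apply: eq_bigr => s; rewrite mem_words => /andP[sn _].
  rewrite inner_sum sn haar_sum => [|r]; last exact: cintegrableZ.
  by rewrite mulr_sumr; apply: eq_bigr => r _; rewrite haarZ// mulrA.
rewrite -haarZ; last first.
  pose K := \sum_(i <- L) modc ((u i)^* * v i) * sw i.
  have hK x : modc (h x) <= K.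
    by rewrite (le_trans (modc_sum _ _ _))//; apply: ler_sum => i _; rewrite modcM modc_psi.
  apply: (cintegrableM (M := K ^+ (2 * n.+1))) => //.
    rewrite (_ : (fun _ => _) = fun x => (h x * (h x)^*) ^+ n.+1).
      have mh : cmeasurable h.
        apply: cmeasurable_sum => i; apply: cmeasurableM; first exact: cmeasurable_cst.
        exact: cmeasurable_psi.
      by apply: cmeasurableX; apply: cmeasurableM => //; exact: cmeasurableJ.
    by apply/funext => x; rewrite mulcJ -rmorphXn -exprM.
  move=> x; rewrite modcR ger0_norm ?exprn_ge0 ?modc_ge0//.
  by rewrite ler_pXn2r ?nnegrE ?modc_ge0// (le_trans (modc_ge0 _) (hK x)).
congr haar; apply/funext => x.
transitivity ((\sum_(s <- W) G s * psis s x) * (\sum_(r <- W) G r * psis r x)^* * f x).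
  have aux (a b c d e : C) : a * b * (c * d * e) = a * d * (b * c) * e by ring.
  rewrite conj_sum mulr_suml mulr_suml; apply: eq_bigr => s _.
  by rewrite mulr_sumr mulr_suml; apply: eq_bigr => r _; rewrite conjM; exact: aux.
rewrite sumW mulcJ modcM modcR modcX mulrA; congr (_ * _).
by rewrite -rmorphM /= exprMn real_normK ?num_real// -exprM mulnC.
Qed.

End Observable.

(** * The exponential series *)

Section ExpSeries.
Variable R : realType.
Local Notation C := R[i].
Implicit Types (x y b r : R).

Lemma cvg_exp_sum x : \sum_(0 <= k < n) (x ^+ k / k`!%:R) @[n --> \oo] --> expR x.
Proof. exact: is_cvg_series_exp_coeff. Qed.

Lemma exp_sum_le x (s : seq nat) : 0 <= x -> uniq s ->
  \sum_(k <- s) (x ^+ k / k`!%:R) <= expR x.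
Proof.
move=> x0 us; pose n := (\max_(k <- s) k).+1.
have t0 k : 0 <= x ^+ k / k`!%:R by rewrite divr_ge0 ?exprn_ge0.
apply: (@le_trans _ _ (\sum_(0 <= k < n) (x ^+ k / k`!%:R))).
  apply: sum_subset_le => //; first exact: iota_uniq.
  by move=> k ks; rewrite mem_index_iota ltnS; apply: leq_bigmax_seq.
apply: (nondecreasing_cvgn_le (u_ := fun n => \sum_(0 <= k < n) (x ^+ k / k`!%:R))).
  by apply: nondecreasing_series.
exact: is_cvg_series_exp_coeff.
Qed.

(** The tail of the exponential series decreases faster than any geometric
    sequence: compare [b^k] with [r^-N (r b)^k] for [k >= N]. *)
Lemma expR_taylor b r y N : `|y| <= b -> 1 <= r ->
  `|expR y - \sum_(0 <= k < N) (y ^+ k / k`!%:R)| <= r ^- N * expR (r * b).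
Proof.
move=> yb r1; have b0 : 0 <= b := le_trans (normr_ge0 _) yb.
have r0 : 0 < r := lt_le_trans ltr01 r1.
have tail n : (N <= n)%N -> `|\sum_(0 <= k < n) (y ^+ k / k`!%:R) -
    \sum_(0 <= k < N) (y ^+ k / k`!%:R)| <= r ^- N * expR (r * b).
  move=> Nn; rewrite [X in X - _](big_cat_nat (n := N))//= addrAC subrr add0r.
  rewrite (le_trans (ler_norm_sum _ _ _))//.
  apply: (@le_trans _ _ (\sum_(N <= k < n) r ^- N * ((r * b) ^+ k / k`!%:R))).
    rewrite big_nat_cond [leRHS]big_nat_cond; apply: ler_sum => k /andP[/andP[Nk _] _].
    rewrite normrM normfV normrX normr_nat mulrA ler_wpM2r ?invr_ge0//.
    apply: (@le_trans _ _ (b ^+ k)); first by rewrite lerXn2r ?nnegrE.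
    rewrite exprMn mulrA.
    have -> : r ^+ k = r ^+ (k - N) * r ^+ N by rewrite -exprD subnK.
    rewrite [r ^- N * _]mulrC mulfK ?gt_eqF ?exprn_gt0//.
    by rewrite ler_peMl ?exprn_ge0// exprn_ege1.
  rewrite -mulr_sumr ler_pM2l ?invr_gt0 ?exprn_gt0//.
  by apply: exp_sum_le; [rewrite mulr_ge0// ltW|exact: iota_uniq].
apply/ler_addgt0Pl => e e0.
have /cvgrPdist_le/(_ _ e0)[M _ hM] := @cvg_exp_sum y.
pose n := maxn M N.
have h1 := hM n (leq_maxl M N); have h2 := tail n (leq_maxr M N).
rewrite -(subrKA (\sum_(0 <= k < n) (y ^+ k / k`!%:R))).
by rewrite (le_trans (ler_normD _ _))// lerD.
Qed.

Lemma csum_nat (a : nat -> C) (b : nat -> R) (L : C) : rsummable b ->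
  (forall k, modc (a k) <= b k) ->
  (forall e : R, 0 < e -> exists M, forall n, (M <= n)%N ->
     modc (L - \sum_(0 <= k < n) a k) <= e) -> csum a = L.
Proof.
move=> sb ab h; apply/eqP; rewrite -subr_eq0 -modc_eq0 eq_le modc_ge0 andbT.
apply/ler_addgt0Pl => e e0; rewrite addr0.
have e20 : 0 < e / 2 by rewrite divr_gt0.
have [s us hs] := csum_approx sb e20; have [M hM] := h _ e20.
pose n := maxn M (\max_(k <- s) k).+1.
have h1 := hM n (leq_maxl _ _).
have h2 : modc (csum a - \sum_(0 <= k < n) a k) <= e / 2.
  apply: hs => //; first exact: iota_uniq.
  move=> k ks; rewrite mem_index_iota leq0n (leq_trans _ (leq_maxr _ _))//.
  by rewrite ltnS; apply: leq_bigmax_seq.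
rewrite -(subrKA (\sum_(0 <= k < n) a k)) (le_trans (modc_le_add _ _))//.
by rewrite [X in _ + X]modcB; lra.
Qed.

Lemma pow_imaginary y k : (0 +i* y) ^+ k =
  ((~~ odd k)%:R * (-1) ^+ k./2 * y ^+ k) +i*
  ((odd k)%:R * (-1) ^+ k.-1./2 * y ^+ k) :> C.
Proof.
elim: k => [|k ih]; first by rewrite expr0 /= !expr0 !mulr1.
rewrite exprS ih; simpc; rewrite /= uphalf_half negbK.
case: (boolP (odd k)) => ok /=.
  have -> : (1 + k./2)%N = (k.-1./2).+1.
    by clear ih; case: k ok => //= k /negbTE ok; rewrite uphalf_half ok.
  by rewrite !exprS; congr (_ +i* _); ring.
by rewrite !exprS; congr (_ +i* _); ring.
Qed.

Lemma csum_exp_imaginary y (c : C) :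
  csum (fun k : nat => (k`!%:R)^-1 * ((0 +i* y) ^+ k * c)) = char 1 y * c.
Proof.
pose b k := `|y| ^+ k / k`!%:R * modc c.
have natC (n : nat) : (n%:R : C) = (n%:R : R)%:C by rewrite rmorph_nat.
have my k : modc ((0 +i* y) ^+ k : C) = `|y| ^+ k.
  by rewrite modcX /modc /sqmod /= expr0n add0r sqrtr_sqr.
have sb : rsummable b.
  apply: rsummableP => [k|]; first by rewrite mulr_ge0 ?modc_ge0// divr_ge0 ?exprn_ge0.
  exists (expR `|y| * modc c) => s us; rewrite -mulr_suml ler_wpM2r ?modc_ge0//.
  exact: exp_sum_le.
apply: (csum_nat sb) => [k|e e0].
  by rewrite modcM modcV natC modcR normr_nat modcM my /b mulrA [_^-1 * _]mulrC.
have termE k : (k`!%:R)^-1 * ((0 +i* y) ^+ k * c) =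
    (cos_coeff y k +i* sin_coeff y k) * c.
  rewrite mulrA; congr (_ * _); rewrite pow_imaginary natC -fmorphV /=.
  rewrite /real_complex_def; simpc; rewrite /cos_coeff /sin_coeff /= -!exprnP.
  by congr (_ +i* _); ring.
have cc : series (cos_coeff y) @ \oo --> cos y.
  by rewrite unlock; exact: is_cvg_series_cos_coeff.
have cs : series (sin_coeff y) @ \oo --> sin y.
  by rewrite unlock; exact: is_cvg_series_sin_coeff.
pose d := e / (2 * (modc c + 1)).
have c1 : 0 < modc c + 1 by rewrite ltr_wpDl ?modc_ge0.
have d0 : 0 < d by rewrite divr_gt0// mulr_gt0.
move/cvgrPdist_le/(_ _ d0) : cc => [M1 _ h1].
move/cvgrPdist_le/(_ _ d0) : cs => [M2 _ h2].
exists (maxn M1 M2) => n; rewrite geq_max => /andP[/h1 h1n /h2 h2n].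
under eq_bigr do rewrite termE.
rewrite -mulr_suml -mulrBl modcM.
have hm : modc (char 1 y - \sum_(0 <= k < n) (cos_coeff y k +i* sin_coeff y k)) <= d + d.
  rewrite (le_trans (modc_le_ReIm _))//.
  rewrite !(ReD, ImD) !(ReN, ImN) Re_sum Im_sum /char /= mul1r.
  exact: lerD.
apply: le_trans (ler_wpM2r (modc_ge0 c) hm) _.
have -> : d + d = e / (modc c + 1) by rewrite /d; field; rewrite gt_eqF.
by rewrite mulrAC ler_pdivrMr// ler_wpM2l ?(ltW e0)// lerDl.
Qed.

Lemma opexp_diag (I : choiceType) (th : I -> R) (t : R) :
  opexp (opscale t%:C (diag_op (fun i => 0 +i* th i))) =
  diag_op (fun i => char 1 (t * th i)).
Proof.
apply/funext => x; apply/funext => i; rewrite /opexp /diag_op.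
rewrite -csum_exp_imaginary; congr csum; apply/funext => k; congr (_ * _).
have tE (c : C) : t%:C * ((0 +i* th i) * c) = (0 +i* (t * th i)) * c.
  by rewrite mulrA; congr (_ * _); simpc.
elim: k => [|k ih] /=; first by rewrite expr0 mul1r.
by rewrite /opscale ih tE exprS mulrA.
Qed.

End ExpSeries.

(** * The regularized generators *)

Section Generators.
Variables (R : realType) (p alpha : R).
Hypotheses (hp : 0 < p < 1) (halpha : 0 < alpha).
Local Notation C := R[i].
Local Notation wt := (weight p).

(** The eigenvalue of the regularized generator is [i] times this real number;
    the second scheme applies the branch [qinv]. *)
Definition frequency (s : scheme R) (tau : R) (j : int) : R :=
  match s with
  | CompactApprox => alpha * j%:~R * wt tau j
  | CompactResolvent z =>
    if j == 0 then 0 else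
    let om := alpha * j%:~R * wt tau j / (z ^+ 2 + (alpha * j%:~R) ^+ 2) in
    (1 + Num.sqrt (1 - 4 * z ^+ 2 * om ^+ 2)) / (2 * om)
  end.

Lemma Vcompact_diag tau : Vcompact p alpha tau =
  diag_op (fun j => 0 +i* (alpha * j%:~R * wt tau j)).
Proof.
apply/funext => x; apply/funext => j; rewrite /Vcompact /Kself /generatorV /diag_op /=.
rewrite !mulrA; congr (_ * _).
have -> : wt tau j = wt (tau / 2) j * wt (tau / 2) j.
  by rewrite /weight -expRD; congr expR; field.
by rewrite /real_complex_def; simpc; congr (_ +i* _); ring.
Qed.

Lemma Qresolvent_eigenvalue z tau j : 0 < z ->
  Qresolvent p alpha z tau (basis_vec R j) j =
  0 +i* (alpha * j%:~R * wt tau j / (z ^+ 2 + (alpha * j%:~R) ^+ 2)).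
Proof.
move=> z0; rewrite /Qresolvent /= Vcompact_diag /resolvent adjoint_diag.
rewrite /diag_op /basis_vec eqxx mulr1.
set a := alpha * _; set v := 0 +i* _; set r := (z +i* (- a))^-1.
have -> : r^* * (v * r) = v * (r * r^*) by ring.
have za : 0 < z ^+ 2 + a ^+ 2 by rewrite ltr_pwDl ?exprn_gt0// sqr_ge0.
have -> : r * r^* = ((z ^+ 2 + a ^+ 2)^-1)%:C.
  by rewrite mulcJ /r modcV exprVn -sqmodE /sqmod /= sqrrN.
by rewrite /v /real_complex_def; simpc.
Qed.

Lemma generatorW_diag s tau : admissible alpha s ->
  generatorW p alpha s tau = diag_op (fun j => 0 +i* frequency s tau j).
Proof.
case: s => [_|z /= /andP[z0 _]]; first exact: Vcompact_diag.
apply/funext => x; apply/funext => j; rewrite /Vresolvent /funcalc /= /diag_op.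
rewrite /proj_zero_mean /frequency; case: (eqVneq j 0) => j0.
  by rewrite mulr0 [X in X * _](_ : _ = 0)// mul0r.
by rewrite Qresolvent_eigenvalue.
Qed.

Lemma Um_diag s tau m t : admissible alpha s ->
  Um p alpha s tau m t = diag_op (fun j => char 1 (t *
    (if j \in [seq fourier_index i | i <- iota 0 m.+1] then frequency s tau j else 0))).
Proof.
move=> hs; rewrite /Um -opexp_diag; congr opexp; congr opscale.
apply/funext => x; apply/funext => j; rewrite /generatorWm /= generatorW_diag//.
rewrite /proj_first /diag_op; case: ifP => [->//|_].
by rewrite [X in X * _](_ : _ = 0)// mul0r.
Qed.

Lemma frequency0 s tau : frequency s tau 0 = 0.
Proof. by case: s => [|z] /=; rewrite ?mulr0 ?mul0r. Qed.

Lemma cvg_weight0 j : wt tau j @[tau --> (0 : R)] --> (1 : R).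
Proof.
have h : - tau * `|j%:~R| `^ p @[tau --> (0 : R)] --> - (0 : R) * `|j%:~R| `^ p.
  by apply: cvgMl; apply: cvgN; exact: cvg_id.
rewrite oppr0 mul0r in h; rewrite -expR0.
exact: (continuous_cvg _ (@continuous_expR R 0) h).
Qed.

(** For [j != 0], [z <= alpha <= |alpha j|], and the radicand at [tau = 0] is the square of
    [(alpha^2 j^2 - z^2) / (alpha^2 j^2 + z^2) >= 0], so that the branch picks
    the true eigenvalue. *)
Lemma cvg_frequency s j : admissible alpha s ->
  frequency s tau j @[tau --> (0 : R)] --> alpha * j%:~R.
Proof.
case: s => [_|z /= /andP[z0 za]].
  rewrite -[X in _ --> X]mulr1; apply: cvgMr; exact: cvg_weight0.
have [->|j0] := eqVneq j 0; first by rewrite mulr0; exact: cvg_cst.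
set a := alpha * j%:~R; set q := z ^+ 2 + a ^+ 2.
have a0 : a != 0 by apply: mulf_neq0; [rewrite gt_eqF|rewrite intr_eq0].
have q0 : 0 < q by rewrite ltr_pwDl ?exprn_gt0// sqr_ge0.
have a2 : z ^+ 2 <= a ^+ 2.
  rewrite -[a ^+ 2]real_normK ?num_real// ler_pXn2r ?nnegrE ?(ltW z0)//.
  rewrite /a normrM (gtr0_norm halpha) (le_trans za)// ler_peMr ?(ltW halpha)//.
  by rewrite -intr_norm ler1z -gtz0_ge1 normr_gt0.
have om : a * wt tau j / q @[tau --> (0 : R)] --> a / q.
  rewrite -[X in X / q]mulr1; apply: cvgMl; apply: cvgMr; exact: cvg_weight0.
have sqE : Num.sqrt (1 - 4 * z ^+ 2 * (a / q) ^+ 2) = (a ^+ 2 - z ^+ 2) / q.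
  have -> : 1 - 4 * z ^+ 2 * (a / q) ^+ 2 = ((a ^+ 2 - z ^+ 2) / q) ^+ 2.
    by rewrite /q; field; rewrite -/q gt_eqF.
  by rewrite sqrtr_sqr ger0_norm// divr_ge0 ?subr_ge0// ltW.
have aE : (1 + Num.sqrt (1 - 4 * z ^+ 2 * (a / q) ^+ 2)) / (2 * (a / q)) = a.
  by rewrite sqE /q; field; rewrite -/q gt_eqF ?a0.
rewrite -[X in _ --> X]aE; apply: cvgM.
  apply: cvgD; first exact: cvg_cst.
  apply: continuous_cvg; first exact: sqrt_continuous.
  apply: cvgB; first exact: cvg_cst.
  by apply: cvgMr; rewrite expr2; under eq_fun do rewrite expr2; apply: cvgM.
apply: cvgV; first by rewrite mulf_neq0// mulf_neq0// invr_eq0 gt_eqF.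
by apply: cvgMr.
Qed.

End Generators.

(** * Fourier analysis of the von Mises densities *)

Section VonMises.
Variable R : realType.
Local Notation C := R[i].
Implicit Types (b s x r : R) (j : int).

Definition expcos b s x : R := expR (b * cos (x - s)).

Definition cosX s k x : C := (cos (x - s) ^+ k)%:C.

Lemma measurable_cosB s : measurable_fun [set: R] (fun x : R => cos (x - s)).
Proof.
apply: continuous_measurable_fun => x.
apply: (@continuous_comp _ _ _ (fun x => x - s) cos); last exact: continuous_cos.
by apply: cvgB; [exact: cvg_id|exact: cvg_cst].
Qed.

Lemma measurable_expcos b s : measurable_fun [set: R] (expcos b s).
Proof.
apply: (measurableT_comp (f := @expR R)).
  by apply: continuous_measurable_fun; exact: continuous_expR.
by apply: measurable_funM; [exact: measurable_cst|exact: measurable_cosB].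
Qed.

Lemma cmeasurable_cosX s k : cmeasurable (cosX s k).
Proof. by apply: cmeasurable_real; apply: measurable_funX; exact: measurable_cosB. Qed.

Lemma modc_cosX s k x : modc (cosX s k x) <= 1.
Proof. by rewrite modcR normrX exprn_ile1// cos_max. Qed.

Lemma expcos_gt0 b s x : 0 < expcos b s x. Proof. exact: expR_gt0. Qed.

Lemma bcos_le b s x : 0 <= b -> `|b * cos (x - s)| <= b.
Proof. by move=> b0; rewrite normrM ger0_norm// ler_piMr// cos_max. Qed.

Lemma expcos_le b s x : 0 <= b -> expcos b s x <= expR b.
Proof.
by move=> b0; rewrite ler_expR (le_trans (ler_norm _))// bcos_le.
Qed.

Lemma expcos_ge b s x : 0 <= b -> expR (- b) <= expcos b s x.
Proof.
move=> b0; rewrite ler_expR lerNl (le_trans _ (bcos_le s x b0))//.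
by rewrite -normrN ler_norm.
Qed.

Definition expcos_coef b s j : C := haar (fun x => (char j x)^* * (expcos b s x)%:C).

Lemma cintegrable_charM j (g : R -> C) (M : R) : cmeasurable g ->
  (forall x, modc (g x) <= M) -> cintegrable (fun x => (char j x)^* * g x).
Proof.
move=> mg gM; apply: (cintegrable_bounded (M := M)) => [|x].
  by apply: cmeasurableM => //; exact: cmeasurable_charJ.
by rewrite modcM modcJ modc_char mul1r.
Qed.

(** The cosine is a mean of two characters, so that each factor moves the
    frequency by one: [k] factors do not reach [j]. *)
Lemma cosX_coef_small s k j : (k < `|j|)%N ->
  haar (fun x => (char j x)^* * cosX s k x) = 0.
Proof.
elim: k j => [|k ih] j kj.
  rewrite (_ : (fun x => _) = (fun x => (char j x)^* * char 0 x)); last first.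
    by apply/funext => x; rewrite /cosX expr0 char0.
  rewrite haar_charM; by case: eqP => // j0; rewrite j0 in kj.
have step x : (char j x)^* * cosX s k.+1 x =
    2^-1 * char 1 (- s) * ((char (j - 1) x)^* * cosX s k x) +
    2^-1 * char (-1) (- s) * ((char (j + 1) x)^* * cosX s k x).
  have realM (a b : R) : (a * b)%:C = a%:C * b%:C :> C by exact: rmorphM.
  rewrite /cosX exprS realM cosE_char !charD.
  have -> : (char (j - 1) x)^* = (char j x)^* * char 1 x :> C.
    by rewrite charDl conjM charNl conjcK.
  have -> : (char (j + 1) x)^* = (char j x)^* * char (-1) x :> C.
    by rewrite charDl conjM charNl.
  have aux (a b c d e f g : C) : a * (e * (b * c + d * f) * g) =
    e * c * (a * b * g) + e * f * (a * d * g) by ring.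
  exact: aux.
under eq_fun do rewrite step.
have ii i := @cintegrable_charM i _ _ (cmeasurable_cosX s k) (modc_cosX s k).
rewrite haarD; try by apply: cintegrableZ.
by rewrite !haarZ// !ih ?mulr0 ?addr0//; lia.
Qed.

(** Subtracting the Taylor polynomial of degree below [|j|], which is orthogonal
    to the character, shows that the Fourier coefficients decay faster than any
    exponential. *)
Lemma expcos_coef_decay b s j r : 0 <= b -> 1 <= r ->
  modc (expcos_coef b s j) <= 2 * (r ^- `|j|%N * expR (r * b)).
Proof.
move=> b0 r1; pose P x : C := \sum_(0 <= k < `|j|%N) ((b ^+ k / k`!%:R)%:C * cosX s k x).
have mP : cmeasurable P.
  apply: cmeasurable_sum => k; apply: cmeasurableM; first exact: cmeasurable_cst.
  exact: cmeasurable_cosX.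
have PE x : P x = (\sum_(0 <= k < `|j|%N) ((b * cos (x - s)) ^+ k / k`!%:R))%:C.
  rewrite /P (rmorph_sum (real_complex R)); apply: eq_bigr => k _.
  by rewrite /cosX -(rmorphM (real_complex R)) exprMn mulrAC.
have me : cmeasurable (fun x => (expcos b s x)%:C).
  by apply: cmeasurable_real; exact: measurable_expcos.
pose D x := (expcos b s x)%:C - P x.
have mD : cmeasurable D by apply: cmeasurableD => //; exact: cmeasurableN.
have Db x : modc (D x) <= r ^- `|j|%N * expR (r * b).
  by rewrite /D PE -(rmorphB (real_complex R)) modcR expR_taylor// bcos_le.
have iP : haar (fun x => (char j x)^* * P x) = 0.
  transitivity (haar (fun x => \sum_(k <- index_iota 0 `|j|%N)
      (b ^+ k / k`!%:R)%:C * ((char j x)^* * cosX s k x))).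
    by congr haar; apply/funext => x; rewrite mulr_sumr; apply: eq_bigr => k _; rewrite mulrCA.
  have ii k := @cintegrable_charM j _ _ (cmeasurable_cosX s k) (modc_cosX s k).
  rewrite haar_sum => [|k]; last exact: cintegrableZ.
  rewrite big_seq big1// => k; rewrite mem_index_iota => /andP[_ kj].
  by rewrite haarZ// cosX_coef_small// mulr0.
have Pb x : modc (P x) <= r ^- `|j|%N * expR (r * b) + expR b.
  have -> : P x = (expcos b s x)%:C - D x by rewrite /D subKr.
  rewrite (le_trans (modc_le_sub _ _))// addrC lerD//.
  by rewrite modcR gtr0_norm ?expcos_gt0// expcos_le.
have -> : expcos_coef b s j = haar (fun x => (char j x)^* * D x).
  rewrite -[RHS]addr0 -iP -haarD.
  - by congr haar; apply/funext => x; rewrite -mulrDr /D subrK.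
  - exact: cintegrable_charM Db.
  - exact: cintegrable_charM Pb.
apply: modc_haar_le; first by apply: cmeasurableM => //; exact: cmeasurable_charJ.
by move=> x; rewrite modcM modcJ modc_char mul1r.
Qed.

Lemma haar_cosX s k : haar (cosX s k) =
  (2^-1) ^+ k * \sum_(i < k.+1) 'C(k, i)%:R * (k == i.*2)%:R.
Proof.
pose c i x : C := char (k%:Z - (i.*2)%:Z) (- s) * char (k%:Z - (i.*2)%:Z) x.
have E : cosX s k = fun x => \sum_(i <- index_enum 'I_k.+1)
    ((2^-1) ^+ k * 'C(k, i)%:R) * c i x.
  apply/funext => x.
  rewrite /cosX rmorphXn /= cosE_char exprMn exprDn mulr_sumr; apply: eq_bigr => i _.
  rewrite /c -charD [- s + x]addrC !charX -charDl -mulrA; congr (_ * _).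
  rewrite -mulr_natl; congr (_ * char _ _).
  have := ltn_ord i; rewrite ltnS => ik.
  by rewrite mulNrn !natz; lia.
rewrite E.
have ic i : cintegrable (fun x => char i x : C).
  apply: (cintegrable_bounded (M := 1)); first exact: cmeasurable_char.
  by move=> x; rewrite modc_char.
rewrite haar_sum => [|i]; last by do 2 apply: cintegrableZ.
rewrite mulr_sumr; apply: eq_bigr => i _.
rewrite haarZ; last exact: cintegrableZ.
rewrite haarZ// haar_char subr_eq0 eqz_nat -mulrA; congr (_ * (_ * _)).
case: eqP => [e|_]; last by rewrite mulr0.
have -> : k%:Z - i.*2%:Z = 0 by rewrite -e subrr.
by rewrite char0 mulr1.
Qed.

Lemma haar_cosX_even s m : haar (cosX s m.*2) = (2^-1) ^+ m.*2 * 'C(m.*2, m)%:R.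
Proof.
have mm : (m < m.*2.+1)%N by rewrite ltnS -addnn leq_addr.
rewrite haar_cosX (bigD1 (Ordinal mm))//= eqxx mulr1 big1 ?addr0// => i im.
by case: eqP => [/double_inj e|]; rewrite ?mulr0//; case/eqP: im; exact: val_inj.
Qed.

Lemma haar_cosX_odd s m : haar (cosX s m.*2.+1) = 0.
Proof.
rewrite haar_cosX big1 ?mulr0// => i _; case: eqP => [e|]; last by rewrite mulr0.
by have := odd_double i; rewrite -e /= odd_double.
Qed.

(** The termwise integral of the exponential series is the Bessel series. *)
Lemma haar_expcos b s : 0 <= b ->
  haar (fun x => (expcos b s x)%:C) = (besselI0 b)%:C.
Proof.
move=> b0; set H := haar _.
have mc k := cmeasurable_cosX s k.
have ic k : cintegrable (cosX s k) := cintegrable_bounded (mc k) (modc_cosX s k).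
pose u k : R := (b / 2) ^+ (2 * k) / (k`!%:R) ^+ 2.
have me : cmeasurable (fun x => (expcos b s x)%:C).
  by apply: cmeasurable_real; exact: measurable_expcos.
have approx N : modc (H - (series u N)%:C) <= 2 * (2 ^- (2 * N) * expR (2 * b)).
  pose P x : C := \sum_(k <- index_iota 0 (2 * N)) ((b ^+ k / k`!%:R)%:C * cosX s k x).
  have mP : cmeasurable P.
    by apply: cmeasurable_sum => k; apply: cmeasurableM; first exact: cmeasurable_cst.
  have PE x : P x = (\sum_(0 <= k < 2 * N) ((b * cos (x - s)) ^+ k / k`!%:R))%:C.
    rewrite /P (rmorph_sum (real_complex R)); apply: eq_bigr => k _.
    by rewrite /cosX -(rmorphM (real_complex R)) exprMn mulrAC.
  have hP : haar P = (series u N)%:C.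
    rewrite haar_sum => [|k]; last exact: cintegrableZ.
    under eq_bigr do rewrite haarZ//.
    rewrite /series /= (rmorph_sum (real_complex R)) /=.
    elim: N {P mP PE} => [|N ih]; first by rewrite muln0 !big_geq.
    rewrite mulnS addnC addn2 !big_nat_recr//= ih -addrA; congr (_ + _).
    rewrite mul2n haar_cosX_even haar_cosX_odd mulr0 addr0 /u -mul2n.
    have natC (n : nat) : (n%:R : C) = (n%:R : R)%:C by rewrite rmorph_nat.
    have halfC : (2^-1 : C) = (2^-1 : R)%:C by rewrite natC -fmorphV.
    rewrite halfC natC -rmorphXn -!(rmorphM (real_complex R)); congr (_%:C).
    have NN : (N <= 2 * N)%N by rewrite leq_pmull.
    have := bin_fact NN; rewrite mul2n -addnn addnK => /(congr1 (fun n => n%:R : R)).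
    rewrite !natrM addnn -mul2n => <-; rewrite exprMn.
    have f0 : (N`!%:R : R) != 0 by rewrite pnatr_eq0 -lt0n fact_gt0.
    have b0' : ('C(2 * N, N)%:R : R) != 0 by rewrite pnatr_eq0 -lt0n bin_gt0.
    by field; rewrite f0 b0'.
  have -> : H - (series u N)%:C = haar (fun x => (expcos b s x)%:C - P x).
    rewrite haarB ?hP//.
      apply: (cintegrable_bounded (M := expR b)) => // x.
      by rewrite modcR gtr0_norm ?expcos_gt0// expcos_le.
    by apply: cintegrable_sum => k; exact: cintegrableZ.
  apply: modc_haar_le; first by apply: cmeasurableD => //; exact: cmeasurableN.
  move=> x; rewrite PE -(rmorphB (real_complex R)) modcR expR_taylor ?bcos_le//.
  by rewrite ler1n.
have cv : series u @ \oo --> complex.Re H.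
  apply/cvgrPdist_le => e e0.
  have half1 : `|2^-1 : R| < 1 by rewrite ger0_norm ?invr_ge0// invf_lt1// ltr1n.
  have [M _ hM] : \forall n \near \oo, 2 * expR (2 * b) * 2^-1 ^+ n <= e.
    have /cvgrPdist_le/(_ _ e0) := cvg_geometric (2 * expR (2 * b)) half1.
    apply: filterS => n; rewrite sub0r normrN /geometric /= => /(le_trans _); apply.
    exact: ler_norm.
  exists M => // N /= MN; apply: le_trans (hM (2 * N)%N _).
    rewrite -[complex.Re H - _]/(complex.Re _ - complex.Re (series u N)%:C).
    rewrite -ReN -ReD (le_trans (Re_le_modc _))// (le_trans (approx N))//.
    by rewrite mulrA mulrAC -exprVn.
  by rewrite /= (leq_trans MN)// leq_pmull.
have -> : H = (complex.Re H)%:C.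
  rewrite [LHS]complexE.
  by rewrite [complex.Im H]haar_real mulr0 addr0.
by congr (_%:C); rewrite -(cvg_lim _ cv).
Qed.

End VonMises.

(** * The feature vectors *)

Section Feature.
Variables (R : realType) (p alpha kappa t theta : R).
Hypotheses (hp : 0 < p < 1) (halpha : 0 < alpha) (hkappa : 0 < kappa).
Local Notation C := R[i].
Local Notation wt := (weight p).
Local Notation sw tau j := (Num.sqrt (wt tau j)).

Lemma l2norm_gt0 (I : choiceType) (x : I -> C) i : ell2 x -> x i != 0 -> 0 < l2norm x.
Proof.
move=> x2 xi0; rewrite sqrtr_gt0.
have fin : sqnorm x \is a fin_num := rsummable_fin_num ((ell2P x).1 x2).
rewrite -lte_fin fineK//; apply: lt_le_trans (sqmod_le_sqnorm x i).
by rewrite lte_fin sqmodE exprn_gt0// lt_def modc_ge0 modc_eq0 xi0.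
Qed.

Lemma besselI0_gt0 (b : R) : 0 <= b -> 0 < besselI0 b.
Proof.
move=> b0; have /(congr1 (@complex.Re R)) := haar_expcos theta b0.
rewrite [RHS]/= => <-; apply: lt_le_trans (expR_gt0 (- b)) _.
apply: haar_ge; first exact: measurable_expcos.
  by exists (expR b) => x; rewrite gtr0_norm ?expcos_gt0 ?expcos_le.
by move=> x; exact: expcos_ge.
Qed.

Lemma exp_le_weight (tau : R) j : 0 <= tau -> expR tau ^- `|j|%N <= wt tau j.
Proof.
move=> t0; rewrite -expRM_natr -expRN ler_expR mulNr lerN2 ler_wpM2l//.
have -> : `|j%:~R| = `|j|%N%:R :> R by rewrite -intr_norm -abszE.
case: `|j|%N => [|n]; first by rewrite powR0// gt_eqF//; case/andP: hp.
rewrite -[leRHS]powRr1//; apply: ler_powR; first by rewrite ler1n.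
by apply: ltW; case/andP: hp.
Qed.

Lemma rk_coord_real_scale (tau a : R) (q : R -> R) (M : R) j :
  measurable_fun [set: R] q -> (forall x, `|q x| <= M) ->
  rk_coord p tau (fun x => (a * q x)%:C) j =
  a%:C * haar (fun x => (char j x)^* * (q x)%:C) / (sw tau j)%:C.
Proof.
move=> mq qM; have realM (c d : R) : (c * d)%:C = c%:C * d%:C :> C by exact: rmorphM.
rewrite /rk_coord; congr (_ / _); rewrite -haarZ; last first.
  apply: (@cintegrable_charM _ j _ M); first exact: cmeasurable_real.
  by move=> x; rewrite modcR.
by congr haar; apply/funext => x; rewrite realM mulrCA.
Qed.

Let expcos_bound b s x : 0 <= b -> `|expcos b s x| <= expR b :> R.
Proof. by move=> b0; rewrite gtr0_norm ?expcos_gt0// expcos_le. Qed.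

(** The Fourier coefficients decay faster than any exponential, hence outweigh
    the inverse weights [e^{tau |j|^p}], whatever [tau]. *)
Lemma ell2_von_mises (tau : R) : 0 < tau ->
  ell2 (rk_coord p tau (fun y => (von_mises theta kappa y)%:C)).
Proof.
move=> t0; have I0 := besselI0_gt0 (ltW hkappa); set B := besselI0 kappa in I0.
pose r := expR tau; have r1 : 1 <= r by rewrite -expR0 ler_expR ltW.
pose K := B^-1 ^+ 2 * (2 * expR (r * kappa)) ^+ 2.
have K0 : 0 <= K by rewrite mulr_ge0 ?sqr_ge0.
have sb := rsummable_weight hp t0.
have [M M0 hM] := rsummable_sum_le sb.
apply/ell2P; apply: (@rsummable_le _ _ (fun j => K * wt tau j)).
  apply: rsummableP => [j|]; first by rewrite mulr_ge0// ltW// weight_gt0.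
  by exists (K * M) => s us; rewrite -mulr_sumr ler_wpM2l// hM.
move=> j; rewrite sqmod_ge0/=.
have -> : (fun y => (von_mises theta kappa y)%:C) =
          (fun y => (B^-1 * expcos kappa theta y)%:C).
  by apply/funext => y; rewrite mulrC.
rewrite (rk_coord_real_scale _ _ _ (measurable_expcos kappa theta)
  (fun x => expcos_bound theta x (ltW hkappa))).
rewrite sqmodE modcM modcM modcV !modcR -/(expcos_coef kappa theta j).
have w0 := weight_gt0 p tau j.
rewrite (ger0_norm (sqrtr_ge0 _)) exprMn exprVn sqr_sqrtr ?(ltW w0)//.
rewrite ler_pdivrMr// exprMn gtr0_norm ?invr_gt0//.
have -> : K * wt tau j * wt tau j = B^-1 ^+ 2 * (2 * expR (r * kappa) * wt tau j) ^+ 2.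
  by rewrite /K; ring.
apply: ler_wpM2l; first exact: sqr_ge0.
have h := expcos_coef_decay theta j (ltW hkappa) r1.
have h2 : modc (expcos_coef kappa theta j) <= 2 * expR (r * kappa) * wt tau j.
  apply: le_trans h _; rewrite [r ^- _ * _]mulrC mulrA.
  by apply: ler_wpM2l; [rewrite mulr_ge0|exact: exp_le_weight (ltW t0)].
rewrite ler_pXn2r ?nnegrE ?modc_ge0//.
by apply: mulr_ge0; [rewrite mulr_ge0|exact: ltW].
Qed.

(** The frequencies kept by the projection for [d = 2]. *)
Definition freqs : seq int := [:: 0; 1; -1; 2; -2].

Lemma freqsE : [seq fourier_index i | i <- iota 0 5] = freqs.
Proof. by []. Qed.

Lemma expcos_coef0_gt0 b : 0 <= b -> expcos_coef b theta 0 != 0.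
Proof.
move=> b0; rewrite (_ : expcos_coef b theta 0 = (besselI0 b)%:C).
  by rewrite (inj_eq (@complexI R) _ 0) gt_eqF// besselI0_gt0.
rewrite -(haar_expcos theta b0); congr haar; apply/funext => x.
by rewrite char0 conjc1 mul1r.
Qed.

(** All the normalizations of the feature vector are positive constants: only
    the Fourier coefficients of the [n]-th root of the density matter. *)
Lemma xi_nE (tau : R) n : 0 < tau -> exists2 c : R, 0 < c & forall j,
  xi_n p kappa tau 2 theta n.+1 j =
  if j \in freqs then c%:C * expcos_coef (kappa / n.+1%:R) theta j / (sw tau j)%:C else 0.
Proof.
move=> t0; set b := kappa / n.+1%:R.
have b0 : 0 <= b by rewrite divr_ge0// ltW.
have I0 := besselI0_gt0 (ltW hkappa).
have vm0 : 0 < l2norm (rk_coord p tau (fun y => (von_mises theta kappa y)%:C)).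
  apply: (@l2norm_gt0 _ _ 0); first exact: ell2_von_mises.
  have -> : (fun y => (von_mises theta kappa y)%:C) =
          (fun y => ((besselI0 kappa)^-1 * expcos kappa theta y)%:C).
    by apply/funext => y; rewrite mulrC.
  rewrite (rk_coord_real_scale _ _ _ (measurable_expcos kappa theta)
    (fun x => expcos_bound theta x (ltW hkappa))).
  have C0 (x : R) : 0 < x -> x%:C != 0 :> C.
    by move=> x0; rewrite (inj_eq (@complexI R) _ 0) gt_eqF.
  rewrite mulf_neq0// ?invr_eq0 ?C0 ?sqrtr_gt0 ?weight_gt0//.
  by rewrite mulf_neq0// ?C0 ?invr_gt0// expcos_coef0_gt0// ltW.
set nv := l2norm _ in vm0.
pose A := ((besselI0 kappa * nv)^-1) `^ (n.+1%:R)^-1.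
have A0 : 0 < A by rewrite powR_gt0// invr_gt0 mulr_gt0.
have xiE : (fun x => (xi p kappa tau theta x `^ (n.+1%:R)^-1)%:C) =
           (fun x => (A * expcos b theta x)%:C).
  apply/funext => x; congr (_%:C).
  have -> : xi p kappa tau theta x = (besselI0 kappa * nv)^-1 * expcos kappa theta x.
    by rewrite /xi -/nv /von_mises /expcos; field; rewrite !gt_eqF.
  rewrite powRM ?ltW ?invr_gt0 ?mulr_gt0 ?expcos_gt0//.
  by rewrite -/A /expcos -expRM /b; congr (_ * expR _); ring.
pose v := proj_first 5 (rk_coord p tau (fun x => (xi p kappa tau theta x `^ (n.+1%:R)^-1)%:C)).
have vE j : v j = if j \in freqs then A%:C * expcos_coef b theta j / (sw tau j)%:C else 0.
  rewrite /v /proj_first freqsE xiE; case: ifP => // _.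
  exact: rk_coord_real_scale (measurable_expcos b theta) (fun x => expcos_bound theta x b0).
have nv0 : 0 < l2norm v.
  apply: (@l2norm_gt0 _ _ 0).
    by apply: (ell2_fin (s := freqs)) => j jL; rewrite vE (negbTE jL).
  have C0 (x : R) : 0 < x -> x%:C != 0 :> C.
    by move=> x0; rewrite (inj_eq (@complexI R) _ 0) gt_eqF.
  rewrite vE /= mulf_neq0// ?invr_eq0 ?C0 ?sqrtr_gt0 ?weight_gt0//.
  by rewrite mulf_neq0// ?C0// expcos_coef0_gt0.
exists (A / l2norm v); first by rewrite divr_gt0.
move=> j; have -> : xi_n p kappa tau 2 theta n.+1 j = v j / (l2norm v)%:C by [].
rewrite vE.
case: ifP => _; last by rewrite mul0r.
have realD (x y : R) : (x / y)%:C = x%:C / y%:C :> C by exact: fmorph_div.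
have aux (a e d l : C) : a * e / d / l = a / l * e / d by ring.
by rewrite realD; exact: aux.
Qed.

Lemma feature_word (w : nat -> R) (tau : R) (n : nat) s : size s = n.+1 ->
  feature p w kappa tau 2 theta s =
  (w n)%:C * \prod_(i <- s) xi_n p kappa tau 2 theta n.+1 i.
Proof.
move=> sn; rewrite /feature (csum1 (j := n)) /tensor_power ?sn ?eqxx// => k kn.
by rewrite eqSS eq_sym (negbTE kn) mulr0.
Qed.

(** Its modulus to the power [2 n] is, up to a constant, the density seen by the
    observable: it is the von Mises root truncated to [freqs], each frequency
    carrying the phase that the approximate evolution gives it. *)
Definition profile (s : scheme R) (tau b : R) (x : R) : C :=
  \sum_(j <- freqs) (char 1 (t * frequency p alpha s tau j))^* *
    expcos_coef b theta j * char j x.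

Lemma cmeasurable_profile s tau b : cmeasurable (profile s tau b).
Proof.
apply: cmeasurable_sum => j; apply: cmeasurableM; first exact: cmeasurable_cst.
exact: cmeasurable_char.
Qed.

Lemma freqs_index m j : (5 <= m)%N -> j \in freqs ->
  j \in [seq fourier_index i | i <- iota 0 m.+1].
Proof.
move=> m5 jL; rewrite -(subnKC (leqW m5)) iotaD map_cat mem_cat.
by rewrite [X in X || _](_ : _ = true).
Qed.

(** The square roots of the weights in the basis functions cancel those in the
    coordinates of the feature vector, so that [tau] survives only in the
    phases of [profile] and in the factor [K]. *)
Lemma fock_expectationE (s : scheme R) (w : nat -> R) (tau : R) n m :
  0 < tau -> (5 <= m)%N -> admissible alpha s -> (forall k, 0 < w k) ->
  exists2 K : R, 0 < K & forall f, cintegrable f ->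
    fock_expectation p alpha s w kappa tau n.+1 2 m t theta f =
    K%:C * haar (fun x =>
      ((modc (profile s tau (kappa / n.+1%:R) x)) ^+ (2 * n.+1))%:C * f x).
Proof.
move=> t0 m5 hs w0; have [c c0 xiE] := xi_nE n t0.
exists (w n ^+ 2 * c ^+ (2 * n.+1)); first by rewrite mulr_gt0 ?exprn_gt0.
move=> f jf; pose u j := char 1 (t * (if j \in [seq fourier_index i | i <- iota 0 m.+1]
  then frequency p alpha s tau j else 0)) : C.
pose v := xi_n p kappa tau 2 theta n.+1; pose F := feature p w kappa tau 2 theta.
have vL i : i \notin freqs -> v i = 0 by move=> iL; rewrite /v xiE (negbTE iL).
have FE r : size r = n.+1 -> F r = (w n)%:C * \prod_(i <- r) v i by exact: feature_word.
have E := @expectation_observable R p hp tau t0 f n u v freqs F (w n) jf isT vL FE.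
have -> : fock_expectation p alpha s w kappa tau n.+1 2 m t theta f =
    Defs.expectation (adjoint (fock_lift (diag_op u)) \o rank_one F \o
      fock_lift (diag_op u)) (observable p f tau n.+1).
  by rewrite /fock_expectation /evolve (Um_diag p tau m t hs).
rewrite E {E}.
have realM (x y : R) : (x * y)%:C = x%:C * y%:C :> C by exact: rmorphM.
rewrite realM -mulrA; congr (_ * _); rewrite -haarZ; last first.
  pose M := \sum_(j <- freqs) modc (expcos_coef (kappa / n.+1%:R) theta j).
  have hM x : modc (profile s tau (kappa / n.+1%:R) x) <= M.
    rewrite (le_trans (modc_sum _ _ _))//; apply: ler_sum => j _.
    by rewrite !modcM modcJ !modc_char mul1r mulr1.
  apply: (cintegrableM (M := M ^+ (2 * n.+1))) => //.
    rewrite (_ : (fun _ => _) = fun x => (profile s tau (kappa / n.+1%:R) x *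
        (profile s tau (kappa / n.+1%:R) x)^*) ^+ n.+1).
      apply: cmeasurableX; apply: cmeasurableM; first exact: cmeasurable_profile.
      by apply: cmeasurableJ; exact: cmeasurable_profile.
    by apply/funext => x; rewrite mulcJ -rmorphXn -exprM.
  move=> x; rewrite modcR ger0_norm ?exprn_ge0 ?modc_ge0//.
  by rewrite ler_pXn2r ?nnegrE ?modc_ge0// (le_trans (modc_ge0 _) (hM x)).
congr haar; apply/funext => x; rewrite mulrA; congr (_ * _).
rewrite -realM -exprMn; congr ((_ ^+ _)%:C).
rewrite -[X in X * _](gtr0_norm c0) -modcR -modcM; congr modc.
rewrite /profile mulr_sumr big_seq [RHS]big_seq; apply: eq_bigr => j jL.
rewrite /v xiE jL /u (freqs_index m5 jL) /psi.
have aux (a b c' d e : C) : d != 0 -> b * (a * c' / d) * (d * e) = a * (b * c' * e).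
  by move=> d0; field.
apply: aux; by rewrite (inj_eq (@complexI R) _ 0) gt_eqF// sqrtr_gt0 weight_gt0.
Qed.

End Feature.

(** * Asymptotics of the profile *)

Section Asymptotics.
Variables (R : realType) (p alpha kappa t theta : R).
Hypotheses (hp : 0 < p < 1) (halpha : 0 < alpha) (hkappa : 0 < kappa).
Local Notation C := R[i].
Local Notation profile := (profile p alpha t theta).
Local Notation s' := (theta + alpha * t).

Lemma modc_dist (z w : C) : `|modc z - modc w| <= modc (z - w).
Proof.
have h1 := modc_le_add (z - w) w; rewrite subrK in h1.
have h2 := modc_le_add (w - z) z; rewrite subrK modcB in h2.
by rewrite ler_norml; apply/andP; split; lra.
Qed.

Lemma powB_le (X Y Z : R) N : 0 <= X <= Z -> 0 <= Y <= Z -> 1 <= Z ->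
  `|X ^+ N - Y ^+ N| <= N%:R * Z ^+ N * `|X - Y|.
Proof.
move=> /andP[X0 XZ] /andP[Y0 YZ] Z1; have Z0 : 0 <= Z := le_trans X0 XZ.
elim: N => [|N ih]; first by rewrite !expr0 subrr normr0 mulr_ge0.
have -> : X ^+ N.+1 - Y ^+ N.+1 = X * (X ^+ N - Y ^+ N) + (X - Y) * Y ^+ N.
  by rewrite !exprS; ring.
rewrite (le_trans (ler_normD _ _))// !normrM (ger0_norm X0) (ger0_norm (exprn_ge0 _ Y0)).
have h1 : X * `|X ^+ N - Y ^+ N| <= Z * (N%:R * Z ^+ N * `|X - Y|) by apply: ler_pM.
have h2 : `|X - Y| * Y ^+ N <= `|X - Y| * Z ^+ N.+1.
  apply: ler_wpM2l => //; apply: le_trans (_ : Z ^+ N <= _).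
    by rewrite lerXn2r ?nnegrE.
  by rewrite exprS ler_peMl// exprn_ge0.
apply: le_trans (lerD h1 h2) _.
by rewrite -[in leRHS]natr1 exprS; rewrite le_eqVlt; apply/orP; left; apply/eqP; ring.
Qed.

(** Compared with the phase of the exact rotation. Only [j = 1] and [j = -1] are
    used: the frequencies [2] and [-2] enter at second order, and [0] carries no
    phase. *)
Definition phase_error (s : scheme R) (tau : R) (j : int) : R :=
  modc ((char 1 (t * frequency p alpha s tau j))^* - char j (- (alpha * t))).

(** In the last term, [10] is a coefficient error [2 b^2 e] on each of the five
    frequencies, and [1] is the Taylor error of the target. *)
Definition first_order_error (s : scheme R) (tau b : R) : R :=
  phase_error s tau 1 + phase_error s tau (-1) + 11 * expR 1 * b.

Let linear_part (b x0 : R) (x : R) : C :=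
  1 + b%:C * (2^-1 * (char 1 (x - x0) + char (-1) (x - x0))).

Let linear_partE b x0 x : linear_part b x0 x = (1 + b * cos (x - x0))%:C.
Proof.
rewrite /linear_part -cosE_char.
by rewrite (rmorphD (real_complex R)) (rmorphM (real_complex R)) rmorph1.
Qed.

Let taylor_error b x0 x : 0 < b <= 1 ->
  modc ((expcos b x0 x)%:C - linear_part b x0 x) <= b ^+ 2 * expR 1.
Proof.
move=> /andP[b0 b1]; rewrite linear_partE -(rmorphB (real_complex R)) modcR.
(* With [N = 2] and [r = b^-1] the tail bound is quadratic in [b]. *)
have := @expR_taylor R b b^-1 (b * cos (x - x0)) 2 (bcos_le _ _ (ltW b0)).
rewrite invf_ge1// => /(_ b1); rewrite mulVf ?gt_eqF// exprVn invrK.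
by rewrite !big_nat_recr//= big_geq// !expr0 !expr1 fact0 factS fact0 !divr1 add0r.
Qed.

Let cmeasurable_linear b x0 : cmeasurable (linear_part b x0).
Proof.
rewrite (_ : linear_part b x0 = fun x => (1 + b * cos (x - x0))%:C); last first.
  by apply/funext => x; exact: linear_partE.
apply: cmeasurable_real; apply: measurable_funD; first exact: measurable_cst.
by apply: measurable_funM; [exact: measurable_cst|exact: measurable_cosB].
Qed.

Definition coef_lin (b : R) (j : int) : C :=
  (j == 0)%:R + (b / 2)%:C * (char 1 (- theta) * (j == 1)%:R +
    char (-1) (- theta) * (j == -1)%:R).

Let coef_error b j : 0 < b <= 1 ->
  modc (expcos_coef b theta j - coef_lin b j) <= 2 * (b ^+ 2 * expR 1).
Proof.
move=> hb; have /andP[b0 b1] := hb.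
have me : cmeasurable (fun x => (expcos b theta x)%:C).
  by apply: cmeasurable_real; exact: measurable_expcos.
have be x : modc ((expcos b theta x)%:C) <= expR b.
  by rewrite modcR gtr0_norm ?expcos_gt0// expcos_le// ltW.
have bl x : modc (linear_part b theta x) <= 1 + b.
  rewrite linear_partE modcR (le_trans (ler_normD _ _))// normr1 lerD2l.
  by rewrite bcos_le// ltW.
have lE : haar (fun x => (char j x)^* * linear_part b theta x) = coef_lin b j.
  pose c1 : C := (b / 2)%:C * char 1 (- theta).
  pose c2 : C := (b / 2)%:C * char (-1) (- theta).
  have E x : (char j x)^* * linear_part b theta x =
      (char j x)^* * char 0 x + (c1 * ((char j x)^* * char 1 x) +
        c2 * ((char j x)^* * char (-1) x)).
    have b2 : (b / 2)%:C = b%:C * 2^-1 :> C.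
      by rewrite (rmorphM (real_complex R)) fmorphV rmorph_nat.
    by rewrite /linear_part /c1 /c2 b2 !charD char0; ring.
  have ic k : cintegrable (fun x => (char j x)^* * char k x).
    apply: (@cintegrable_charM _ j _ 1); first exact: cmeasurable_char.
    by move=> x; rewrite modc_char.
  rewrite (_ : (fun x => _) = (fun x => (char j x)^* * char 0 x +
    (c1 * ((char j x)^* * char 1 x) + c2 * ((char j x)^* * char (-1) x)))); last exact/funext.
  rewrite haarD//; last by apply: cintegrableD; exact: cintegrableZ.
  rewrite haarD; try exact: cintegrableZ.
  by rewrite !haarZ// !haar_charM /coef_lin mulrDr !mulrA.
rewrite -lE /expcos_coef -haarB; first last.
- exact: cintegrable_charM bl.
- exact: cintegrable_charM be.
apply: modc_haar_le.
  by apply: cmeasurableD; [|apply: cmeasurableN];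
    apply: cmeasurableM => //; exact: cmeasurable_charJ.
move=> x; rewrite -mulrBr modcM modcJ modc_char mul1r.
exact: taylor_error.
Qed.

(** Up to [O(b^2)], the Fourier coefficients of the von Mises root are those of
    [1 + b cos (x - theta)]; the phases rotate its frequencies [1] and [-1] by
    [alpha t] up to [phase_error], and the result is again the first-order part
    of the exponential centred at [s']. *)
Lemma profile_error s tau b x : 0 < b <= 1 ->
  modc (profile s tau b x - (expcos b s' x)%:C) <= b * first_order_error s tau b.
Proof.
move=> hb; have /andP[b0 b1] := hb.
pose U j : C := (char 1 (t * frequency p alpha s tau j))^*.
have modU j : modc (U j) = 1 by rewrite modcJ modc_char.
have U0 : U 0 = 1 by rewrite /U frequency0 mulr0 charr0 conjc1.
pose d j := U j - char j (- (alpha * t)).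
pose E j := expcos_coef b theta j - coef_lin b j.
have b2 : (b / 2)%:C = b%:C * 2^-1 :> C.
  by rewrite (rmorphM (real_complex R)) fmorphV rmorph_nat.
have split : profile s tau b x - (expcos b s' x)%:C =
  \sum_(j <- freqs) U j * E j * char j x +
  ((b / 2)%:C * (d 1 * char 1 (x - theta) + d (-1) * char (-1) (x - theta))
  - ((expcos b s' x)%:C - linear_part b s' x)).
  have -> : profile s tau b x = \sum_(j <- freqs) U j * E j * char j x +
      \sum_(j <- freqs) U j * coef_lin b j * char j x.
    have aux (u a l c : C) : u * a * c = u * (a - l) * c + u * l * c by ring.
    by rewrite -big_split; apply: eq_bigr => j _; exact: aux.
  rewrite -!addrA; congr (_ + _).
  have -> : \sum_(j <- freqs) U j * coef_lin b j * char j x =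
      1 + (b / 2)%:C * (U 1 * char 1 (x - theta) + U (-1) * char (-1) (x - theta)).
    rewrite /freqs !big_cons big_nil /coef_lin /= U0 char0 !charD; ring.
  have -> : linear_part b s' x = 1 + (b / 2)%:C *
      (char 1 (- (alpha * t)) * char 1 (x - theta) +
       char (-1) (- (alpha * t)) * char (-1) (x - theta)).
    rewrite /linear_part b2 (_ : x - s' = - (alpha * t) + (x - theta)); last by ring.
    by rewrite ![char _ (- (alpha * t) + _)]charD; ring.
  by rewrite /d; ring.
have h1 : modc (\sum_(j <- freqs) U j * E j * char j x) <= 10 * (b ^+ 2 * expR 1).
  rewrite (le_trans (modc_sum _ _ _))//.
  apply: (@le_trans _ _ (\sum_(j <- freqs) 2 * (b ^+ 2 * expR 1))).
    by apply: ler_sum => j _; rewrite !modcM modU modc_char mul1r mulr1 coef_error.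
  by rewrite /freqs !big_cons big_nil; lra.
have h2 : modc ((b / 2)%:C * (d 1 * char 1 (x - theta) + d (-1) * char (-1) (x - theta)))
    <= b * (phase_error s tau 1 + phase_error s tau (-1)).
  rewrite modcM modcR ger0_norm ?divr_ge0 ?(ltW b0)//.
  apply: ler_pM; rewrite ?modc_ge0 ?divr_ge0 ?(ltW b0)//.
    by rewrite ler_pdivrMr// ler_peMr ?(ltW b0)// ler1n.
  by rewrite (le_trans (modc_le_add _ _))// !modcM !modc_char !mulr1.
have h3 := taylor_error s' x hb.
rewrite split (le_trans (modc_le_add _ _))//.
apply: le_trans (lerD h1 (modc_le_sub _ _)) _.
apply: le_trans (lerD (lexx _) (lerD h2 h3)) _.
rewrite /first_order_error; rewrite le_eqVlt; apply/orP; left; apply/eqP; ring.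
Qed.

Lemma first_order_error_ge0 s tau b : 0 <= b -> 0 <= first_order_error s tau b.
Proof.
by move=> b0; rewrite !addr_ge0 ?modc_ge0// !mulr_ge0 ?expR_ge0.
Qed.

Lemma expcosX (b x : R) N : expcos b s' x ^+ N = expcos (N%:R * b) s' x.
Proof. by rewrite /expcos -expRM_natl mulrA. Qed.

(** For [b = kappa / n] the error of [profile_error] is [o(1/n)], while both
    functions are [1 + O(1/n)]: the [2 n]-th power turns it into [o(1)]. *)
Lemma profile_power s tau (n : nat) x : kappa <= n.+1%:R ->
  first_order_error s tau (kappa / n.+1%:R) <= 1 ->
  `|modc (profile s tau (kappa / n.+1%:R) x) ^+ (2 * n.+1) - expcos (2 * kappa) s' x|
    <= 2 * kappa * expR (4 * kappa) * first_order_error s tau (kappa / n.+1%:R).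
Proof.
move=> kn; set b := kappa / n.+1%:R; set e := first_order_error _ _ _ => e1.
have n0 : 0 < n.+1%:R :> R by [].
have b0 : 0 < b by rewrite divr_gt0.
have b1 : b <= 1 by rewrite ler_pdivrMr// mul1r.
have e0 : 0 <= e by rewrite first_order_error_ge0// ltW.
have bn : n.+1%:R * b = kappa by rewrite mulrC divfK// gt_eqF.
have Nb : (2 * n.+1)%:R * b = 2 * kappa by rewrite natrM -mulrA bn.
pose X := modc (profile s tau b x); pose Y := expcos b s' x.
have XY : `|X - Y| <= b * e.
  have h := @profile_error s tau b x; rewrite b0 b1 in h.
  apply: le_trans (h isT); have Y0 : 0 <= Y := ltW (expcos_gt0 _ _ _).
  have mY : modc Y%:C = Y by rewrite modcR ger0_norm.
  by rewrite -[Y in `|X - Y|]mY; exact: modc_dist.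
have YZ : Y <= expR (b * (1 + e)).
  rewrite (le_trans (expcos_le _ _ (ltW b0)))// ler_expR ler_peMr ?(ltW b0)//.
  by rewrite lerDl.
have XZ : X <= expR (b * (1 + e)).
  have : X <= Y + b * e by move: XY; rewrite ler_norml => /andP[_]; rewrite lerBlDl.
  move=> /le_trans; apply.
  apply: (@le_trans _ _ (expR b * (1 + b * e))).
    rewrite [expR b * _]mulrDr mulr1; apply: lerD; first exact: expcos_le (ltW b0).
    have be0 : 0 <= b * e by rewrite mulr_ge0// ltW.
    by apply: ler_peMl => //; rewrite -expR0 ler_expR ltW.
  by rewrite [b * (1 + e)]mulrDr mulr1 expRD ler_pM2l ?expR_gt0// expR_ge1Dx.
rewrite -Nb -expcosX -/X -/Y.
apply: le_trans (@powB_le X Y _ (2 * n.+1) _ _ _) _.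
- by rewrite modc_ge0; exact: XZ.
- by rewrite (ltW (expcos_gt0 _ _ _)); exact: YZ.
- by rewrite -expR0 ler_expR mulr_ge0 ?(ltW b0)// addr_ge0.
rewrite -expRM_natl mulrA Nb.
apply: (@le_trans _ _ ((2 * n.+1)%:R * expR (4 * kappa) * (b * e))).
  apply: ler_pM => //; apply: ler_wpM2l => //; rewrite ler_expR.
  by have := ltW hkappa; nra.
by rewrite -Nb; rewrite le_eqVlt; apply/orP; left; apply/eqP; ring.
Qed.

Lemma cvg_phase_error s j : admissible alpha s ->
  phase_error s (eps ^+ 2) j @[eps --> 0^'+] --> (0 : R).
Proof.
move=> hs.
have sq : (eps ^+ 2) @[eps --> 0^'+] --> (0 : R).
  apply: cvg_at_right_filter; rewrite -[X in _ --> X](mul0r 0).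
  by under eq_fun do rewrite expr2; apply: cvgM; exact: cvg_id.
have fr : frequency p alpha s (eps ^+ 2) j @[eps --> 0^'+] --> alpha * j%:~R.
  exact: (cvg_comp (fun eps : R => eps ^+ 2)
    (fun tau => frequency p alpha s tau j) sq (cvg_frequency p halpha hs)).
pose y eps := t * frequency p alpha s (eps ^+ 2) j; pose y0 := t * (alpha * j%:~R).
have cy : y eps @[eps --> 0^'+] --> y0 by apply: cvgMr.
have cc : `|cos (y eps) - cos y0| + `|sin (y eps) - sin y0| @[eps --> 0^'+] --> (0 : R).
  have n0 (f : R -> R) : continuous f -> `|f (y eps) - f y0| @[eps --> 0^'+] --> (0 : R).
    move=> cf; have h : `|f (y eps) - f y0| @[eps --> 0^'+] --> `|f y0 - f y0|.
      apply: cvg_norm; apply: cvgB; last exact: cvg_cst.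
      exact: (continuous_cvg _ (cf y0) cy).
    by rewrite subrr normr0 in h.
  by rewrite -[X in _ --> X](addr0 (0 : R)); apply: cvgD; apply: n0;
    [exact: continuous_cos|exact: continuous_sin].
apply: (squeeze_cvgr _ (cvg_cst 0) cc).
apply: nearW => eps; apply/andP; split; first exact: modc_ge0.
rewrite /phase_error.
have -> : char j (- (alpha * t)) = (char 1 y0)^* :> C.
  by rewrite charN -charMz; congr (_^*); congr (char 1 _); rewrite /y0; ring.
have conjB (z w : C) : z^* - w^* = (z - w)^* by rewrite rmorphB.
rewrite conjB modcJ (le_trans (modc_le_ReIm _))//.
by rewrite ReD ImD ReN ImN /char /= !mul1r.
Qed.

End Asymptotics.

(** * Bounded observables *)

Section Linfty.
Variable R : realType.
Local Notation C := R[i].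
Local Notation mu := (@lebesgue_measure R : {measure set _ -> \bar R}).
Implicit Types (f : R -> C) (q : R -> R).

Lemma integrable_ae_bounded q (M a b : R) : measurable_fun [set: R] q ->
  {ae mu, forall x, `|q x| <= M} -> mu.-integrable `[a, b] (EFin \o q).
Proof.
move=> mq [N [mN N0 hN]].
have mab : measurable (`[a, b]%classic : set (measurableTypeR R)) by exact: measurable_itv.
apply/(negligible_integrable mN mab _ N0).
  by apply: measurable_funTS; apply/measurable_EFinP.
apply: measurable_bounded_integrable.
- exact: measurableD.
- apply: (@le_lt_trans _ _ (mu `[a, b]%classic)).
    apply: le_measure; [apply/mem_set; exact: measurableD|exact/mem_set|exact: subDsetl].
  by rewrite [mu _]lebesgue_measure_itv /=; case: ifP => _; rewrite -?EFinB ?ltry.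
- exact: measurable_funTS.
- exists M; split; first exact: num_real.
  move=> K /ltW MK x [_ Nx]; apply: le_trans MK.
  by apply: contrapT => h; apply: Nx; apply: hN.
Qed.

Lemma Linfty_integrable f (a b : R) : Linfty_circle f ->
  mu.-integrable `[a, b] (EFin \o (fun x => complex.Re (f x))) /\
  mu.-integrable `[a, b] (EFin \o (fun x => complex.Im (f x))).
Proof.
move=> [_ mR mI [M hM]].
have bnd (z : C) : sqmod z <= M -> modc z <= M + 1.
  by rewrite sqmodE => h; have := modc_ge0 z; nra.
case: hM => [N [mN N0 hN]].
split; apply: (integrable_ae_bounded (M := M + 1)) => //; exists N; split => //;
  move=> x hx; apply: hN => /bnd h; apply: hx; apply: le_trans h.
  exact: Re_le_modc.
exact: Im_le_modc.
Qed.

Lemma Linfty_cintegrable f : Linfty_circle f -> cintegrable f.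
Proof. exact: Linfty_integrable. Qed.

Lemma haar_shift f s : Linfty_circle f -> haar (fun x => f (x + s)) = haar f.
Proof.
move=> Lf; have ii a b := Linfty_integrable a b Lf; case: Lf => pf mR mI _.
rewrite /haar; congr (_ * _ +i* (_ * _)).
  apply: (@Rintegral_periodic _ s (fun x => complex.Re (f x))) => // [a b|x].
    by case: (ii a b).
  by rewrite pf.
apply: (@Rintegral_periodic _ s (fun x => complex.Im (f x))) => // [a b|x].
  by case: (ii a b).
by rewrite pf.
Qed.

Lemma Linfty_expcos f (b s : R) : 0 <= b -> Linfty_circle f ->
  Linfty_circle (fun x => (expcos b s x)%:C * f x).
Proof.
move=> b0 [pf mR mI [M hM]].
have [m1 m2] : cmeasurable (fun x => (expcos b s x)%:C * f x).
  apply: cmeasurableM => //; apply: cmeasurable_real; exact: measurable_expcos.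
split=> // [x|].
  rewrite pf /expcos; congr (_%:C * _); congr (expR (b * _)).
  by rewrite (_ : x + 2 * pi - s = (x - s) + pi *+ 2) ?cosD2pi// -mulr_natl; ring.
exists (expR b ^+ 2 * M); case: hM => [N [mN N0 hN]]; exists N; split => // x hx.
apply: hN => hM; apply: hx => /=; rewrite sqmodM sqmodR.
apply: ler_pM; rewrite ?sqr_ge0 ?sqmod_ge0//.
by rewrite lerXn2r ?nnegrE ?expR_ge0 ?expcos_le// ltW ?expcos_gt0.
Qed.

End Linfty.

(** * The limit *)

Section Limit.
Variables (R : realType) (p alpha kappa t theta : R).
Hypotheses (hp : 0 < p < 1) (halpha : 0 < alpha) (hkappa : 0 < kappa).
Local Notation C := R[i].
Local Notation profile := (profile p alpha t theta).
Local Notation s' := (theta + alpha * t).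

Lemma cvg_modc (T : Type) (F : set_system T) (FF : Filter F)
    (g : T -> complex_field R) (l : complex_field R) :
  (forall e : R, 0 < e -> \forall x \near F, modc (l - g x) <= e) ->
  g x @[x --> F] --> l.
Proof.
move=> h; apply/cvgrPdist_le => e; rewrite ltcE => /andP[/eqP ei er].
have -> : e = (complex.Re e)%:C by rewrite [LHS]complexE ei mulr0 addr0.
apply: filterS (h _ er) => x hx; have := normc_modc (l - g x).
by rewrite -lecR in hx => hn; rewrite -hn in hx.
Qed.

Lemma cvg_ratio (T : Type) (F : set_system T) (FF : Filter F)
    (a b u v : T -> complex_field R) (la lb : complex_field R) :
  a x @[x --> F] --> la -> b x @[x --> F] --> lb -> lb != 0 ->
  (\forall x \near F, exists2 K : complex_field R, K != 0 &
     u x = K * a x /\ v x = K * b x) ->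
  u x / v x @[x --> F] --> la / lb.
Proof.
move=> ca cb lb0 uv; apply: cvg_trans (cvgM ca (cvgV lb0 cb)).
apply: near_eq_cvg; apply: filterS uv => x [K K0 [-> ->]].
by rewrite invfM mulrACA divff// mul1r.
Qed.

(** What is left of the expectation of the observable of [f] without the factor
    common to all [f], which cancels in the quotient. *)
Definition moment (s : scheme R) (f : R -> C) (eps : R) : C :=
  haar (fun x => ((modc (profile s (eps ^+ 2) (kappa / (ceil_nat eps^-1)%:R) x))
    ^+ (2 * ceil_nat eps^-1))%:C * f x).

Lemma ceil_nat_ge (x : R) : 0 < x -> (0 < ceil_nat x)%N /\ x <= (ceil_nat x)%:R.
Proof.
move=> x0; have c0 : 0 < Num.ceil x by rewrite -ceil_gt0 in x0.
have e : (ceil_nat x)%:R = (Num.ceil x)%:~R :> R.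
  by rewrite /ceil_nat -[in RHS](gtz0_abs c0).
by split; [rewrite absz_gt0 gt_eqF|rewrite e Num.Theory.ceil_ge].
Qed.

Lemma cvg_first_order_error s : admissible alpha s ->
  first_order_error p alpha t s (eps ^+ 2) (kappa * eps)
    @[eps --> 0^'+] --> (0 : R).
Proof.
move=> hs; rewrite -[X in _ --> X](addr0 (0 : R)); apply: cvgD.
  rewrite -[X in _ --> X](addr0 (0 : R)); apply: cvgD; exact: cvg_phase_error.
have h : 11 * expR 1 * (kappa * eps) @[eps --> 0^'+] --> (11 * expR 1 * (kappa * 0) : R).
  by apply: cvg_at_right_filter; apply: cvgMr; apply: cvgMr; exact: cvg_id.
by rewrite !mulr0 in h.
Qed.

(** Uniform convergence of the densities passes to their integrals against the
    integrable [f]. *)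
Lemma cvg_moment s f : admissible alpha s -> cintegrable f ->
  moment s f eps @[eps --> 0^'+] -->
    (haar (fun x => (expcos (2 * kappa) s' x)%:C * f x) : complex_field R).
Proof.
move=> hs jf; apply: cvg_modc => e e0.
pose K := 2 * kappa * expR (4 * kappa); pose A := haar_abs f.
have K0 : 0 < K by rewrite !mulr_gt0 ?expR_gt0.
have A0 : 0 <= A := haar_abs_ge0 f.
(* By [profile_power] a first-order error [d <= 1] moves the density by at most
   [K * d], hence the integral by at most [2 * K * d * A <= e]. *)
pose d := Num.min 1 (e / (2 * K * (A + 1))).
have A1 : 0 < A + 1 by rewrite ltr_wpDl.
have d0 : 0 < d.
  have h : 0 < e / (2 * K * (A + 1)).
    by apply: divr_gt0 => //; apply: mulr_gt0 => //; apply: mulr_gt0.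
  by rewrite /d lt_min ltr01 h.
have hE : \forall eps \near 0^'+, first_order_error p alpha t s (eps ^+ 2) (kappa * eps) <= d.
  have /cvgrPdist_le/(_ _ d0) := cvg_first_order_error hs; apply: filterS => x.
  by rewrite sub0r normrN => /(le_trans (ler_norm _)).
near=> eps.
have eps0 : 0 < eps by near: eps; exact: nbhs_right_gt.
have keps : kappa * eps <= 1.
  rewrite -ler_pdivlMl// mulr1; near: eps; apply: nbhs_right_le; by rewrite invr_gt0.
have he : first_order_error p alpha t s (eps ^+ 2) (kappa * eps) <= d by near: eps.
have [c0 c1] := @ceil_nat_ge eps^-1 (ltac:(by rewrite invr_gt0)).
rewrite /moment; move: (ceil_nat eps^-1) c0 c1 => [//|n] _ c1.
have n0 : 0 < n.+1%:R :> R by [].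
have bk : kappa / n.+1%:R <= kappa * eps.
  by rewrite ler_pM2l// -[leRHS]invrK lef_pV2 ?posrE ?invr_gt0.
have kn : kappa <= n.+1%:R by have := le_trans bk keps; rewrite ler_pdivrMr// mul1r.
have hd : first_order_error p alpha t s (eps ^+ 2) (kappa / n.+1%:R) <= d.
  by apply: le_trans he; rewrite /first_order_error lerD2l ler_wpM2l// mulr_ge0// expR_ge0.
have d1 : d <= 1 by rewrite /d ge_min lexx.
pose X x := modc (profile s (eps ^+ 2) (kappa / n.+1%:R) x) ^+ (2 * n.+1).
pose Y := expcos (2 * kappa) s'.
have hP x : `|X x - Y x| <= K * first_order_error p alpha t s (eps ^+ 2) (kappa / n.+1%:R).
  exact: profile_power kn (le_trans hd d1).
rewrite -/Y -[fun x => _ * f x in X in _ - X]/(fun x => (X x)%:C * f x).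
have mX : cmeasurable (fun x => (X x)%:C).
  rewrite (_ : (fun _ => _) = fun x => (profile s (eps ^+ 2) (kappa / n.+1%:R) x *
        (profile s (eps ^+ 2) (kappa / n.+1%:R) x)^*) ^+ n.+1).
    apply: cmeasurableX; apply: cmeasurableM; first exact: cmeasurable_profile.
    by apply: cmeasurableJ; exact: cmeasurable_profile.
  by apply/funext => x; rewrite mulcJ -rmorphXn -exprM.
have mY : cmeasurable (fun x => (Y x)%:C).
  by apply: cmeasurable_real; exact: measurable_expcos.
have XY x : modc ((Y x)%:C - (X x)%:C) <= K * d.
  rewrite -(rmorphB (real_complex R)) modcR distrC (le_trans (hP x))//.
  by rewrite ler_wpM2l// ltW.
have bY x : modc (Y x)%:C <= expR (2 * kappa).
  rewrite modcR gtr0_norm ?expcos_gt0// expcos_le// mulr_ge0// ltW//.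
have bX x : modc (X x)%:C <= expR (2 * kappa) + K * d.
  rewrite -[(X x)%:C](subKr (Y x)%:C) (le_trans (modc_le_sub _ _))// lerD//.
rewrite -haarB; first last.
- exact: cintegrableM bX jf.
- exact: cintegrableM bY jf.
rewrite (_ : (fun x => _) = (fun x => ((Y x)%:C - (X x)%:C) * f x)); last first.
  by apply/funext => x; rewrite mulrBl.
apply: le_trans (modc_haarM_le _ XY jf) _.
  by apply: cmeasurableD => //; exact: cmeasurableN.
rewrite -/A; apply: (@le_trans _ _ (2 * (K * (e / (2 * K * (A + 1))) * (A + 1)))).
  rewrite ler_pM2l//; apply: ler_pM => //.
  - by rewrite mulr_ge0// ltW.
  - by rewrite ler_pM2l// /d ge_min lexx orbT.
  - by rewrite lerDl.
rewrite le_eqVlt; apply/orP; left; apply/eqP; field.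
by rewrite !gt_eqF.
Unshelve. all: by end_near. Qed.

Lemma fock_expectation_moment s w m eps : (5 <= m)%N -> admissible alpha s ->
  (forall k, 0 < w k) -> 0 < eps -> exists2 K : R, 0 < K & forall f, cintegrable f ->
    fock_expectation p alpha s w kappa (1 * eps ^+ 2) (ceil_nat (1 / eps)) 2 m t theta f =
    K%:C * moment s f eps.
Proof.
move=> m5 hs w0 eps0; rewrite !mul1r /moment.
have [] := @ceil_nat_ge eps^-1 (ltac:(by rewrite invr_gt0)).
case: (ceil_nat eps^-1) => [//|n] _ _.
by apply: fock_expectationE => //; rewrite exprn_gt0.
Qed.

(** Translation invariance moves the rotation from the density to the
    observable. *)
Lemma haar_rotated f : Linfty_circle f ->
  haar (fun x => (expcos (2 * kappa) s' x)%:C * f x) / (besselI0 (2 * kappa))%:C =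
  haar (fun x => koopman alpha t f x * (von_mises theta (2 * kappa) x)%:C).
Proof.
move=> Lf; have k0 : 0 <= 2 * kappa by rewrite mulr_ge0// ltW.
have Lq := Linfty_expcos s' k0 Lf.
rewrite -(haar_shift (alpha * t) Lq) mulrC -haarZ.
  congr haar; apply/funext => x; rewrite /koopman /= /rotation /von_mises /expcos.
  rewrite (_ : x + alpha * t - s' = x - theta); last by ring.
  have realV (a c : R) : (a / c)%:C = a%:C / c%:C :> C by exact: fmorph_div.
  by rewrite realV; ring.
case: (Lq) => pq mR mI _.
have [iR iI] := Linfty_integrable (0 + alpha * t) (2 * pi + alpha * t) Lq.
by split; [exact: (integrable_shift mR iR)|exact: (integrable_shift mI iI)].
Qed.

End Limit.

Unset Implicit Arguments.

Theorem theorem12 (R : realType) (alpha p kappa t : R)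
    (halpha : 0 < alpha) (hp : 0 < p < 1) (hkappa : 0 < kappa) :
  exists c1 c2 : R, [/\ 0 < c1, 0 < c2 &
    forall (m : nat) (s : scheme R) (w : nat -> R) (f : R -> R[i]) (theta : R),
      (2 * 2 + 1 <= m)%N -> admissible alpha s -> positive_unit w ->
      Linfty_circle f ->
      (\forall eps \near 0^'+,
         fock_expectation p alpha s w kappa (c2 * eps ^+ 2)
           (ceil_nat (c1 / eps)) 2 m t theta (fun=> 1) != 0) /\
      fock_approx p alpha s w kappa (c2 * eps ^+ 2)
          (ceil_nat (c1 / eps)) 2 m t theta f @[eps --> 0^'+]
        --> (haar (fun x => koopman alpha t f x * (von_mises theta (2 * kappa) x)%:C)
              : complex_field R)].
Proof.
(* The phase errors vanish with [tau] and all other errors are [O(1/n)], so both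
   constants can be [1]. *)
exists 1, 1; split=> // m s w f theta m5 hs [w0 _] Lf.
have jf := Linfty_cintegrable Lf; have j1 := @cintegrable_cst R 1.
have k0 : 0 <= 2 * kappa by rewrite mulr_ge0// ltW.
have I0 : (besselI0 (2 * kappa))%:C != 0 :> R[i].
  by rewrite (inj_eq (@complexI R) _ 0) gt_eqF// (besselI0_gt0 theta).
have cf := @cvg_moment R p alpha kappa t theta halpha hkappa s f hs jf.
have c1 := @cvg_moment R p alpha kappa t theta halpha hkappa s _ hs j1.
rewrite (_ : haar (fun x => _ * 1) = (besselI0 (2 * kappa))%:C) in c1; last first.
  rewrite -(haar_expcos (theta + alpha * t) k0); congr haar.
  by apply/funext => x; rewrite mulr1.
have n1 : \forall eps \near 0^'+, moment p alpha kappa t theta s (fun=> 1) eps != 0.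
  exact: (@cvgr_neq0 (complex_field R) (complex_field R) _ _ _ _ _ c1 I0).
have KE eps := @fock_expectation_moment R p alpha kappa t theta hp hkappa
  s w m eps m5 hs w0.
have C0 (x : R) : 0 < x -> x%:C != 0 :> R[i].
  by move=> x0; rewrite (inj_eq (@complexI R) _ 0) gt_eqF.
split.
  near=> eps; have eps0 : 0 < eps by near: eps; exact: nbhs_right_gt.
  have [K K0 ->//] := KE eps eps0.
  by rewrite mulf_neq0 ?C0//; near: eps.
have hr := @haar_rotated R alpha kappa t theta hkappa f Lf.
rewrite -hr.
apply: (cvg_ratio _ cf c1 I0).
near=> eps; have eps0 : 0 < eps by near: eps; exact: nbhs_right_gt.
have [K K0 hK] := KE eps eps0.
by exists K%:C; [exact: C0|split; apply: hK].
Unshelve. all: by end_near. Qed.
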